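(* Let $r\geq 3$. Every quasi-linear, inconsistent $r$-graph $F$ which admits all inconsistent descriptive sequences of order $r$ satisfies $\pi_u(F)=\binom{r}{2}^{-\binom{r}{2}}$.
   Context: An $r$-graph is an $r$-uniform hypergraph. For an $r$-graph $H$ and $S\subseteq V(H)$, $e(S)$ is the number of edges of $H$ inside $S$. $H$ is $(d,\varepsilon)$-dense if every $S\subseteq V(H)$ with $|S|\geq\varepsilon|V(H)|$ has $e(S)\geq(d-\varepsilon)\binom{|S|}{r}$. A sequence $(H_n)$ of $r$-graphs is locally $d$-dense if there are $\varepsilon_n\to0$ with each $H_n$ $(d,\varepsilon_n)$-dense and $|V(H_n)|\to\infty$. $\pi_u(F)$ is the maximum $d$ such that some locally $d$-dense sequence of $r$-graphs avoids $F$ as a subgraph. A hypergraph $H$ is quasi-linear if for every edge $e$ there is a unique other edge $f$ (its twin) with $|e\cap f|=2$, and every edge $f'\notin\{e,f\}$ satisfies $|e\cap f'|\leq1$. Roles: given a linearly ordered set $S$ of $k$ elements sorted as $w_1\prec\dots\prec w_k$, a pair $\{u,v\}\subseteq S$ plays the role $\{i,j\}\in\binom{[k]}{2}$ in $S$ if $\{w_i,w_j\}=\{u,v\}$. A quasi-linear hypergraph with a linear vertex order is consistently ordered if for every twin pair $\{e,f\}$, the pair $e\cap f$ plays the same role in $e$ as in $f$. It is consistent if some vertex order makes it consistently ordered, and inconsistent otherwise. A descriptive sequence of order $k$ is a sequence $\sigma=(s_1,\dots,s_{2k-2})$ over $\{X,Y,Z\}$ with exactly $k-2$ letters $X$, $k-2$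 letters $Y$ and two letters $Z$. It is consistent if the pair of $Z$-positions plays the same role among the $k$ positions carrying $X$ or $Z$ as among the $k$ positions carrying $Y$ or $Z$ (positions ordered naturally), and inconsistent otherwise. Given a linearly ordered vertex set and two $k$-edges $e,f$ with $|e\cap f|=2$, sort $e\cup f$ as $w_1\prec\dots\prec w_{2k-2}$; $\sigma$ describes $\{e,f\}$ if either ($s_i=X$ iff $w_i\in e\setminus f$, $s_i=Y$ iff $w_i\in f\setminus e$, $s_i=Z$ iff $w_i\in e\cap f$) or the same holds with $e,f$ swapped. A quasi-linear hypergraph admits $\sigma$ if there is a linear order of its vertex set in which every twin pair of edges is described by $\sigma$. *)

(* Defs.v *)
From HB Require Import structures.
From mathcomp Require Import all_boot all_order all_algebra.
From mathcomp Require Import all_classical all_reals all_analysis.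

Set Implicit Arguments.
Unset Strict Implicit.
Unset Printing Implicit Defensive.

Import Order.TTheory GRing.Theory Num.Theory.
Import numFieldNormedType.Exports.

Local Open Scope ring_scope.
Local Open Scope classical_set_scope.

Record hypergraph (r : nat) := Hypergraph {
  vertex :> finType;
  edges : {set {set vertex}};
  card_edge : forall e, e \in edges -> #|e| = r }.

Definition edges_inside (r : nat) (H : hypergraph r) (S : {set H}) : {set {set H}} :=
  [set e in edges H | e \subset S]%SET.

Definition contains (r : nat) (H F : hypergraph r) : Prop :=
  exists2 f : F -> H, injective f &
    forall e : {set F}, e \in edges F -> f @: e \in edges H.

Definition eps_dense (R : realType) (r : nat) (d eps : R) (H : hypergraph r) : Prop :=
  forall S : {set H}, eps * #|vertex H|%:R <= #|S|%:R ->
    (d - eps) * 'C(#|S|, r)%:R <= #|edges_inside S|%:R.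

Definition locally_dense (R : realType) (r : nat) (d : R)
    (H : nat -> hypergraph r) : Prop :=
  (exists2 eps : nat -> R, eps n @[n --> \oo] --> (0 : R) &
     forall n, eps_dense d (eps n) (H n)) /\
  #|vertex (H n)| @[n --> \oo] --> \oo.

Definition avoidable_density (R : realType) (r : nat) (F : hypergraph r)
    (d : R) : Prop :=
  exists2 H : nat -> hypergraph r, locally_dense d H & forall n, ~ contains (H n) F.

(* [pi_u_eq F d] reads "pi_u(F) = d". As pi_u is defined as a maximum, this
   includes that the value [d] is attained. *)
Definition pi_u_eq (R : realType) (r : nat) (F : hypergraph r) (d : R) : Prop :=
  avoidable_density F d /\ forall d' : R, avoidable_density F d' -> d' <= d.

Definition twins (r : nat) (H : hypergraph r) (e f : {set H}) : Prop :=
  [/\ e \in edges H, f \in edges H, e != f & #|e :&: f| = 2%N].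

Definition quasi_linear (r : nat) (H : hypergraph r) : Prop :=
  forall e : {set H}, e \in edges H ->
    exists f : {set H}, unique (twins e) f /\
      forall f' : {set H}, f' \in edges H -> f' \notin [set e; f]%SET ->
        (#|e :&: f'| <= 1)%N.

Definition linear_order (T : Type) (le : rel T) : Prop :=
  [/\ reflexive le, antisymmetric le, transitive le & total le].

Definition listing (T : finType) (le : rel T) (S : {set T}) : seq T :=
  sort le (enum S).

(* For #|S| = k and p = {u, v} \subset S, this is the role of p in S: the set
   {i, j} of positions of u and v in S. Positions are numbered from 0. *)
Definition role (T : finType) (le : rel T) (k : nat) (S p : {set T}) :
    {set 'I_k} :=
  [set i : 'I_k | [exists x in p, index x (listing le S) == i]]%SET.

Definition consistently_ordered (r : nat) (H : hypergraph r) (le : rel H) : Prop :=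
  forall e f : {set H}, twins e f ->
    role le r e (e :&: f) = role le r f (e :&: f).

Definition consistent (r : nat) (H : hypergraph r) : Prop :=
  exists2 le : rel H, linear_order le & consistently_ordered le.

Inductive letter := LX | LY | LZ.

Definition letter_code (l : letter) : option bool :=
  match l with LX => Some true | LY => Some false | LZ => None end.
Definition letter_decode (o : option bool) : letter :=
  match o with Some true => LX | Some false => LY | None => LZ end.
Lemma letter_codeK : cancel letter_code letter_decode. Proof. by case. Qed.
HB.instance Definition _ := Equality.copy letter (can_type letter_codeK).

Definition descriptive (k : nat) (s : (2 * k - 2).-tuple letter) : bool :=
  [&& count_mem LX s == (k - 2)%N, count_mem LY s == (k - 2)%N
    & count_mem LZ s == 2%N].

Definition consistent_seq (k : nat) (s : (2 * k - 2).-tuple letter) : bool :=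
  let le (i j : 'I_(2 * k - 2)) := (i <= j)%N in
  let XZ := [set i | (tnth s i == LX) || (tnth s i == LZ)]%SET in
  let YZ := [set i | (tnth s i == LY) || (tnth s i == LZ)]%SET in
  let ZZ := [set i | tnth s i == LZ]%SET in
  role le k XZ ZZ == role le k YZ ZZ.

(* Only applied to vertices of e :|: f. *)
Definition vertex_letter (T : finType) (e f : {set T}) (x : T) : letter :=
  if x \in e :&: f then LZ else if x \in e then LX else LY.

Definition describes (T : finType) (le : rel T) (k : nat)
    (s : (2 * k - 2).-tuple letter) (e f : {set T}) : Prop :=
  tval s = map (vertex_letter e f) (listing le (e :|: f)) \/
  tval s = map (vertex_letter f e) (listing le (e :|: f)).

Definition admits (r : nat) (H : hypergraph r) (s : (2 * r - 2).-tuple letter) :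
    Prop :=
  exists2 le : rel H, linear_order le &
    forall e f : {set H}, twins e f -> describes le s e f.

(* Main.v *)
(* Write K = C(r,2).

   Lower bound.  Colour the pairs of an ordered vertex set by the K roles and
   let an r-set be an edge when each of its pairs has the colour of its own
   role.  In a copy of a quasi-linear F the colour of e :&: f is its role both in
   e and in f, so F would be consistent.  When the colouring is quasirandom,
   replacing one colour condition after the other by its density 1/K shows that
   every large set has edge density K^-K.

   Upper bound.  Split a dense H into many parts and pass to sub-boxes on which,
   for every r-set A of parts and every pair p in A, the crossing edges are
   regular over the coordinates A :\: p.  Let G_{A,p} be the set of pairs of
   vertices contained in a positive proportion of these edges.  By Ramsey's
   theorem the densities of G_{A,p} and of G_{A,p} :&: G_{B,p}, where
   A :&: B = p, depend only on the relative order of A and B.  If some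
   intersection with different roles of p in A and B has positive density, the
   order in which F admits the corresponding inconsistent sequence embeds F.
   Otherwise the K graphs on p, one for each role, are almost disjoint, so that
   their densities sum to at most 1 + o(1); by AM-GM the density of crossing
   edges is at most K^-K + o(1). *)

(* The obstacle is that full hypergraph regularity would control far more than is required. Around
   an edge A with twin B, the other edges of F meet A in at most one vertex, and B meets it in p. So
   the only tests that A has to pass are products of sides over [A :\: p], times an arbitrary
   function of the remaining coordinates. Regularity against these tests survives passing to a
   sub-box, and one sub-box is enough, since local density constrains every large vertex set: one
   large set with too many non-edges is already a contradiction. Hence an energy increment follows a
   single cell, no partition is kept, and volumes drop by a constant factor.

   Only crossing sets are controlled, so sparsity is a lower bound on the number of non-edges, and
   the parts kept by Ramsey's theorem must be numerous enough to make non-crossing r-sets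
   negligible.

   Densities are rounded to multiples of 1/L before Ramsey's theorem is applied; the same threshold
   1/L separates the case of a copy of F from the case of almost disjoint graphs. *)
Require Import Defs.
From HB Require Import structures.
From mathcomp Require Import all_boot all_order all_algebra.
From mathcomp Require boolp.
From mathcomp Require Import ring lra zify.
Set Implicit Arguments.
Unset Strict Implicit.
Unset Printing Implicit Defensive.
Import Order.TTheory GRing.Theory Num.Theory.
Local Open Scope ring_scope.
(** * Boxes and cylinder regularity *)

Section Boxes.
Variables (R : realFieldType) (I T : finType).
Implicit Types (V W : I -> {set T}) (x y z : {ffun I -> T}) (K D : {set I}).

Definition vol V : nat := \prod_i #|V i|.

Definition dep D (U : Type) (f : {ffun I -> T} -> U) :=
  forall x y, {in D, x =1 y} -> f x = f y.

Definition merge K x y : {ffun I -> T} :=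
  [ffun i => if i \in K then y i else x i].

Definition avg V K (h : {ffun I -> T} -> R) x : R :=
  (\sum_(y in family V) h (merge K x y)) / (vol V)%:R.

Lemma card_box V : #|family V| = vol V.
Proof. by rewrite card_family /vol foldrE big_map big_enum. Qed.

Lemma vol_gt0 V : (0 < vol V)%N = [forall i, (0 < #|V i|)%N].
Proof.
apply/idP/forallP => [h i|h]; last by apply: prodn_gt0.
by move: h; rewrite /vol (bigD1 i) //= muln_gt0 => /andP[].
Qed.

Lemma merge_box V K x y :
  x \in family V -> y \in family V -> merge K x y \in family V.
Proof.
move=> /familyP hx /familyP hy; apply/familyP => i; rewrite ffunE.
by case: ifP.
Qed.

Lemma merge_swapK K x y : merge K (merge K x y) (merge K y x) = x.
Proof. by apply/ffunP => i; rewrite !ffunE; case: (i \in K). Qed.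

(** Exchanging the [K]-entries of two tuples is an involution of the square of the box. This
    replaces Fubini's theorem for the split of the coordinates into [K] and its complement. *)
Lemma sum_swap V K (F : {ffun I -> T} -> {ffun I -> T} -> R) :
  \sum_(x in family V) \sum_(y in family V) F x y =
  \sum_(x in family V) \sum_(y in family V) F (merge K x y) (merge K y x).
Proof.
rewrite !pair_big /=.
pose sw (p : {ffun I -> T} * {ffun I -> T}) := (merge K p.1 p.2, merge K p.2 p.1).
have swK : involutive sw by case=> x y; rewrite /sw /= !merge_swapK.
rewrite (reindex_inj (can_inj swK)); apply: eq_bigl => -[x y] /=.
apply/andP/andP => -[hx hy]; last by split; apply: merge_box.
have := merge_box K hx hy; have := merge_box K hy hx.
by rewrite !merge_swapK => -> ->.
Qed.

Lemma dep_sub D D' (U : Type) (f : {ffun I -> T} -> U) :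
  D \subset D' -> dep D f -> dep D' f.
Proof. by move=> /subsetP sD df x y e; apply: df => i /sD /e. Qed.

Lemma dep_comp D (U U' : Type) (g : U -> U') (f : {ffun I -> T} -> U) :
  dep D f -> dep D (fun x => g (f x)).
Proof. by move=> df x y /df ->. Qed.

Lemma dep_comp2 D (U1 U2 U' : Type) (g : U1 -> U2 -> U') f1 f2 :
  @dep D U1 f1 -> @dep D U2 f2 -> dep D (fun x => g (f1 x) (f2 x)).
Proof. by move=> d1 d2 x y e; rewrite (d1 x y e) (d2 x y e). Qed.

Lemma avg_dep V D K h : dep D h -> dep (D :\: K) (avg V K h).
Proof.
move=> dh x y e; rewrite /avg; congr (_ / _); apply: eq_bigr => z _.
apply: dh => i iD; rewrite !ffunE; case: ifP => // /negbT iK.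
by apply: e; rewrite inE iK.
Qed.

Lemma avg_depC V K h : dep (~: K) (avg V K h).
Proof. by rewrite -setTD; apply: avg_dep => x y e; congr h; apply/ffunP => i; apply: e. Qed.

Lemma sum_const_box V (c : R) : \sum_(x in family V) c = (vol V)%:R * c.
Proof. by rewrite big_const iter_addr addr0 card_box mulr_natl. Qed.

(** [avg] acts as a conditional expectation: resampling the [K]-entries of [x] preserves the double
    sum, and [l] does not notice it. In an empty box both sides are empty sums. *)
Lemma sum_avg V K (l h : {ffun I -> T} -> R) : dep (~: K) l ->
  \sum_(x in family V) l x * h x = \sum_(x in family V) l x * avg V K h x.
Proof.
move=> dl; case: (posnP (vol V)) => [v0|v0].
  have e0 : family V =i pred0 by apply/card0_eq; rewrite card_box.
  by rewrite !big_pred0.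
have vn : (vol V)%:R != 0 :> R by rewrite pnatr_eq0 -lt0n.
apply: (mulfI vn).
have -> : (vol V)%:R * (\sum_(x in family V) l x * h x) =
    \sum_(x in family V) \sum_(y in family V) l x * h x.
  by rewrite mulr_sumr; apply: eq_bigr => x _; rewrite sum_const_box.
rewrite (sum_swap V K) mulr_sumr; apply: eq_bigr => x _.
rewrite /avg mulrCA [_%:R * _]mulrC divfK // mulr_sumr; apply: eq_bigr => y _.
congr (_ * _); apply: dl => i; rewrite inE => /negbTE iK.
by rewrite ffunE iK.
Qed.

Lemma sum_bounds V (f : {ffun I -> T} -> R) (a b : R) :
  (forall x, a <= f x <= b) ->
  a * (vol V)%:R <= \sum_(x in family V) f x <= b * (vol V)%:R.
Proof.
move=> h; rewrite ![_ * (vol V)%:R]mulrC -!sum_const_box.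
by apply/andP; split; apply: ler_sum => x _; case/andP: (h x).
Qed.

Lemma avg_bounds V K h (x : {ffun I -> T}) :
  (forall x, 0 <= h x <= 1) -> 0 <= avg V K h x <= 1.
Proof.
move=> h01; have /andP[a b] := sum_bounds V (fun y => h01 (merge K x y)).
case: (posnP (vol V)) => [v0|v0]; rewrite /avg; first by rewrite v0 invr0 mulr0 lexx ler01.
rewrite mul0r in a; rewrite mul1r in b.
by rewrite divr_ge0 //= ler_pdivrMr ?ltr0n // mul1r.
Qed.

Lemma sub_box V W : (forall i, V i \subset W i) -> {subset family V <= family W}.
Proof. by move=> h x /familyP hx; apply/familyP => i; exact: (subsetP (h i)). Qed.
End Boxes.

Section Cells.
Variables (R : realFieldType) (I T : finType).
Implicit Types (V X : I -> {set T}) (x y z : {ffun I -> T}) (K D s : {set I}).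

Definition cell V X s i := if i \in s then V i :&: X i else V i :\: X i.

Definition cell_of X x := [set i | x i \in X i].

Lemma in_cell V X s x :
  (x \in family (cell V X s)) = (x \in family V) && (cell_of X x == s).
Proof.
apply/familyP/andP => [h|[/familyP h /eqP <-] i].
  split; first by apply/familyP => i; have := h i; rewrite /cell; case: ifP => _; rewrite inE => /andP[].
  apply/eqP/setP => i; have := h i; rewrite /cell /cell_of inE.
  by case: ifP => _; rewrite inE => /andP[] // /negbTE.
by rewrite /cell /cell_of inE; case: ifPn => hx; rewrite inE h ?hx.
Qed.

Lemma sum_cells V X (F : {set I} -> {ffun I -> T} -> R) :
  \sum_s \sum_(x in family (cell V X s)) F s x =
  \sum_(x in family V) F (cell_of X x) x.
Proof.
rewrite [RHS](partition_big (cell_of X) xpredT) //=; apply: eq_bigr => s _.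
rewrite (eq_bigl _ _ (in_cell V X s)); apply: eq_bigr => x /andP[_ /eqP->] //.
Qed.

Lemma cell_sub V X s i : cell V X s i \subset V i.
Proof. by rewrite /cell; case: ifP => _; rewrite ?subsetIl ?subsetDl. Qed.

Definition in_rect K X x : bool := [forall k in K, x k \in X k].

(** A cut-norm condition: arbitrary tests off [K], but only rectangles on [K]. The approximation [w]
    is a parameter because the condition is transferred to smaller boxes, where [w] is no longer the
    average of [h]. *)
Definition regular_on V K (h w : {ffun I -> T} -> R) (eps : R) :=
  forall (G : {ffun I -> T} -> R) X, dep (~: K) G -> (forall x, `|G x| <= 1) ->
  \sum_(x in family V) (h x - w x) * (G x * (in_rect K X x)%:R) <= eps * (vol V)%:R.

(* The energy of a box is the maximum of the left-hand side over all l that do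
   not depend on K, attained at the average of h: this makes it superadditive
   under subdivision without any convexity argument. *)
Lemma energy_var V K (h l : {ffun I -> T} -> R) : dep (~: K) l ->
  \sum_(x in family V) (2 * (l x * h x) - l x ^+ 2) <=
  \sum_(x in family V) avg V K h x ^+ 2.
Proof.
move=> dl; rewrite sumrB -mulr_sumr (sum_avg V _ dl) mulr_sumr -sumrB.
apply: ler_sum => x _; set a := avg _ _ _ _; have := sqr_ge0 (l x - a); nra.
Qed.

Lemma energy_eq V K (h : {ffun I -> T} -> R) :
  \sum_(x in family V) (2 * (avg V K h x * h x) - avg V K h x ^+ 2) =
  \sum_(x in family V) avg V K h x ^+ 2.
Proof.
rewrite sumrB -mulr_sumr (sum_avg V _ (@avg_depC _ _ _ V K h)).
by rewrite mulr_sumr -sumrB; apply: eq_bigr => x _; ring.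
Qed.
End Cells.

Section Regularity.
Variables (R : realFieldType) (I T A : finType).
Variables (h : A -> {ffun I -> T} -> R) (K : A -> {set I}).
Hypothesis h01 : forall a x, 0 <= h a x <= 1.
Implicit Types (V X : I -> {set T}).

Definition energy V : R := \sum_a \sum_(x in family V) avg V (K a) (h a) x ^+ 2.

Lemma energy_le V : energy V <= #|A|%:R * (vol V)%:R.
Proof.
rewrite mulr_natl -sumr_const; apply: ler_sum => a _.
rewrite -[leRHS]mulr1 -sum_const_box; apply: ler_sum => x _.
by have /andP[? ?] := avg_bounds V (K a) x (h01 a); rewrite expr_le1.
Qed.

Lemma energy_increment V a0 (G : {ffun I -> T} -> R) X (eps : R) :
  0 < eps -> dep (~: K a0) G -> (forall x, `|G x| <= 1) ->
  eps * (vol V)%:R < \sum_(x in family V) (h a0 x - avg V (K a0) (h a0) x) *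
     (G x * (in_rect (K a0) X x)%:R) ->
  exists Y, energy V + eps ^+ 2 * (vol V)%:R <= \sum_s energy (cell V Y s).
Proof.
move=> e0 dG G1 viol; pose Y k := if k \in K a0 then X k else setT.
exists Y.
(* The cell of index [setT] is the violating rectangle. Shifting the old average there by [eps * G]
   gains twice [eps] times the violation, which exceeds [2 * eps ^+ 2 * vol V], and the square costs
   at most [eps ^+ 2 * vol V]. *)
pose l (s : {set I}) a x := avg V (K a) (h a) x + ((s == setT) && (a == a0))%:R * (eps * G x).
have dl s a : dep (~: K a) (l s a).
  apply: dep_comp2; first exact: avg_depC.
  case: (a =P a0) => [->|_]; last by rewrite andbF => x y _; rewrite !mul0r.
  by move=> x y e; rewrite (dG x y e).
have cellT x : (cell_of Y x == setT) = in_rect (K a0) X x.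
  apply/eqP/forallP => [/setP e k|e].
    by apply/implyP => kK; have := e k; rewrite !inE /Y kK => ->.
  apply/setP => k; rewrite !inE /Y; case: ifP => kK; last by rewrite inE.
  by have := e k; rewrite kK.
rewrite /energy [leRHS]exchange_big /= (bigD1 a0) //= [leRHS](bigD1 a0) //= addrAC.
apply: lerD; last first.
  apply: ler_sum => a /negbTE na; rewrite -energy_eq.
  pose F (s : {set I}) x := 2 * (l s a x * h a x) - l s a x ^+ 2.
  have -> : \sum_(x in family V) (2 * (avg V (K a) (h a) x * h a x) -
     avg V (K a) (h a) x ^+ 2) = \sum_(x in family V) F (cell_of Y x) x.
    by apply: eq_bigr => x _; rewrite /F /l na andbF mul0r addr0.
  by rewrite -sum_cells; apply: ler_sum => s _; apply: energy_var.
pose F (s : {set I}) x := 2 * (l s a0 x * h a0 x) - l s a0 x ^+ 2.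
apply: (@le_trans _ _ (\sum_(x in family V) F (cell_of Y x) x)); last first.
  by rewrite -sum_cells; apply: ler_sum => s _; apply: energy_var.
rewrite -energy_eq -lerBrDl -sumrB.
have viol2 : eps ^+ 2 * (vol V)%:R <= 2 * eps * (\sum_(x in family V)
   (h a0 x - avg V (K a0) (h a0) x) * (G x * (in_rect (K a0) X x)%:R))
   - \sum_(x in family V) eps ^+ 2.
  rewrite sum_const_box; have := ltW viol; set S := \sum_(_ in _) _ => vs.
  have : eps * (eps * (vol V)%:R) <= eps * S by rewrite ler_pM2l.
  by lra.
apply: le_trans viol2 _; rewrite mulr_sumr -sumrB; apply: ler_sum => x _.
rewrite /F /l cellT eqxx andbT; set a := avg _ _ _ _.
case: (in_rect _ _ _); rewrite /= ?mulr1 ?mulr0 ?mul0r ?mul1r.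
  have : G x ^+ 2 <= 1 by rewrite -[G x ^+ 2]ger0_norm ?sqr_ge0 // normrX expr_le1.
  have : 0 <= eps ^+ 2 by rewrite sqr_ge0.
  nra.
by have := sqr_ge0 eps; lra.
Qed.

(** Chosen so that all cells below this share together carry at most half of the energy increment:
    there are [2 ^ #|I|] cells, of mean energy at most [#|A|]. The successor keeps the denominator
    nonzero for empty [A]. *)
Definition cell_share (eps : R) : R := eps ^+ 2 / (2 * (2 ^ #|I|)%:R * #|A|.+1%:R).

Lemma cell_share_gt0 eps : 0 < eps -> 0 < cell_share eps.
Proof.
move=> e0; rewrite /cell_share divr_gt0 ?exprn_gt0 // !mulr_gt0 ?ltr0n //.
by rewrite expn_gt0.
Qed.

Lemma cell_share_le1 eps : 0 < eps -> eps <= 1 -> cell_share eps <= 1.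
Proof.
move=> e0 e1; rewrite /cell_share ler_pdivrMr ?mul1r; last first.
  by rewrite !mulr_gt0 ?ltr0n ?expn_gt0.
apply: (@le_trans _ _ 1); first by rewrite expr_le1 // ltW.
by rewrite -!natrM ler1n !muln_gt0 expn_gt0.
Qed.

(** Half of the increment pays for the cells of small share, the other half is the gain in mean
    energy asked of the rest. If no cell were both large and richer, the total energy would fall
    short. *)
Lemma pick_cell V X (eps : R) : 0 < eps -> (0 < vol V)%N ->
  energy V + eps ^+ 2 * (vol V)%:R <= \sum_s energy (cell V X s) ->
  exists s, cell_share eps * (vol V)%:R <= (vol (cell V X s))%:R /\
    (energy V / (vol V)%:R + eps ^+ 2 / 2) * (vol (cell V X s))%:R
      <= energy (cell V X s).
Proof.
move=> e0 N0 inc; apply: boolp.contrapT => /boolp.forallNP none.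
set N := (vol V)%:R in inc none *; have N0r : 0 < N by rewrite ltr0n.
pose c := energy V / N + eps ^+ 2 / 2.
have sumN : \sum_s (vol (cell V X s))%:R = N :> R.
  have := sum_cells V X (fun _ _ => 1%R : R); rewrite sum_const_box mulr1 -/N => <-.
  by apply: eq_bigr => s _; rewrite sum_const_box mulr1.
have e_ge0 : 0 <= energy V.
  by apply: sumr_ge0 => a _; apply: sumr_ge0 => x _; exact: sqr_ge0.
have c0 : 0 <= c by rewrite addr_ge0 ?divr_ge0 ?(ltW N0r) ?sqr_ge0.
have bound : \sum_s energy (cell V X s) <
    \sum_s (c * (vol (cell V X s))%:R + #|A|.+1%:R * (cell_share eps * N)).
  apply: ltr_sum => [|s _].
    by apply/hasP; exists set0; rewrite ?mem_index_enum.
  have /boolp.not_andP[/negP|/negP] := none s; rewrite -ltNge; [move=> small|move=> lt_e].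
    apply: (le_lt_trans (energy_le _)); apply: (ltr_wpDl (mulr_ge0 c0 (ler0n _ _))).
    apply: (@le_lt_trans _ _ (#|A|.+1%:R * (vol (cell V X s))%:R)).
      by rewrite ler_wpM2r // ler_nat.
    by rewrite ltr_pM2l ?ltr0n.
  apply: ltr_wpDr lt_e.
  exact: mulr_ge0 (ler0n _ _) (mulr_ge0 (ltW (cell_share_gt0 e0)) (ltW N0r)).
move: bound; rewrite big_split /= -mulr_sumr sumN sumr_const.
have -> : #|{: {set I}}| = (2 ^ #|I|)%N by rewrite -(cardsT I) -card_powerset powersetT cardsT.
rewrite -[_ *+ _]mulr_natr /cell_share.
set P := (2 ^ #|I|)%:R; set B := #|A|.+1%:R.
have P0 : P != 0 by rewrite pnatr_eq0 -lt0n expn_gt0.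
have B0 : B != 0 by rewrite pnatr_eq0.
have -> : B * (eps ^+ 2 / (2 * P * B) * N) * P = eps ^+ 2 / 2 * N by clearbody P B; field; rewrite P0 B0.
have eN : energy V / N * N = energy V by rewrite divfK ?gt_eqF.
by rewrite /c mulrDl eN => bound; move: bound inc; lra.
Qed.

(** The mean energy lies between 0 and [#|A|] and rises by [eps ^+ 2 / 2] with every passage to a
    cell, so [J] passages suffice. *)
Theorem cylinder_regularity (eps : R) (J : nat) V : 0 < eps -> eps <= 1 ->
  #|A|%:R <= J%:R * (eps ^+ 2 / 2) -> (0 < vol V)%N ->
  exists W : I -> {set T}, [/\ forall i, W i \subset V i,
    cell_share eps ^+ J * (vol V)%:R <= (vol W)%:R, (0 < vol W)%N &
    forall a, regular_on W (K a) (h a) (avg W (K a) (h a)) eps].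
Proof.
move=> e0 e1 hJ; have d0 := cell_share_gt0 e0; have d1 := cell_share_le1 e0 e1.
have step V' : (0 < vol V')%N ->
    ~ (forall a, regular_on V' (K a) (h a) (avg V' (K a) (h a)) eps) ->
    exists W : I -> {set T}, [/\ forall i, W i \subset V' i,
      cell_share eps * (vol V')%:R <= (vol W)%:R, (0 < vol W)%N &
      (energy V' / (vol V')%:R + eps ^+ 2 / 2) * (vol W)%:R <= energy W].
  move=> N0 /boolp.existsNP[a] /boolp.existsNP[G] /boolp.existsNP[X].
  move=> /boolp.not_implyP[dG] /boolp.not_implyP[G1] /negP; rewrite -ltNge => viol.
  have [Y inc] := energy_increment e0 dG G1 viol.
  have [s [big en]] := pick_cell e0 N0 inc.
  exists (cell V' Y s); split => //; first by move=> i; exact: cell_sub.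
  by rewrite -(ltr0n R); apply: lt_le_trans big; rewrite mulr_gt0 ?ltr0n.
(* Here [j] bounds the number of passages still possible from [V']; at [j = 0] a further one would
   push the mean energy above [#|A|]. *)
suff main j V' : (0 < vol V')%N ->
    (#|A|%:R - j%:R * (eps ^+ 2 / 2)) * (vol V')%:R <= energy V' ->
  exists W : I -> {set T}, [/\ forall i, W i \subset V' i,
    cell_share eps ^+ j * (vol V')%:R <= (vol W)%:R, (0 < vol W)%N &
    forall a, regular_on W (K a) (h a) (avg W (K a) (h a)) eps].
  move=> V0; apply: main => //; apply: (@le_trans _ _ 0).
    by rewrite mulr_le0_ge0 ?subr_le0.
  by apply: sumr_ge0 => a _; apply: sumr_ge0 => x _; exact: sqr_ge0.
elim: j V' => [|j IH] V' N0 he.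
  have [reg|/(step _ N0)[W [_ _ W0 hW]]] :=
      boolp.EM (forall a, regular_on V' (K a) (h a) (avg V' (K a) (h a)) eps).
    by exists V'; split => //; rewrite expr0 mul1r.
  have N0r : 0 < (vol V')%:R :> R by rewrite ltr0n.
  have W0r : 0 < (vol W)%:R :> R by rewrite ltr0n.
  have := le_trans hW (energy_le W); rewrite ler_pM2r //.
  move: he; rewrite mul0r subr0 -ler_pdivlMr // => he hc.
  by have := exprn_gt0 2 e0; lra.
have [reg|/(step _ N0)[W [WV Wbig W0 hW]]] :=
    boolp.EM (forall a, regular_on V' (K a) (h a) (avg V' (K a) (h a)) eps).
  by exists V'; split => //; rewrite ler_piMl // exprn_ile1 // ltW.
have [|W' [W'W W'big W'0 reg]] := IH W W0.
  apply: le_trans hW; rewrite ler_wpM2r //.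
  by move: he; rewrite -ler_pdivlMr ?ltr0n // -natr1; lra.
exists W'; split => //; first by move=> i; apply: subset_trans (WV i).
by apply: le_trans W'big; rewrite exprSr -mulrA ler_wpM2l // exprn_ge0 // ltW.
Qed.
End Regularity.

(** * Admissible test functions and replacement of conditions one at a time *)

Section TestFunctions.
Variables (R : realFieldType) (I T : finType).
Implicit Types (V W X : I -> {set T}) (x y z : {ffun I -> T}) (K D : {set I}).
Implicit Types (h w : {ffun I -> T} -> R) (u v : {ffun I -> T} -> bool).

Lemma regular_abs V K h w eps (G : {ffun I -> T} -> R) X :
  regular_on V K h w eps -> dep (~: K) G -> (forall x, `|G x| <= 1) ->
  `|\sum_(x in family V) (h x - w x) * (G x * (in_rect K X x)%:R)| <= eps * (vol V)%:R.
Proof.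
move=> reg dG G1; rewrite ler_norml reg // andbT lerNl -sumrN.
have := reg (fun x => - G x) X; under eq_bigr do rewrite mulNr mulrN.
apply; first exact: dep_comp.
by move=> x; rewrite normrN.
Qed.

(** The indicator of [W] is absorbed by the test: its sides off [K] join [G], those in [K] shrink
    the rectangle. The sum is unchanged and only the normalisation differs. *)
Lemma regular_sub V W K h w e1 e2 : (forall i, W i \subset V i) ->
  e1 * (vol V)%:R <= e2 * (vol W)%:R ->
  regular_on V K h w e1 -> regular_on W K h w e2.
Proof.
move=> WV le reg G X dG G1; apply: le_trans le.
pose G' x := G x * [forall i in ~: K, x i \in W i]%:R.
pose X' k := X k :&: W k.
have := reg G' X'; set S := \sum_(_ in _) _ => hS.
have dG' : dep (~: K) G'.
  move=> x y e; rewrite /G' (dG x y e); congr (_ * (nat_of_bool _)%:R).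
  by apply/forall_inP/forall_inP => a i iK; have := a i iK; rewrite (e i iK).
have G'1 x : `|G' x| <= 1.
  by rewrite /G'; case: [forall i in ~: K, x i \in W i]; rewrite ?mulr1 ?mulr0 ?normr0.
apply: le_trans (hS dG' G'1); rewrite /S {hS S}.
rewrite [leLHS]big_mkcond [leRHS]big_mkcond /=.
rewrite le_eqVlt; apply/orP; left; apply/eqP; apply: eq_bigr => x _.
case: (boolP (x \in family V)) => [xV|xV]; last first.
  by case: ifP => // /(sub_box WV) h'; rewrite h' in xV.
rewrite /G' -mulrA -natrM mulnb.
have -> : [forall i in ~: K, x i \in W i] && in_rect K X' x =
   (x \in family W) && in_rect K X x.
  apply/andP/andP => [[/forall_inP o /forall_inP k]|[/familyP b /forall_inP k]].
    split; last by apply/forall_inP => i /k; rewrite inE => /andP[].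
    apply/familyP => i; have [/k|iK] := boolP (i \in K); first by rewrite inE => /andP[].
    by apply: o; rewrite inE.
  split; apply/forall_inP => i iK; first exact: b.
  by rewrite inE k // b.
by case: ifP => _; rewrite /= ?mulr0.
Qed.

(** In the uses, [D] is either the index set of an edge and [K] what remains of it after removing a
    pair, or both are the pair. A mild [u] may depend on coordinates off [D] in any way, since these
    are frozen at [z]. *)
Definition mild D K u :=
  forall z, exists G : {ffun I -> T} -> bool, exists X, dep (~: K) G /\
    forall x, u (merge D z x) = G x && in_rect K X x.

Lemma mild_and D K u v : mild D K u -> mild D K v -> mild D K (fun x => u x && v x).
Proof.
move=> mu mv z; have [G [X [dG eG]]] := mu z; have [G' [X' [dG' eG']]] := mv z.
exists (fun x => G x && G' x), (fun k => X k :&: X' k); split; first exact: dep_comp2.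
move=> x; rewrite eG eG' andbACA; congr (_ && _).
apply/andP/forall_inP => [[/forall_inP a /forall_inP b] k kK|a].
  by rewrite inE a ?b.
by split; apply/forall_inP => k /a; rewrite inE => /andP[].
Qed.

Lemma mild_disjoint D K D' u : dep D' u -> [disjoint D' & K] -> mild D K u.
Proof.
move=> du dj z; exists (fun x => u (merge D z x)), (fun=> setT); split.
  move=> x y e; apply: du => i iD'; rewrite !ffunE; case: ifP => // _.
  by apply: e; rewrite inE (disjointFr dj iD').
move=> x; suff -> : in_rect K (fun=> setT) x by rewrite andbT.
by apply/forall_inP => k _; rewrite inE.
Qed.

Lemma mild_meet1 D K D' u : dep D' u -> K \subset D -> (#|D' :&: D| <= 1)%N ->
  mild D K u.
Proof.
move=> du KD; rewrite leq_eqVlt ltnS leqn0 cards_eq0 => /orP[/cards1P[k ek]|/eqP e0]; last first.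
  apply: (mild_disjoint _ du); rewrite -setI_eq0 -subset0 -e0.
  by apply/setIS.
have [kK|kK] := boolP (k \in K); last first.
  apply: (mild_disjoint _ du); rewrite -setI_eq0 -subset0; apply/subsetP => i.
  rewrite inE => /andP[iD' iK]; have : i \in D' :&: D by rewrite inE iD' (subsetP KD).
  by rewrite ek inE => /eqP ik; rewrite -ik iK in kK.
move=> z; exists (fun=> true).
exists (fun j => if j == k then [set t | u (merge D z [ffun=> t])] else setT).
split => // x /=.
have -> : u (merge D z x) = u (merge D z [ffun=> x k]).
  apply: du => i iD'; rewrite !ffunE; case: ifP => // iD.
  have : i \in D' :&: D by rewrite inE iD' iD.
  by rewrite ek inE => /eqP ->.
apply/idP/forall_inP => [h j _|/(_ k kK)]; last by rewrite eqxx inE.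
by case: eqP => [->|]; rewrite inE.
Qed.

(* Freezing the coordinates off D does not affect h - w and turns u into a
   test function of [regular_on]. *)
Lemma regular_mild V K D h w eps u : dep D h -> dep D w ->
  regular_on V K h w eps -> mild D K u ->
  `|\sum_(x in family V) (h x - w x) * (u x)%:R| <= eps * (vol V)%:R.
Proof.
move=> dh dw reg mu.
have [v0|v0] := posnP (vol V).
  have e0 : family V =i pred0 by apply/card0_eq; rewrite card_box.
  by rewrite big_pred0 // v0 mulr0 normr0.
have vp : 0 < (vol V)%:R :> R by rewrite ltr0n.
rewrite -(ler_pM2l vp) -[X in X * `|_|]ger0_norm ?ler0n // -normrM.
have -> : (vol V)%:R * (\sum_(x in family V) (h x - w x) * (u x)%:R) =
    \sum_(z in family V) \sum_(x in family V) (h x - w x) * (u (merge D z x))%:R.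
  rewrite mulr_sumr exchange_big /=.
  pose F x z := (h x - w x) * (u x)%:R.
  rewrite (eq_bigr (fun x => \sum_(y in family V) F x y)); last first.
    by move=> x _; rewrite sum_const_box.
  rewrite (sum_swap V (~: D)); apply: eq_bigr => x _; apply: eq_bigr => y _.
  have e : merge (~: D) x y = merge D y x.
    by apply/ffunP => i; rewrite !ffunE inE; case: (i \in D).
  rewrite /F e (dh _ x) ?(dw _ x) // => i iD; by rewrite ffunE iD.
apply: le_trans (ler_norm_sum _ _ _) _; rewrite -sum_const_box.
apply: ler_sum => z _; have [G [X [dG eG]]] := mu z.
have := regular_abs (G := fun x => (G x)%:R) X reg.
have -> : \sum_(x in family V) (h x - w x) * (u (merge D z x))%:R =
  \sum_(x in family V) (h x - w x) * ((G x)%:R * (in_rect K X x)%:R).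
  by apply: eq_bigr => x _; rewrite eG -mulnb natrM.
apply; first by move=> x y e; rewrite (dG x y e).
by move=> x; case: (G x); rewrite ?normr1 ?normr0 ?ler01.
Qed.

Definition bsum V u : R := \sum_(x in family V) (u x)%:R.

Lemma bsum_eq V u v : u =1 v -> bsum V u = bsum V v.
Proof. by move=> e; apply: eq_bigr => x _; rewrite e. Qed.

Section Telescope.
Variables (J : eqType) (V : I -> {set T}) (M : J -> ({ffun I -> T} -> bool) -> Prop).
Hypothesis Mand : forall j u v, M j u -> M j v -> M j (fun x => u x && v x).

Lemma test_all j (f : J -> {ffun I -> T} -> bool) u (t : seq J) : M j u ->
  (forall k, k \in t -> M j (f k)) -> M j (fun x => all (f^~ x) t && u x).
Proof.
move=> Mu; elim: t => [|k t IHt] //= hM.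
have Mt : M j (fun x => all (f^~ x) t && u x).
  by apply: IHt => l lt; apply: hM; rewrite inE lt orbT.
have := Mand (hM k (mem_head _ _)) Mt.
by congr (M j _); apply: boolp.funext => x; rewrite andbA.
Qed.

(** The conditions are replaced one after the other, the remaining ones serving as the test. As
    [eta <= 1], later factors do not amplify earlier errors. [M j] abstracts the tests valid at step
    [j], so that edges, graphs and colours are all covered. *)
Lemma telescope_lower (b g : J -> {ffun I -> T} -> bool) (eta eps : R) :
  0 <= eta <= 1 -> 0 <= eps ->
  forall (s : seq J) u, uniq s ->
  (forall j v, j \in s -> M j v ->
     eta * bsum V (fun x => g j x && v x) - eps * (vol V)%:R
       <= bsum V (fun x => b j x && v x)) ->
  (forall i j, i \in s -> j \in s -> i != j -> M i (b j) /\ M i (g j)) ->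
  (forall j, j \in s -> M j u) ->
  eta ^+ size s * bsum V (fun x => all (g^~ x) s && u x)
     - (size s)%:R * (eps * (vol V)%:R) <= bsum V (fun x => all (b^~ x) s && u x).
Proof.
move=> /andP[eta0 eta1] eps0; elim=> [|j s IH] u.
  by rewrite /= mul1r mul0r subr0.
move=> /andP[js us] step Mbg Mu.
have jn k : k \in s -> k != j by move=> ks; apply: contraNneq js => <-.
have sj k : k \in s -> k \in j :: s by rewrite inE => ->; rewrite orbT.
have S1 : eta * bsum V (fun x => g j x && (all (b^~ x) s && u x)) - eps * (vol V)%:R
   <= bsum V (fun x => b j x && (all (b^~ x) s && u x)).
  apply: step (mem_head _ _) _; apply: test_all; first by apply: Mu; exact: mem_head.
  move=> k ks; case: (Mbg j k) => //; rewrite ?mem_head ?sj //.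
  by rewrite eq_sym jn.
have S2 : eta ^+ size s * bsum V (fun x => all (g^~ x) s && (g j x && u x))
     - (size s)%:R * (eps * (vol V)%:R) <=
     bsum V (fun x => all (b^~ x) s && (g j x && u x)).
  apply: IH => // [k v ks|i k iks ks ne|k ks]; first by apply: step; exact: sj.
    by apply: Mbg => //; exact: sj.
  apply: Mand; last by apply: Mu; exact: sj.
  by case: (Mbg k j) => //; rewrite ?mem_head ?jn ?sj.
rewrite (bsum_eq V (u := fun x => all (b^~ x) (j :: s) && u x)
  (v := fun x => b j x && (all (b^~ x) s && u x))); last first.
  by move=> x; rewrite /= andbA.
rewrite (bsum_eq V (u := fun x => all (g^~ x) (j :: s) && u x)
  (v := fun x => all (g^~ x) s && (g j x && u x))); last first.
  by move=> x; rewrite /= [RHS]andbCA andbA.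
rewrite (bsum_eq V (u := fun x => g j x && (all (b^~ x) s && u x))
  (v := fun x => all (b^~ x) s && (g j x && u x))) in S1; last first.
  by move=> x; rewrite /= andbCA.
apply: le_trans S1; rewrite /= exprS.
move: S2; set A := bsum V _; set B := bsum V _ => S2.
have e1 : eta * (eta ^+ size s * A - (size s)%:R * (eps * (vol V)%:R)) <= eta * B.
  by rewrite ler_wpM2l.
have e2 : 0 <= (1 - eta) * ((size s)%:R * (eps * (vol V)%:R)).
  by rewrite !mulr_ge0 ?ler0n ?subr_ge0.
by rewrite -natr1; move: e1 e2; lra.
Qed.

Lemma telescope_upper (g : J -> {ffun I -> T} -> bool) (a : J -> R) (eps : R) :
  (forall j, 0 <= a j <= 1) -> 0 <= eps ->
  forall (s : seq J) u, uniq s ->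
  (forall j v, j \in s -> M j v ->
     bsum V (fun x => g j x && v x) <= a j * bsum V v + eps * (vol V)%:R) ->
  (forall i j, i \in s -> j \in s -> i != j -> M i (g j)) ->
  (forall j, j \in s -> M j u) ->
  bsum V (fun x => all (g^~ x) s && u x) <=
    (\prod_(j <- s) a j) * bsum V u + (size s)%:R * (eps * (vol V)%:R).
Proof.
move=> a01 eps0; elim=> [|j s IH] u.
  by rewrite /= big_nil mul1r mul0r addr0.
move=> /andP[js us] step Mg Mu.
have jn k : k \in s -> k != j by move=> ks; apply: contraNneq js => <-.
have sj k : k \in s -> k \in j :: s by rewrite inE => ->; rewrite orbT.
have S1 : bsum V (fun x => g j x && (all (g^~ x) s && u x)) <=
   a j * bsum V (fun x => all (g^~ x) s && u x) + eps * (vol V)%:R.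
  apply: step (mem_head _ _) _; apply: test_all; first by apply: Mu; exact: mem_head.
  by move=> k ks; apply: Mg; rewrite ?mem_head ?sj // eq_sym jn.
have S2 : bsum V (fun x => all (g^~ x) s && u x) <=
    (\prod_(j <- s) a j) * bsum V u + (size s)%:R * (eps * (vol V)%:R).
  apply: IH => // [k v ks|i k iks ks ne|k ks]; first by apply: step; exact: sj.
    by apply: Mg => //; exact: sj.
  by apply: Mu; exact: sj.
rewrite (bsum_eq V (v := fun x => g j x && (all (g^~ x) s && u x))); last first.
  by move=> x; rewrite /= andbA.
apply: le_trans S1 _; rewrite big_cons /=; have /andP[a0 a1] := a01 j.
move: S2; set A := bsum V _; set B := bsum V _; set P := \prod_(_ <- _) _ => S2.
have e1 : a j * A <= a j * (P * B + (size s)%:R * (eps * (vol V)%:R)).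
  by rewrite ler_wpM2l.
have e2 : 0 <= (1 - a j) * ((size s)%:R * (eps * (vol V)%:R)).
  by rewrite !mulr_ge0 ?ler0n ?subr_ge0.
by rewrite -natr1; move: e1 e2; lra.
Qed.
End Telescope.
End TestFunctions.

(** * Clusters and counting *)

Section Clusters.
Variables (R : archiRealFieldType) (I : finType).

Definition crossing_edge (T : finType) (E : {set {set T}}) (A : {set I})
    (x : {ffun I -> T}) : bool := x @: A \in E.

Lemma crossing_edge_dep (T : finType) (E : {set {set T}}) A :
  dep A (crossing_edge E A).
Proof.
by move=> x y e; rewrite /crossing_edge (_ : x @: A = y @: A) //; apply: eq_in_imset.
Qed.

Definition density (T : finType) (V : I -> {set T}) (u : {ffun I -> T} -> bool) : R :=
  bsum R V u / (vol V)%:R.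

Lemma density_bounds (T : finType) (V : I -> {set T}) u : 0 <= density V u <= 1.
Proof.
have u01 (x : {ffun I -> T}) : 0 <= ((u x)%:R : R) <= 1 by case: (u x); rewrite ?lexx ler01.
have /andP[a b] := sum_bounds V u01; rewrite mul0r in a; rewrite mul1r in b.
rewrite /density divr_ge0 //=; have [->|v0] := posnP (vol V); first by rewrite invr0 mulr0.
by rewrite ler_pdivrMr ?ltr0n // mul1r.
Qed.

(* [G A p] records where the average number of edges over the coordinates
   [A :\: p] is at least [eta]. *)
Record clusters (T : finType) (E : {set {set T}}) (W : I -> {set T})
    (G : {set I} -> {set I} -> {ffun I -> T} -> bool) (eta eps : R) : Prop := Clusters {
  clusters_dep : forall A p : {set I}, p \subset A -> dep p (G A p);
  clusters_lower : forall (A p : {set I}) u, p \subset A -> mild A (A :\: p) u ->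
    eta * bsum R W (fun x => G A p x && u x) - eps * (vol W)%:R <=
    bsum R W (fun x => crossing_edge E A x && u x);
  clusters_upper : forall A p : {set I}, p \subset A ->
    bsum R W (fun x => crossing_edge E A x && ~~ G A p x) <= (eta + eps) * (vol W)%:R;
  clusters_pair : forall (A B p : {set I}) u, p \subset A -> p \subset B -> mild p p u ->
    `|bsum R W (fun x => (G A p x && G B p x) && u x) -
      density W (fun x => G A p x && G B p x) * bsum R W u| <= eps * (vol W)%:R }.

Lemma bool_bounds (b : bool) : 0 <= (b%:R : R) <= 1.
Proof. by case: b; rewrite ?lexx ler01. Qed.

Lemma bsum_and (T : finType) (V : I -> {set T}) u v :
  bsum R V (fun x => u x && v x) = \sum_(x in family V) (u x)%:R * (v x)%:R.
Proof. by apply: eq_bigr => x _; rewrite -natrM mulnb. Qed.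

Theorem regular_clusters (eta eps : R) : 0 <= eta -> 0 < eps -> eps <= 1 ->
  exists2 c : R, 0 < c & forall (T : finType) (E : {set {set T}}) (V : I -> {set T}),
    (0 < vol V)%N -> exists (W : I -> {set T}) G, [/\ forall i, W i \subset V i,
      c * (vol V)%:R <= (vol W)%:R, (0 < vol W)%N & clusters E W G eta eps].
Proof.
move=> eta0 e0 e1.
have steps (A : finType) (e : R) : 0 < e -> exists J : nat, #|A|%:R <= J%:R * (e ^+ 2 / 2).
  move=> ep; have q0 : 0 < e ^+ 2 / 2 by rewrite divr_gt0 ?exprn_gt0.
  exists (Num.bound (#|A|%:R / (e ^+ 2 / 2))); rewrite -ler_pdivrMr //.
  by apply: ltW; apply: archi_boundP; exact: divr_ge0 (ler0n _ _) (ltW q0).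
pose AB : finType := ({set I} * {set I} * {set I})%type.
pose AA : finType := ({set I} * {set I})%type.
have [JB hJB] := steps AB eps e0.
pose cB := @cell_share R I AB eps ^+ JB.
have cB0 : 0 < cB by rewrite exprn_gt0 // cell_share_gt0.
have cB1 : cB <= 1 by rewrite exprn_ile1 ?cell_share_le1 // ltW ?cell_share_gt0.
(* The second round of regularisation may shrink the volume by the factor [cB], so the first round
   runs at the finer precision [eps * cB]. *)
have eA0 : 0 < eps * cB by rewrite mulr_gt0.
have eA1 : eps * cB <= 1 by rewrite mulr_ile1 // ltW.
have [JA hJA] := steps AA _ eA0.
pose cA := @cell_share R I AA (eps * cB) ^+ JA.
have cA0 : 0 < cA by rewrite exprn_gt0 // cell_share_gt0.
exists (cA * cB) => [|T E V V0]; first by rewrite mulr_gt0.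
pose hA (q : AA) (x : {ffun I -> T}) : R := (crossing_edge E q.1 x)%:R.
have hA01 q x : 0 <= hA q x <= 1 by exact: bool_bounds.
have [VA [VAV VAbig VA0 regA]] :=
  cylinder_regularity (fun q : AA => q.1 :\: q.2) hA01 eA0 eA1 hJA V0.
pose w A p := avg VA (A :\: p) (hA (A, p)).
(* The graphs are cut out of the averages over [VA] and stay fixed when the box shrinks to [W]: the
   second round has to regularise these very graphs. *)
pose G A p x := eta <= w A p x.
pose hB (q : AB) (x : {ffun I -> T}) : R := (G q.1.1 q.2 x && G q.1.2 q.2 x)%:R.
have hB01 q x : 0 <= hB q x <= 1 by exact: bool_bounds.
have [W [WVA Wbig W0 regB]] :=
  cylinder_regularity (fun q : AB => q.2) hB01 e0 e1 hJB VA0.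
have hAdep (A p : {set I}) : dep A (hA (A, p)).
  by move=> x y e; rewrite /hA (crossing_edge_dep E e).
have wdep (A p : {set I}) : p \subset A -> dep p (w A p).
  move=> pA; rewrite /w; have := avg_dep VA (K := A :\: p) (hAdep A p).
  by apply: dep_sub; rewrite setDDr setDv set0U subsetIr.
have wdepA (A p : {set I}) : p \subset A -> dep A (w A p).
  by move=> pA; apply: dep_sub (wdep _ _ pA).
have Gdep (A p : {set I}) : p \subset A -> dep p (G A p).
  by move=> pA x y e; rewrite /G (wdep _ _ pA _ _ e).
have regW (A p : {set I}) : regular_on W (A :\: p) (hA (A, p)) (w A p) eps.
  apply: (regular_sub WVA _ (regA (A, p))).
  by rewrite -mulrA ler_wpM2l // ltW.
have w01 (A p : {set I}) x : 0 <= w A p x <= 1 by exact: avg_bounds.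
have mildA (A p : {set I}) u : p \subset A -> mild A (A :\: p) u ->
   `|\sum_(x in family W) (hA (A, p) x - w A p x) * (u x)%:R| <= eps * (vol W)%:R.
  by move=> pA mu; apply: regular_mild (regW A p) mu => //; apply: wdepA.
exists W, G; split => //.
- by move=> i; apply: subset_trans (WVA i) (VAV i).
- apply: le_trans Wbig; rewrite -/cB mulrAC mulrC ler_wpM2l // ltW //.
split => // [A p u pA mu|A p pA|A B p u pA pB mu].
- have := mildA A p u pA mu; rewrite ler_norml => /andP[lo _].
  have e : eta * bsum R W (fun x => G A p x && u x) <=
      \sum_(x in family W) w A p x * (u x)%:R.
    rewrite bsum_and mulr_sumr; apply: ler_sum => x _; rewrite mulrA.
    have /andP[w0 _] := w01 A p x.
    by rewrite ler_wpM2r ?ler0n // /G; case: (leP eta (w A p x)); rewrite ?mulr1 ?mulr0.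
  rewrite [leRHS]bsum_and; move: lo e; under eq_bigr do rewrite mulrBl.
  by rewrite sumrB /hA /=; lra.
- have mu : mild A (A :\: p) (fun x => ~~ G A p x).
    apply: (@mild_disjoint _ _ A (A :\: p) p).
      by move=> x y e; rewrite (Gdep A p pA x y e).
    by rewrite disjoints_subset setCD; exact: subsetUr.
  have := mildA A p _ pA mu; rewrite ler_norml => /andP[_ up].
  have e : \sum_(x in family W) w A p x * (~~ G A p x)%:R <= eta * (vol W)%:R.
    rewrite mulrC -sum_const_box; apply: ler_sum => x _; rewrite /G.
    by case: (leP eta (w A p x)) => h; rewrite ?mulr1 ?mulr0 // ltW.
  rewrite [leLHS]bsum_and; move: up e; under eq_bigr do rewrite mulrBl.
  by rewrite sumrB /hA /=; lra.
pose g x := G A p x && G B p x.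
have gdep : dep p (fun x => (g x)%:R : R).
  by move=> x y e; rewrite /g (Gdep A p pA x y e) (Gdep B p pB x y e).
(* [g] lives on [p], so averaging over [p] leaves a constant; regularity over [p] becomes
   quasirandomness of the graph [g]. *)
have cst x : avg W p (fun x => (g x)%:R) x = density W g.
  rewrite /avg /density /bsum; congr (_ / _); apply: eq_bigr => y _.
  by apply: gdep => i ip; rewrite ffunE ip.
have := regB (A, B, p); rewrite /hB /= -/(g _).
have -> : avg W p (fun x => (g x)%:R) = fun=> density W g by apply: boolp.funext.
move=> reg; have := regular_mild gdep (w := fun=> density W g) (fun _ _ _ => erefl) reg mu.
under eq_bigr do rewrite mulrBl; rewrite sumrB -mulr_sumr.
by rewrite -bsum_and.
Qed.
End Clusters.

Section Counting.
Variables (R : archiRealFieldType) (I T : finType) (E : {set {set T}}).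
Variables (W : I -> {set T}) (G : {set I} -> {set I} -> {ffun I -> T} -> bool).
Variables (eta eps : R).
Hypothesis cl : clusters E W G eta eps.
Hypothesis eps0 : 0 <= eps.

Definition pairs_in (A : {set I}) :=
  [seq p : {set I} <- enum {: {set I}} | (p \subset A) && (#|p| == 2)].

Lemma mem_pairs_in (A p : {set I}) : (p \in pairs_in A) = (p \subset A) && (#|p| == 2).
Proof. by rewrite mem_filter mem_enum andbT. Qed.

Lemma distinct_pairs (p q : {set I}) : #|p| = 2 -> #|q| = 2 -> p != q -> (#|p :&: q| <= 1)%N.
Proof.
move=> cp cq; apply: contraR; rewrite -ltnNge => h.
have e1 : p :&: q = p by apply/eqP; rewrite eqEcard subsetIl cp.
have e2 : p :&: q = q by apply/eqP; rewrite eqEcard subsetIr cq.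
by rewrite -{1}e1 e2.
Qed.

Lemma bsum_true : bsum R W (fun=> true) = (vol W)%:R.
Proof. by rewrite /bsum sum_const_box mulr1. Qed.

(** An edge with a pair outside its graph is rare, at most [eta + eps] for each pair. For the others
    the graphs are replaced by their densities in turn, at cost [eps] each; two pairs share at most
    one vertex and so are mild tests for each other. *)
Lemma edge_upper A : (0 < vol W)%N ->
  density R W (crossing_edge E A) <=
    \prod_(p <- pairs_in A) density R W (G A p)
    + (size (pairs_in A))%:R * (eta + 2 * eps).
Proof.
move=> W0; have N0 : 0 < (vol W)%:R :> R by rewrite ltr0n.
set P := pairs_in A; set n := (size P)%:R.
have split_bound : bsum R W (crossing_edge E A) <=
    bsum R W (fun x => all (fun p => G A p x) P && true) +
    \sum_(p <- P) bsum R W (fun x => crossing_edge E A x && ~~ G A p x).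
  rewrite /bsum exchange_big -big_split /=; apply: ler_sum => x _; rewrite andbT.
  case: (boolP (all _ P)) => [_|].
    rewrite -[leLHS]addr0; apply: lerD; first by case: crossing_edge.
    by apply: sumr_ge0 => p _.
  rewrite add0r -has_predC => /hasP[p pP /= hp].
  rewrite (bigD1_seq p) //=; last by rewrite filter_uniq // enum_uniq.
  by rewrite hp andbT lerDl sumr_ge0.
have up : \sum_(p <- P) bsum R W (fun x => crossing_edge E A x && ~~ G A p x) <=
    n * ((eta + eps) * (vol W)%:R).
  rewrite /n -sum1_size natr_sum mulr_suml big_seq [leRHS]big_seq.
  apply: ler_sum => p; rewrite mem_pairs_in => /andP[pA _]; rewrite mul1r.
  exact: (clusters_upper cl).
have a01 p : 0 <= density R W (G A p) <= 1 by exact: density_bounds.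
have Mand (p : {set I}) (u v : {ffun I -> T} -> bool) : mild p p u -> mild p p v -> mild p p (fun x => u x && v x).
  exact: mild_and.
have tel := telescope_upper (M := fun p : {set I} => mild p p) Mand a01 eps0
   (s := P) (u := fun=> true).
have {}tel : bsum R W (fun x => all (fun p => G A p x) P && true) <=
    (\prod_(p <- P) density R W (G A p)) * (vol W)%:R + n * (eps * (vol W)%:R).
  rewrite -{1}bsum_true; apply: tel => [|p v|p q|p].
  - by rewrite filter_uniq // enum_uniq.
  - rewrite mem_pairs_in => /andP[pA _] mv.
    have := clusters_pair cl pA pA mv; rewrite ler_norml => /andP[_].
    rewrite lerBlDl [_ + eps * _]addrC.
    have -> : (fun x => G A p x && G A p x) = G A p.
      by apply: boolp.funext => x; rewrite andbb.
    rewrite addrC; apply: le_trans; rewrite (bsum_eq _ _ (v := fun x => G A p x && v x)) //.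
    by move=> x; rewrite andbb.
  - rewrite !mem_pairs_in => /andP[pA /eqP cp] /andP[qA /eqP cq] pq.
    apply: (mild_meet1 (D' := q)) => //; first exact: (clusters_dep cl).
    by apply: distinct_pairs => //; rewrite eq_sym.
  - by move=> _; apply: (@mild_disjoint _ _ _ _ set0); rewrite // -setI_eq0 set0I.
rewrite ler_pdivrMr //; apply: le_trans split_bound _.
by move: tel up; set a := bsum _ _ _; set b := \sum_(_ <- _) _; lra.
Qed.

(** Two rounds of replacement: the two edges of each pair by the two graphs on their intersection
    (factor [eta ^+ 2], error [2 * eps]), then the common part of these graphs by its density
    (factor [delta], error [eps]). This explains the 3 in the smallness condition. *)
Lemma crossing_pairs_exist (delta : R) (L : seq ({set I} * {set I})) :
  (0 < vol W)%N -> 0 <= eta <= 1 -> 0 <= delta <= 1 -> uniq L ->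
  (forall j, j \in L -> delta <= density R W
     (fun x => G j.1 (j.1 :&: j.2) x && G j.2 (j.1 :&: j.2) x)) ->
  (forall j k (C D : {set I}), j \in L -> k \in L -> j != k -> C \in [:: j.1; j.2] ->
     D \in [:: k.1; k.2] -> (#|D :&: C| <= 1)%N) ->
  3 * (size L)%:R * eps < (eta ^+ 2 * delta) ^+ size L ->
  exists2 x, x \in family W &
    forall j, j \in L -> crossing_edge E j.1 x && crossing_edge E j.2 x.
Proof.
move=> W0 eta01 delta01 uL dL crossL small.
have /andP[eta0 eta1] := eta01; have /andP[delta0 delta1] := delta01.
have N0 : 0 < (vol W)%:R :> R by rewrite ltr0n.
pose p (j : {set I} * {set I}) := j.1 :&: j.2.
pose b (j : {set I} * {set I}) (x : {ffun I -> T}) := crossing_edge E j.1 x && crossing_edge E j.2 x.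
pose g j x := G j.1 (p j) x && G j.2 (p j) x.
have p1 j : p j \subset j.1 by exact: subsetIl.
have p2 j : p j \subset j.2 by exact: subsetIr.
have gdep j : dep (p j) (g j).
  by move=> x y e; rewrite /g (clusters_dep cl (p1 j) e) (clusters_dep cl (p2 j) e).
pose M1 (j : {set I} * {set I}) (u : {ffun I -> T} -> bool) := mild j.1 (j.1 :\: p j) u /\ mild j.2 (j.2 :\: p j) u.
have M1and j u v : M1 j u -> M1 j v -> M1 j (fun x => u x && v x).
  by move=> [a c] [a' c']; split; apply: mild_and.
have M2and (j : {set I} * {set I}) (u v : {ffun I -> T} -> bool) : mild (p j) (p j) u -> mild (p j) (p j) v ->
   mild (p j) (p j) (fun x => u x && v x) by exact: mild_and.
have mild1 (D K : {set I}) : mild D K (fun _ : {ffun I -> T} => true).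
  by apply: (@mild_disjoint _ _ _ _ set0); rewrite // -setI_eq0 set0I.
have eta2 : 0 <= eta ^+ 2 <= 1 by rewrite sqr_ge0 exprn_ile1.
have eps2 : 0 <= 2 * eps by rewrite mulr_ge0.
have T1 := telescope_lower M1and (b := b) (g := g) eta2 eps2
  (s := L) (u := fun=> true).
have T2 := telescope_lower M2and (b := g) (g := fun _ _ => true) delta01 eps0
  (s := L) (u := fun=> true).
have {}T1 : (eta ^+ 2) ^+ size L * bsum R W (fun x => all (g^~ x) L && true)
     - (size L)%:R * (2 * eps * (vol W)%:R) <= bsum R W (fun x => all (b^~ x) L && true).
  apply: T1 => // [j v jL [m1 m2]|j k jL kL jk].
    (* The two edges are replaced in turn: [j.2] avoids [j.1 :\: p j], and the graph that replaces
       the first edge lives on [p j], hence avoids [j.2 :\: p j]. *)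
    have c1 : mild j.1 (j.1 :\: p j) (fun x => crossing_edge E j.2 x && v x).
      apply: mild_and m1; apply: (mild_disjoint _ (@crossing_edge_dep _ _ E j.2)).
      rewrite disjoints_subset; apply/subsetP => i i2.
      by rewrite /p !inE i2 andbT andNb.
    have c2 : mild j.2 (j.2 :\: p j) (fun x => G j.1 (p j) x && v x).
      apply: mild_and m2; apply: (mild_disjoint _ (clusters_dep cl (p1 j))).
      by rewrite disjoints_subset setCD; exact: subsetUr.
    have s1 := clusters_lower cl (p1 j) c1.
    have s2 := clusters_lower cl (p2 j) c2.
    have e1 : bsum R W (fun x => b j x && v x) =
        bsum R W (fun x => crossing_edge E j.1 x && (crossing_edge E j.2 x && v x)).
      by apply: bsum_eq => x; rewrite andbA.
    have e2 : bsum R W (fun x => g j x && v x) =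
        bsum R W (fun x => G j.2 (p j) x && (G j.1 (p j) x && v x)).
      by apply: bsum_eq => x; rewrite /g andbA [G j.2 _ _ && _]andbC.
    have e3 : bsum R W (fun x => G j.1 (p j) x && (crossing_edge E j.2 x && v x)) =
        bsum R W (fun x => crossing_edge E j.2 x && (G j.1 (p j) x && v x)).
      by apply: bsum_eq => x; rewrite andbCA.
    rewrite e1 e2; rewrite e3 in s1; apply: le_trans s1.
    move: s2; set a := bsum _ _ _; set c := bsum _ _ _ => s2.
    have := ler_wpM2l eta0 s2; have : 0 <= (1 - eta) * (eps * (vol W)%:R).
      by rewrite !mulr_ge0 ?subr_ge0.
    by rewrite expr2; lra.
  have dis (C D : {set I}) (u : {ffun I -> T} -> bool) (D' : {set I}) : C \in [:: j.1; j.2] -> D \in [:: k.1; k.2] -> D' \subset D ->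
      dep D' u -> mild C (C :\: p j) u.
    move=> Cj Dk D'D du; apply: (mild_meet1 du); first exact: subsetDl.
    apply: leq_trans (crossL _ _ _ _ jL kL jk Cj Dk).
    by apply: subset_leq_card; apply: setSI.
  have in1 (z : {set I} * {set I}) : z.1 \in [:: z.1; z.2] by rewrite inE eqxx.
  have in2 (z : {set I} * {set I}) : z.2 \in [:: z.1; z.2] by rewrite !inE eqxx orbT.
  have mb C : C \in [:: j.1; j.2] -> mild C (C :\: p j) (b k).
    move=> Cj; apply: mild_and.
      by apply: (dis _ _ _ _ Cj (in1 k) (subxx _)); exact: crossing_edge_dep.
    by apply: (dis _ _ _ _ Cj (in2 k) (subxx _)); exact: crossing_edge_dep.
  have mg C : C \in [:: j.1; j.2] -> mild C (C :\: p j) (g k).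
    by move=> Cj; exact: (dis _ _ _ _ Cj (in1 k) (p1 k)).
  by split; split; [apply: mb | apply: mb | apply: mg | apply: mg]; rewrite ?in1 ?in2.
have {}T2 : delta ^+ size L * (vol W)%:R - (size L)%:R * (eps * (vol W)%:R) <=
    bsum R W (fun x => all (g^~ x) L && true).
  have -> : (vol W)%:R = bsum R W (fun x => all (fun _ => true) L && true).
    by rewrite -bsum_true; apply: bsum_eq => x; rewrite all_predT.
  rewrite {2}(_ : bsum _ _ _ = (vol W)%:R); last first.
    by rewrite -bsum_true; apply: bsum_eq => x; rewrite all_predT.
  apply: T2 => // [j v jL mv|j k jL kL jk].
    have := clusters_pair cl (p1 j) (p2 j) mv; rewrite ler_norml => /andP[lo _].
    have : delta * bsum R W v <= density R W (g j) * bsum R W v.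
      by apply: ler_wpM2r (dL j jL); apply: sumr_ge0.
    by move: lo; rewrite -/(g j); set a := bsum R W _; set c := bsum R W _; lra.
  split; last exact: mild1.
  apply: (mild_meet1 (gdep k)) => //.
  apply: leq_trans (crossL _ _ _ _ jL kL jk (mem_head _ _) (mem_head _ _)).
  by apply: subset_leq_card; apply: setISS; exact: subsetIl.
apply: boolp.contrapT => none.
have zero : bsum R W (fun x => all (b^~ x) L && true) = 0.
  apply: big1 => x xW; case: (boolP (all _ _)) => // /allP hx; case: none.
  by exists x => // j jL; exact: hx.
rewrite zero in T1; have e20 : 0 <= (eta ^+ 2) ^+ size L by rewrite !exprn_ge0.
have := ler_wpM2l e20 T2.
have e21 : (eta ^+ 2) ^+ size L <= 1 by rewrite !exprn_ile1 ?exprn_ge0.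
have : 0 <= (1 - (eta ^+ 2) ^+ size L) * ((size L)%:R * (eps * (vol W)%:R)).
  by rewrite !mulr_ge0 ?subr_ge0.
move: small; rewrite -(ltr_pM2r N0) exprMn; move: T1; set B := bsum _ _ _.
by lra.
Qed.
End Counting.

(** * From a sparse box to a sparse vertex set *)

Section LocalDensity.
Variables (R : realFieldType) (I T : finType).
Implicit Types (V Y : I -> {set T}).

(** Every tuple of the box survives the deletion of all but one element of [V i], so the averages of
    [f] after deletion have the original average as their mean. Some deletion does not lower it. *)
Lemma trim_one (f : {ffun I -> T} -> R) V i : (1 < #|V i|)%N -> (0 < vol V)%N ->
  exists Y, [/\ forall j, Y j \subset V j, #|Y i| = #|V i|.-1,
    forall j, j != i -> Y j = V j &
    (\sum_(x in family V) f x) / (vol V)%:R <= (\sum_(x in family Y) f x) / (vol Y)%:R].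
Proof.
move=> Vi V0; pose Y t j := if j == i then V j :\ t else V j.
have sumY t : \sum_(x in family (Y t)) f x = \sum_(x in family V | x i != t) f x.
  apply: eq_bigl => x; apply/familyP/andP => [h|[/familyP h xi] j].
    split; last by have := h i; rewrite /Y eqxx !inE => /andP[].
    by apply/familyP => j; have := h j; rewrite /Y; case: eqP => // _; rewrite inE => /andP[].
  by rewrite /Y; case: eqP => [->|]; rewrite ?inE ?h ?xi.
have total : \sum_(t in V i) \sum_(x in family (Y t)) f x =
    (#|V i|.-1)%:R * \sum_(x in family V) f x.
  under eq_bigr do rewrite sumY.
  rewrite (exchange_big_dep (mem (family V))) //=; last by move=> t x _ /andP[].
  rewrite mulr_sumr; apply: eq_bigr => x xV.
  rewrite (eq_bigl (mem (V i :\ x i))); last first.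
    by move=> t; rewrite xV !inE eq_sym andbC.
  rewrite sumr_const mulr_natl; congr (_ *+ _).
  by have := cardsD1 (x i) (V i); have /familyP/(_ i) -> := xV; lia.
have volY t : t \in V i -> (vol (Y t) * #|V i| = vol V * #|V i|.-1)%N.
  move=> tV; rewrite /vol (bigD1 i) //= [in RHS](bigD1 i) //=.
  rewrite {1}/Y eqxx (eq_bigr (fun j => #|V j|)); last first.
    by move=> j /negbTE ji; rewrite /Y ji.
  by have := cardsD1 t (V i); rewrite tV => ->; rewrite add1n /=; lia.
have [t [tV ht]] : exists t, t \in V i /\
    (\sum_(x in family V) f x) * (#|V i|.-1)%:R <= (\sum_(x in family (Y t)) f x) * #|V i|%:R.
  apply: boolp.contrapT => /boolp.forallNP none.
  have : \sum_(t in V i) (\sum_(x in family (Y t)) f x) * #|V i|%:R <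
     \sum_(t in V i) (\sum_(x in family V) f x) * (#|V i|.-1)%:R.
    apply: ltr_sum => [|t tV].
      have /card_gt0P[t tV] : (0 < #|V i|)%N by lia.
      by apply/hasP; exists t; rewrite ?mem_index_enum.
    by rewrite ltNge; apply/negP => h; apply: (none t).
  by rewrite -mulr_suml total sumr_const -[ltRHS]mulr_natr [(#|V i|.-1)%:R * _]mulrC ltxx.
exists (Y t); split => //.
- by move=> j; rewrite /Y; case: ifP => // _; rewrite subD1set.
- by rewrite /Y eqxx; have := cardsD1 t (V i); rewrite tV; lia.
- by move=> j /negbTE; rewrite /Y => ->.
have e := volY t tV; have Vi0 : 0 < #|V i|%:R :> R by rewrite ltr0n; lia.
have V0r : 0 < (vol V)%:R :> R by rewrite ltr0n.
have Y0 : (0 < vol (Y t))%N.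
  have : (0 < vol V * #|V i|.-1)%N by rewrite muln_gt0 V0 /=; lia.
  by rewrite -e muln_gt0 => /andP[].
rewrite ler_pdivrMr // mulrAC ler_pdivlMr ?ltr0n // -(ler_pM2r Vi0).
have eR : (vol (Y t))%:R * #|V i|%:R = (vol V)%:R * (#|V i|.-1)%:R :> R by rewrite -!natrM e.
by rewrite -mulrA eR; have := ler_wpM2l (ltW V0r) ht; lra.
Qed.

Lemma trim_box (f : {ffun I -> T} -> R) V s : (0 < s)%N -> (forall i, s <= #|V i|)%N ->
  exists Y, [/\ forall i, Y i \subset V i, forall i, #|Y i| = s &
    (\sum_(x in family V) f x) / (vol V)%:R <= (\sum_(x in family Y) f x) / (vol Y)%:R].
Proof.
move=> s0; move: {2}(\sum_i #|V i|)%N (leqnn (\sum_i #|V i|)%N) => n.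
elim: n V => [|n IH] V hn sV.
  exists V; split => // i; have := sV i.
  by move: hn; rewrite (bigD1 i) //=; lia.
have [/existsP[i hi]|] := boolP [exists i, (s < #|V i|)%N]; last first.
  rewrite negb_exists => /forallP h; exists V; split => // i.
  by have := h i; have := sV i; lia.
have V0 : (0 < vol V)%N by rewrite vol_gt0; apply/forallP => j; apply: leq_trans (sV j).
have [|Y [YV Yi Yj hY]] := trim_one f (i := i) _ V0; first by lia.
have [| |Z [ZY Zs hZ]] := IH Y.
- have eY : (\sum_(j | j != i) #|Y j| = \sum_(j | j != i) #|V j|)%N.
    by apply: eq_bigr => j /Yj ->.
  move: hn; rewrite (bigD1 i) //= => hn; rewrite (bigD1 i) //= eY Yi.
  by move: hn hi; set a := #|V i|; set b := (\sum_(_ | _) _)%N; lia.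
- move=> j; have [->|/Yj -> //] := eqVneq j i; by rewrite Yi; lia.
exists Z; split => //; first by move=> j; apply: subset_trans (YV j).
exact: le_trans hZ.
Qed.

Lemma disjoint_box_inj V (x : {ffun I -> T}) i j : (forall i j, i != j -> [disjoint V i & V j]) ->
  x i \in V i -> x j \in V j -> x i = x j -> i = j.
Proof.
move=> dV xi xj e; apply/eqP; apply: contraT => /dV /disjointFr/(_ xi).
by rewrite e xj.
Qed.

Lemma count_through V s (e : {set T}) :
  (forall i j, i != j -> [disjoint V i & V j]) -> (forall i, #|V i| = s) ->
  (#|[set x in family V | e \subset x @: setT]| <= s ^ (#|I| - #|e|))%N.
Proof.
move=> dV Vs; have [->|[x0]] := set_0Vmem [set x in family V | e \subset x @: setT].
  by rewrite cards0.
rewrite inE => /andP[/familyP x0V ex0].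
have x0inj : injective x0 by move=> i j; apply: disjoint_box_inj dV _ _.
pose A := [set i | x0 i \in e].
have Ae : x0 @: A = e.
  apply/setP => t; apply/imsetP/idP => [[i]|te]; first by rewrite inE => h ->.
  by have /imsetP[i _ ti] := subsetP ex0 t te; exists i; rewrite // inE -ti.
have cA : #|A| = #|e| by rewrite -Ae card_imset.
pose Z i := if i \in A then [set x0 i] else V i.
have sub : [set x in family V | e \subset x @: setT] \subset family Z.
  apply/subsetP => x; rewrite inE => /andP[/familyP xV ex]; apply/familyP => i.
  rewrite /Z; case: ifP => // iA; rewrite inE in iA.
  have /imsetP[j _ tj] := subsetP ex _ iA.
  have ij : i = j.
    apply/eqP; apply: contraT => /dV /disjointFr/(_ (x0V i)).
    by rewrite tj xV.
  by rewrite inE tj -ij.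
apply: leq_trans (subset_leq_card sub) _.
rewrite card_box /vol (bigID (mem A)) /= big1 ?mul1n => [|i iA]; last by rewrite /Z iA cards1.
rewrite (eq_bigr (fun=> s)) => [|i /negbTE iA]; last by rewrite /Z iA Vs.
rewrite (eq_bigl (mem (~: A))) => [|i]; last by rewrite /= in_setC.
by rewrite prod_nat_const cardsCs setCK cA.
Qed.

Lemma nonedges_through V s r (E : {set {set T}}) (S : {set I}) :
  (forall i j, i != j -> [disjoint V i & V j]) -> (forall i, #|V i| = s) ->
  (\sum_(x in family V) \sum_(A : {set I} | (A \subset S) && (#|A| == r)) (x @: A \notin E) <=
   #|[set e : {set T} | [&& #|e| == r, e \subset \bigcup_(i in S) V i & e \notin E]]|
     * s ^ (#|I| - r))%N.
Proof.
move=> dV Vs; set N := [set e | _].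
have step x : x \in family V ->
   (\sum_(A : {set I} | (A \subset S) && (#|A| == r)) (x @: A \notin E) <=
    \sum_(e in N) (e \subset x @: setT))%N.
  move=> /familyP xV.
  have xinj : injective x by move=> i j; apply: (disjoint_box_inj dV).
  rewrite -big_mkcondr /= -[leqRHS]big_mkcondr /=.
  rewrite !sum1_card -(card_imset _ (imset_inj xinj)); apply: subset_leq_card.
  apply/subsetP => e /imsetP[A]; rewrite unfold_in /= => /andP[/andP[AS cA] nE] ->.
  rewrite unfold_in /= /N in_set card_imset // cA nE imsetS ?subsetT // !andbT /=.
  apply/subsetP => t /imsetP[i iA ->]; apply/bigcupP; exists i => //.
  exact: (subsetP AS).
apply: (@leq_trans (\sum_(x in family V) \sum_(e in N) (e \subset x @: setT))).
  exact: leq_sum.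
rewrite exchange_big /= -sum_nat_const; apply: leq_sum => e; rewrite inE => /and3P[/eqP <- _ _].
apply: leq_trans (count_through e dV Vs); rewrite -big_mkcondr sum1_card /=.
by apply: subset_leq_card; apply/subsetP => x; rewrite !inE.
Qed.

(** Trimming to equal sides while keeping the average number of non-edges turns a density into a
    count: each non-edge lies in the image of at most [s ^ (#|I| - r)] tuples. Non-crossing sets are
    simply left out of the lower bound. *)
Theorem local_density V s r (E : {set {set T}}) (S : {set I}) (D : R) :
  (0 < s)%N -> (forall i j, i != j -> [disjoint V i & V j]) -> (forall i, s <= #|V i|)%N ->
  S != set0 ->
  (forall A : {set I}, A \subset S -> #|A| = r ->
     (\sum_(x in family V) (x @: A \in E)%:R) / (vol V)%:R <= D) ->
  exists U : {set T}, [/\ (s <= #|U|)%N, (#|U| <= #|S| * s)%N &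
    (1 - D) * 'C(#|S|, r)%:R * (s ^ r)%:R <=
      #|[set e : {set T} | [&& #|e| == r, e \subset U & e \notin E]]|%:R].
Proof.
move=> s0 dV sV S0 hD.
pose P (A : {set I}) := (A \subset S) && (#|A| == r).
pose f x : R := \sum_(A | P A) (x @: A \notin E)%:R.
have [Y [YV Ys hY]] := trim_box f s0 sV.
have dY i j : i != j -> [disjoint Y i & Y j].
  by move=> /dV dij; apply: disjointWl (YV i) (disjointWr (YV j) dij).
pose U := \bigcup_(i in S) Y i; exists U.
have V0 : 0 < (vol V)%:R :> R.
  by rewrite ltr0n vol_gt0; apply/forallP => i; apply: leq_trans (sV i).
split.
- have [i iS] := set0Pn _ S0; rewrite -(Ys i); apply: subset_leq_card.
  exact: bigcup_sup.
- rewrite -sum_nat_const /U; elim/big_ind2: _ => [|A m B n hA hB|i _].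
  + by rewrite cards0.
  + by rewrite cardsU; lia.
  + by rewrite Ys.
have cP : #|[set A | P A]| = 'C(#|S|, r).
  by rewrite -cards_draws; apply: eq_card => A; rewrite !inE.
have lo : (1 - D) * 'C(#|S|, r)%:R <= (\sum_(x in family V) f x) / (vol V)%:R.
  rewrite exchange_big /= mulr_suml -cP mulrC mulr_natl -sumr_const.
  rewrite (eq_bigl P) => [|A]; last by rewrite inE.
  apply: ler_sum => A /andP[AS /eqP cA].
  have eq1 : \sum_(x in family V) (x @: A \notin E)%:R =
      (vol V)%:R - \sum_(x in family V) (x @: A \in E)%:R :> R.
    rewrite -[(vol V)%:R]mulr1 -sum_const_box -sumrB; apply: eq_bigr => x _.
    by case: (_ \in E); rewrite ?subrr ?subr0.
  by rewrite eq1 mulrBl divff ?gt_eqF // lerB // hD.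
have := le_trans lo hY.
have volY : vol Y = (s ^ #|I|)%N.
  by rewrite /vol (eq_bigr (fun=> s)) // prod_nat_const.
rewrite volY ler_pdivlMr ?ltr0n ?expn_gt0 ?s0 // => le1.
set N := #|[set e : {set T} | _]|; have le2 : \sum_(x in family Y) f x <= N%:R * (s ^ (#|I| - r))%:R.
  rewrite -natrM; apply: le_trans (_ : _ <= (\sum_(x in family Y)
     \sum_(A : {set I} | P A) (x @: A \notin E))%N%:R) _.
    by rewrite natr_sum; apply: ler_sum => x _; rewrite natr_sum.
  by rewrite ler_nat; apply: nonedges_through.
have [rS|Sr] := leqP r #|S|; last by rewrite bin_small // mulr0 mul0r.
have rI : (r <= #|I|)%N by apply: leq_trans rS (max_card _).
have p0 : 0 < (s ^ (#|I| - r))%:R :> R by rewrite ltr0n expn_gt0 s0.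
rewrite -(ler_pM2r p0); apply: le_trans le2; apply: le_trans le1.
have -> : (s ^ #|I|)%:R = (s ^ r)%:R * (s ^ (#|I| - r))%:R :> R.
  by rewrite -natrM -expnD subnKC.
by rewrite mulrA.
Qed.
End LocalDensity.

(** * Ramsey's theorem *)

Definition homogeneous (T : finType) (C : Type) (col : {set T} -> C) k (S : {set T}) c :=
  forall Q : {set T}, Q \subset S -> #|Q| = k -> col Q = c.

Lemma subset_of_card (T : finType) (S : {set T}) n : (n <= #|S|)%N ->
  exists2 S' : {set T}, S' \subset S & #|S'| = n.
Proof.
move=> nS; have : (0 < #|[set A : {set T} | (A \subset S) && (#|A| == n)]|)%N.
  by rewrite cards_draws bin_gt0.
by case/card_gt0P => A; rewrite inE => /andP[AS /eqP cA]; exists A.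
Qed.

(** Off-diagonal form, by induction on the sum of the targets [f c]. Colouring [Q] by the colour of
    [v |: Q] gives a homogeneous [S1] of some colour [c0]. Inside [S1], with the target of [c0]
    lowered by one, either another colour reaches its target or [v] completes a set of colour
    [c0]. *)
Lemma ramsey_step (C : finType) k :
  (forall n, exists M, forall (T : finType) (col : {set T} -> C) (S : {set T}),
    (M <= #|S|)%N -> exists (S' : {set T}) c, [/\ S' \subset S, #|S'| = n & homogeneous col k S' c]) ->
  forall N (f : C -> nat), (\sum_c f c <= N)%N ->
  exists M, forall (T : finType) (col : {set T} -> C) (S : {set T}),
    (M <= #|S|)%N -> exists (S' : {set T}) c, [/\ S' \subset S, #|S'| = f c & homogeneous col k.+1 S' c].
Proof.
move=> IHk; have trivial (f : C -> nat) c : f c = 0%N ->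
    exists M, forall (T : finType) (col : {set T} -> C) (S : {set T}),
    (M <= #|S|)%N -> exists (S' : {set T}) c, [/\ S' \subset S, #|S'| = f c & homogeneous col k.+1 S' c].
  move=> fc; exists 0%N => T col S _; exists set0, c; rewrite sub0set cards0 fc; split => // Q.
  by rewrite subset0 => /eqP ->; rewrite cards0.
elim=> [|N IHN] f fN.
  exists 0%N => T col S _.
  exists set0, (col set0); rewrite sub0set cards0; split => //.
    by apply/esym/eqP; rewrite -leqn0; apply: leq_trans fN; rewrite (bigD1 (col set0)) //= leq_addr.
  by move=> Q; rewrite subset0 => /eqP ->; rewrite cards0.
have [/existsP[c /eqP fc]|/existsPn fpos] := boolP [exists c, f c == 0%N].
  exact: trivial fc.
pose g c d := (f d - (d == c))%N.
have /fin_all_exists[M hM] : forall c, exists M, forall (T : finType)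
   (col : {set T} -> C) (S : {set T}), (M <= #|S|)%N ->
   exists (S' : {set T}) d, [/\ S' \subset S, #|S'| = g c d & homogeneous col k.+1 S' d].
  move=> c; apply: IHN; move: fN; rewrite (bigD1 c) //= [X in (X <= N)%N](bigD1 c) //=.
  have -> : (\sum_(i | i != c) g c i = \sum_(i | i != c) f i)%N.
    by apply: eq_bigr => i /negbTE ic; rewrite /g ic subn0.
  by rewrite /g eqxx; have := fpos c; lia.
have [M' hM'] := IHk (\max_c M c); exists M'.+1 => T col S MS.
have /card_gt0P[v vS] : (0 < #|S|)%N by lia.
have [|S1 [c0 [S1S cS1 hom1]]] := hM' T (fun Q => col (v |: Q)) (S :\ v).
  by move: MS; rewrite (cardsD1 v) vS.
have [|S2 [c [S2S1 cS2 hom2]]] := hM c0 T col S1; first by rewrite cS1 leq_bigmax.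
have vS1 : v \notin S1.
  by apply/negP => /(subsetP S1S); rewrite !inE eqxx.
have S1S' : S1 \subset S by apply: subset_trans S1S (subD1set _ _).
have [ec|nc] := eqVneq c c0; last first.
  exists S2, c; split; [exact: subset_trans S1S' | by rewrite cS2 /g (negbTE nc) subn0 | done].
rewrite {}ec in cS2 hom2; have vS2 : v \notin S2 by apply: contra vS1; apply: (subsetP S2S1).
exists (v |: S2), c0; split.
- by rewrite subUset sub1set vS; apply: subset_trans S1S'.
- by rewrite cardsU1 vS2 cS2 /g eqxx; have := fpos c0; lia.
move=> Q QS cQ; have [vQ|vQ] := boolP (v \in Q).
  rewrite -(setD1K vQ); apply: hom1.
    apply: subset_trans S2S1; apply/subsetP => x; rewrite !inE => /andP[xv /(subsetP QS)].
    by rewrite !inE (negbTE xv).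
  by have := cardsD1 v Q; rewrite vQ cQ; lia.
apply: hom2 => //; apply/subsetP => x xQ; have := subsetP QS x xQ.
by rewrite !inE => /orP[/eqP xv|//]; rewrite -xv xQ in vQ.
Qed.

Theorem ramsey (C : finType) k n : exists M, forall (T : finType) (col : {set T} -> C) (S : {set T}),
  (M <= #|S|)%N -> exists (S' : {set T}) c, [/\ S' \subset S, #|S'| = n & homogeneous col k S' c].
Proof.
elim: k n => [|k IH] n; last exact: (@ramsey_step C k IH _ (fun=> n) (leqnn _)).
exists n => T col S /subset_of_card[S' S'S cS']; exists S', (col set0); split => // Q _ /eqP.
by rewrite cards_eq0 => /eqP ->.
Qed.

(** * Roles *)

Section Listings.
Variables (T : finType) (le : rel T).
Hypothesis lin : linear_order le.

Lemma perm_listing S : perm_eq (listing le S) (enum S).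
Proof. by rewrite perm_sort. Qed.

Lemma mem_listing S x : (x \in listing le S) = (x \in S).
Proof. by rewrite (perm_mem (perm_listing S)) mem_enum. Qed.

Lemma size_listing S : size (listing le S) = #|S|.
Proof. by rewrite (perm_size (perm_listing S)) -cardE. Qed.

Lemma uniq_listing S : uniq (listing le S).
Proof. by rewrite (perm_uniq (perm_listing S)) enum_uniq. Qed.

Lemma sorted_index s x : sorted le s -> uniq s -> x \in s ->
  index x s = count (fun y => (y != x) && le y x) s.
Proof.
have [_ anti tr _] := lin; elim: s => //= a s IH pas /andP[as_ us].
have /allP aall : all (le a) s by apply: order_path_min.
rewrite inE; case: eqVneq => [-> _|xa /= xs].
  apply/esym/eqP; rewrite ?eqxx /= ?add0n -leqn0 leqNgt -has_count.
  apply/hasPn => y ys; apply/negP => /andP[ya yle].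
  by move: ya; rewrite (anti y a) ?eqxx // yle aall.
by rewrite aall // IH ?(path_sorted pas) // add1n.
Qed.

(** Expressing a position by a count of smaller elements frees it from the sorting algorithm;
    invariance of roles under monotone maps follows from it. *)
Lemma index_listing (S : {set T}) x : x \in S ->
  index x (listing le S) = #|[set y in S | (y != x) && le y x]|.
Proof.
move=> xS; have [_ _ tr tot] := lin.
rewrite sorted_index ?uniq_listing ?mem_listing //; last exact: sort_sorted.
rewrite (permP (perm_listing S)) cardE -size_filter; congr size.
by rewrite /enum_mem -filter_predI; apply: eq_filter => y; rewrite /= !inE andbC.
Qed.

Lemma index_listing_lt (S : {set T}) x y : x \in S -> y \in S ->
  (index x (listing le S) <= index y (listing le S))%N = le x y.
Proof.
move=> xS yS; have [refl anti tr tot] := lin.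
have mono u v : u \in S -> v \in S -> le u v ->
    (index u (listing le S) <= index v (listing le S))%N.
  move=> uS vS uv; rewrite !index_listing //; apply/subset_leq_card/subsetP => z.
  rewrite !inE => /and3P[-> zu zle]; rewrite (tr u) //= andbT.
  by apply: contraNneq zu => zv; apply/eqP/anti; rewrite zle zv.
apply/idP/idP => [h|]; last exact: mono.
have [//|yx] := orP (tot x y); have := mono _ _ yS xS yx => h'.
have /eqP e : index x (listing le S) == index y (listing le S) by rewrite eqn_leq h h'.
have -> : x = y by rewrite -(nth_index x (s := listing le S) (x := x)) ?mem_listing // e nth_index // mem_listing.
exact: refl.
Qed.

Lemma in_role k (S p : {set T}) x0 (i : 'I_k) : p \subset S -> #|S| = k ->
  (i \in role le k S p) = (nth x0 (listing le S) i \in p).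
Proof.
move=> pS cS; have iS : (i < size (listing le S))%N by rewrite size_listing cS.
rewrite inE; apply/existsP/idP => [[x /andP[xp /eqP <-]]|ip].
  by rewrite nth_index // mem_listing (subsetP pS).
by exists (nth x0 (listing le S) i); rewrite ip index_uniq ?uniq_listing /=.
Qed.

(** [psi] is the increasing enumeration of [S]. Taking images under it inverts [role], for subsets
    of any size. *)
Lemma role_enum k (S : {set T}) : (0 < k)%N -> #|S| = k ->
  exists psi : 'I_k -> T, [/\ injective psi, forall i j : 'I_k, (i <= j)%N = le (psi i) (psi j),
    psi @: setT = S & forall p : {set T}, p \subset S -> psi @: role le k S p = p].
Proof.
move=> k0 cS; have /card_gt0P[x0 _] : (0 < #|S|)%N by rewrite cS.
have psiS (j : 'I_k) : nth x0 (listing le S) j \in S.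
  by rewrite -mem_listing mem_nth // size_listing cS.
have idx (j : 'I_k) : index (nth x0 (listing le S) j) (listing le S) = j.
  by rewrite index_uniq ?uniq_listing // size_listing cS.
pose psi (j : 'I_k) := nth x0 (listing le S) j.
have inj : injective psi by move=> i j e; apply: val_inj; rewrite /= -(idx i) -(idx j) -/(psi i) e.
have surj x : x \in S -> exists j, x = psi j.
  move=> xS; have ik : (index x (listing le S) < k)%N by rewrite -cS -size_listing index_mem mem_listing.
  by exists (Ordinal ik); rewrite /psi nth_index ?mem_listing.
exists psi; split => // [i j||p pS].
- by rewrite -(index_listing_lt (psiS i) (psiS j)) !idx.
- apply/setP => x; apply/imsetP/idP => [[j _ ->]|/surj[j ->]].
    exact: psiS.
  by exists j.
apply/setP => x; apply/imsetP/idP => [[j]|xp].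
  by rewrite (in_role x0) // => jp ->.
have [j xj] := surj x (subsetP pS x xp); exists j => //.
by rewrite (in_role x0) // -/(psi j) -xj.
Qed.
End Listings.

Lemma role_imset (T T' : finType) (le : rel T) (le' : rel T') k (phi : T -> T')
    (S p : {set T}) :
  linear_order le -> linear_order le' -> {in S &, injective phi} ->
  {in S &, forall x y, le x y -> le' (phi x) (phi y)} ->
  p \subset S -> role le' k (phi @: S) (phi @: p) = role le k S p.
Proof.
move=> lin lin' inj mono pS; have [_ anti _ tot] := lin; have [_ anti' _ _] := lin'.
have mono' : {in S &, forall x y, le' (phi x) (phi y) = le x y}.
  move=> x y xS yS; apply/idP/idP => [h|]; last exact: mono.
  have [//|yx] := orP (tot x y); have h' := mono _ _ yS xS yx.
  have e : phi x = phi y by apply: anti'; rewrite h h'.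
  by rewrite (inj _ _ xS yS e); have [refl _ _ _] := lin.
have idx x : x \in S -> index (phi x) (listing le' (phi @: S)) = index x (listing le S).
  move=> xS; rewrite !index_listing ?imset_f //.
  rewrite -(card_in_imset (f := phi)); last first.
    by apply: sub_in2 inj => y; rewrite inE => /andP[].
  apply: eq_card => y; rewrite !inE; apply/andP/imsetP => [[/imsetP[z zS ->] /andP[ne l]]|[z]].
    exists z => //; rewrite !inE zS /=; apply/andP; split; last by rewrite -mono'.
    by apply: contraNneq ne => ->.
  rewrite !inE => /and3P[zS ne l] ->; rewrite imset_f //; split => //.
  by rewrite mono' // l andbT; apply: contraNneq ne => /(inj _ _ zS xS) ->.
apply/setP => i; rewrite !inE; apply/existsP/existsP => [[y /andP[/imsetP[x xp ->] h]]|[x /andP[xp h]]].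
  by exists x; rewrite xp -idx ?(subsetP pS).
by exists (phi x); rewrite imset_f //= idx ?(subsetP pS).
Qed.

Definition ordle m : rel 'I_m := fun i j => (i <= j)%N.

Lemma ordle_linear m : linear_order (@ordle m).
Proof.
split => [i|i j h|i j k|i j]; rewrite /ordle //; last exact: leq_total.
- by apply: val_inj; apply/eqP; rewrite eqn_leq.
- exact: leq_trans.
Qed.

Lemma role_ord k (p : {set 'I_k}) : role (@ordle k) k setT p = p.
Proof.
apply/setP => i; rewrite inE.
have idx (x : 'I_k) : index x (listing (@ordle k) setT) = x.
  rewrite index_listing ?inE //; last exact: ordle_linear.
  have -> : [set y in setT | (y != x) && ordle y x] = [set y : 'I_k | (y < x)%N].
    by apply/setP => y; rewrite !inE ltn_neqAle.
  rewrite -sum1_card; under eq_bigl do rewrite inE.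
  rewrite (big_ord_narrow (ltnW (ltn_ord x))) /=.
  by rewrite sum1_card card_ord.
apply/existsP/idP => [[x]|ip]; first by rewrite idx => /andP[xp /eqP/val_inj <-].
by exists i; rewrite ip idx eqxx.
Qed.

(** Adding the Z-positions makes the values at [LX] and [LY] the positions of the two whole edges in
    their union; the value at [LZ] is that of the common pair. *)
Definition letter_set k (s : k.-tuple letter) (l : letter) : {set 'I_k} :=
  [set i | (tnth s i == l) || (tnth s i == LZ)].

Lemma vertex_letterX (T : finType) (A B : {set T}) x :
  (vertex_letter A B x == LX) = (x \in A) && (x \notin B).
Proof. by rewrite /vertex_letter inE; case: (x \in A); case: (x \in B). Qed.

Lemma vertex_letterY (T : finType) (A B : {set T}) x : x \in A :|: B ->
  (vertex_letter A B x == LY) = (x \in B) && (x \notin A).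
Proof. by rewrite /vertex_letter !inE; case: (x \in A); case: (x \in B). Qed.

Lemma vertex_letterZ (T : finType) (A B : {set T}) x :
  (vertex_letter A B x == LZ) = (x \in A) && (x \in B).
Proof. by rewrite /vertex_letter inE; case: (x \in A); case: (x \in B). Qed.

Lemma described_roles (T : finType) (le : rel T) k (s : k.-tuple letter) (A B : {set T}) :
  linear_order le -> #|A :|: B| = k ->
  tval s = map (vertex_letter A B) (listing le (A :|: B)) ->
  [/\ role le k (A :|: B) A = letter_set s LX,
      role le k (A :|: B) B = letter_set s LY &
      role le k (A :|: B) (A :&: B) = letter_set s LZ].
Proof.
move=> lin cQ es; have [k0|k0] := posnP k.
  by split; apply/setP => i; have := ltn_ord i; rewrite {2}k0.
have /card_gt0P[x0 _] : (0 < #|A :|: B|)%N by rewrite cQ.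
have tn i : tnth s i = vertex_letter A B (nth x0 (listing le (A :|: B)) i).
  by rewrite (tnth_nth LX) es (nth_map x0) // size_listing // cQ.
have inQ (i : 'I_k) : nth x0 (listing le (A :|: B)) i \in A :|: B.
  by rewrite -(mem_listing le) mem_nth // size_listing // cQ.
split; apply/setP => i; rewrite (in_role le x0) ?subsetUl ?subsetUr //; last first.
- by rewrite subIset // subsetUl.
- by rewrite !inE tn !vertex_letterZ orbb.
- by rewrite !inE tn vertex_letterZ vertex_letterY //; move: (inQ i); rewrite !inE; case: (_ \in A); case: (_ \in B).
- by rewrite !inE tn vertex_letterZ vertex_letterX; case: (_ \in A); case: (_ \in B).
Qed.

Lemma card_twin_union (T : finType) (A B : {set T}) k :
  #|A| = k -> #|B| = k -> #|A :&: B| = 2 -> #|A :|: B| = (2 * k - 2)%N.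
Proof. by move=> cA cB cI; rewrite cardsU cA cB cI mul2n addnn. Qed.

(** The sequence is read off from the sorted union. The role of the common pair in [A] or in [B] can
    be computed from positions in the union alone ([key]), so unequal roles mean an inconsistent
    sequence. *)
Lemma crossing_pattern (T : finType) (le : rel T) k (A B : {set T}) :
  linear_order le -> (1 < k)%N -> #|A| = k -> #|B| = k -> #|A :&: B| = 2 ->
  role le k A (A :&: B) <> role le k B (A :&: B) ->
  exists s : (2 * k - 2).-tuple letter, [/\ descriptive s, ~~ consistent_seq s,
      role le (2 * k - 2) (A :|: B) A = letter_set s LX,
      role le (2 * k - 2) (A :|: B) B = letter_set s LY &
      role le (2 * k - 2) (A :|: B) (A :&: B) = letter_set s LZ].
Proof.
move=> lin k1 cA cB cI ne; have cQ := card_twin_union cA cB cI.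
have sz : size (map (vertex_letter A B) (listing le (A :|: B))) == (2 * k - 2)%N.
  by rewrite size_map size_listing cQ.
pose s := Tuple sz; have [eX eY eZ] := described_roles (s := s) lin cQ erefl.
have cnt l : count_mem l s = #|[set x in A :|: B | vertex_letter A B x == l]|.
  rewrite count_map (permP (perm_listing le _)) cardE -size_filter; congr size.
  by rewrite /enum_mem -filter_predI; apply: eq_filter => y; rewrite /= [RHS]inE andbC.
exists s; split => //.
  rewrite /descriptive !cnt; apply/and3P; split.
  - rewrite (_ : [set _ in _ | _] = A :\: B); last first.
      by apply/setP => x; rewrite !inE vertex_letterX; case: (x \in A); case: (x \in B).
    by rewrite cardsD cA cI.
  - rewrite (_ : [set _ in _ | _] = B :\: A); last first.
      apply/setP => x; rewrite in_set; have [xQ|] := boolP (x \in A :|: B).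
          by rewrite vertex_letterY // !inE [RHS]andbC.
      by rewrite !inE; case: (x \in A); case: (x \in B).
    by rewrite cardsD cB setIC cI.
  - rewrite (_ : [set _ in _ | _] = A :&: B) ?cI //.
    by apply/setP => x; rewrite !inE vertex_letterZ; case: (x \in A); case: (x \in B).
have q0 : (0 < 2 * k - 2)%N by lia.
have [psi [inj mono _ sub]] := role_enum lin q0 cQ.
have IA : A :&: B \subset A by exact: subsetIl.
have IB : A :&: B \subset B by exact: subsetIr.
have key (C : {set T}) : C \subset A :|: B -> A :&: B \subset C ->
    role le k C (A :&: B) = role (@ordle (2 * k - 2)) k (role le (2 * k - 2) (A :|: B) C)
      (role le (2 * k - 2) (A :|: B) (A :&: B)).
  move=> CQ IC; have IQ := subset_trans IC CQ.
  rewrite -(role_imset k (phi := psi) (@ordle_linear _) lin); rewrite ?sub //.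
  - by move=> i j _ _ /inj.
  - by move=> i j _ _; rewrite -mono.
  - apply/subsetP => i; have := sub _ IQ; have := sub _ CQ => eC eI.
    rewrite -(mem_imset _ _ inj) eI => /(subsetP IC).
    by rewrite -{1}eC (mem_imset _ _ inj).
have ZZ : letter_set s LZ = [set i | tnth s i == LZ].
  by apply/setP => i; rewrite !inE orbb.
rewrite /consistent_seq -ZZ -/(letter_set s LX) -/(letter_set s LY) -eX -eY -eZ.
apply/eqP => h; apply: ne; rewrite !key ?subsetUl ?subsetUr //.
Qed.

(** * One r-set for each role of a fixed pair *)

Section CrossingFamily.
Variables (m r : nat) (S : {set 'I_m}).

Let K := #|{: {set 'I_r}}|.
Let W := (K * r).+1%N.

(* Positions of an r-set in which the pair in role rho occupies the residue K r
   modulo W; residues below K r are reserved for the other vertices, in disjoint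
   blocks of length r indexed by rho. *)
Definition crossing_position (rho : {set 'I_r}) (c : 'I_r) : nat :=
  (W * #|[set x in rho | (x < c)%N]| +
    (if c \in rho then K * r else enum_rank rho * r + c))%N.

Lemma crossing_position_small (rho : {set 'I_r}) (c : 'I_r) :
  (enum_rank rho * r + c < K * r)%N.
Proof.
have := ltn_ord (enum_rank rho); rewrite -[#|_|]/K => h.
by apply: (@leq_trans ((enum_rank rho).+1 * r)); rewrite ?leq_mul2r ?h ?orbT // mulSn addnC ltn_add2r.
Qed.

Lemma crossing_position_mono rho (c d : 'I_r) : (c < d)%N ->
  (crossing_position rho c < crossing_position rho d)%N.
Proof.
move=> cd; rewrite /crossing_position.
have sub : [set x in rho | (x < c)%N] \subset [set x in rho | (x < d)%N].
  by apply/subsetP => x; rewrite !inE => /andP[-> /ltn_trans->].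
have := subset_leq_card sub.
have [cr|cr] := boolP (c \in rho).
  have cS : c |: [set x in rho | (x < c)%N] \subset [set x in rho | (x < d)%N].
    by rewrite subUset sub sub1set !inE cr cd.
  have := subset_leq_card cS; rewrite cardsU1 inE ltnn andbF add1n /=.
  set a := #|_|; set b := #|_| => ab _.
  have : (W * a.+1 <= W * b)%N by rewrite leq_mul2l ab orbT.
  by rewrite mulnS /W; lia.
have sc := crossing_position_small rho c.
set a := #|_|; set b := #|_| => ab.
have : (W * a <= W * b)%N by rewrite leq_mul2l ab orbT.
by case: ifP => dr; lia.
Qed.

(** Modulo [W], a vertex of the pair has residue [K * r] and any other vertex has a residue in the
    block of its own role, so different roles collide only on the pair. *)
Lemma crossing_position_inj rho rho' (c d : 'I_r) :
  crossing_position rho c = crossing_position rho' d -> rho != rho' ->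
  c \in rho /\ d \in rho'.
Proof.
move=> e ne; have W0 : (0 < W)%N by [].
have md rho1 c1 : (crossing_position rho1 c1 %% W = if c1 \in rho1 then K * r else enum_rank rho1 * r + c1)%N.
  rewrite /crossing_position mulnC modnMDl modn_small //.
  by case: ifPn => h //; rewrite /W ltnS ltnW // crossing_position_small.
have := congr1 (modn^~ W) e; rewrite /= !md.
have [cr|cr] := boolP (c \in rho); have [dr|dr] := boolP (d \in rho') => //.
- by have := crossing_position_small rho' d; lia.
- by have := crossing_position_small rho c; lia.
move=> h; have r0 : (0 < r)%N by apply: leq_trans (ltn_ord c).
have : enum_rank rho = enum_rank rho' :> nat.
  by have := congr1 (divn^~ r) h; rewrite /= !divnMDl // !divn_small ?addn0.
by move/val_inj/enum_rank_inj => e'; rewrite e' eqxx in ne.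
Qed.

Lemma crossing_position_pair (rho : {set 'I_r}) (c : 'I_r) : #|rho| = 2 -> c \in rho ->
  crossing_position rho c = (K * r)%N \/ crossing_position rho c = (W + K * r)%N.
Proof.
move=> c2 cr; rewrite /crossing_position cr.
have : ([set x in rho | (x < c)%N] \subset rho :\ c).
  by apply/subsetP => x; rewrite !inE => /andP[-> xc]; rewrite andbT -val_eqE /= neq_ltn xc.
move/subset_leq_card; have := cardsD1 c rho; rewrite cr c2 add1n => -[<-].
by case: #|_| => [|[|n]] // _; [left | right]; rewrite ?muln0 ?muln1.
Qed.

(** The number of pair vertices before [c] is 0, 1 or 2, which gives three windows of length [W]. *)
Lemma crossing_position_lt (rho : {set 'I_r}) (c : 'I_r) : #|rho| = 2 -> (crossing_position rho c < 3 * W)%N.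
Proof.
move=> c2; rewrite /crossing_position.
have : (#|[set x in rho | (x < c)%N]| <= 2)%N.
  by rewrite -[2%N]c2; apply/subset_leq_card/subsetP => x; rewrite inE => /andP[].
set a := #|_| => a2; have : (W * a <= W * 2)%N by rewrite leq_mul2l a2 orbT.
have eW : W = (K * r).+1 by [].
move: eW; set P := (W * a)%N; clearbody P W; move=> eW hP.
case: ifPn => [_|_]; last move: (crossing_position_small rho c).
  by clear -eW hP; lia.
move=> h; clear -eW hP h; move: h; set y := (enum_rank rho * r + c)%N.
by move=> h; lia.
Qed.

(** Two members meet exactly in [p] and give it different roles. This is the configuration in which
    the graphs on [p] are almost disjoint, for all pairs of roles at once. *)
Theorem crossing_family : (1 < r)%N -> (3 * W <= #|S|)%N ->
  exists (p : {set 'I_m}) (A : {set 'I_r} -> {set 'I_m}),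
    #|p| = 2 /\ forall rho : {set 'I_r}, #|rho| = 2 ->
      [/\ A rho \subset S, #|A rho| = r, p \subset A rho, role (@ordle m) r (A rho) p = rho &
        forall rho' : {set 'I_r}, #|rho'| = 2 -> rho != rho' -> A rho :&: A rho' = p].
Proof.
move=> r1 WS; have S0 : (0 < #|S|)%N by lia.
have [g [ginj gmono gS _]] := role_enum (@ordle_linear m) S0 (erefl #|S|).
have i0 : 'I_#|S| := Ordinal S0.
pose h n := g (insubd i0 n).
have hS n : h n \in S by rewrite -gS imset_f.
have hlt a b : (a < #|S|)%N -> (b < #|S|)%N -> (a <= b)%N = (h a <= h b)%N.
  move=> aS bS; rewrite /h; have := gmono (insubd i0 a) (insubd i0 b).
  by rewrite !val_insubd aS bS.
have hinj a b : (a < #|S|)%N -> (b < #|S|)%N -> h a = h b -> a = b.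
  by move=> aS bS e; apply/eqP; rewrite eqn_leq (hlt a b aS bS) (hlt b a bS aS) e leqnn.
pose phi rho c := h (crossing_position rho c).
pose p := [set h (K * r)%N; h (W + K * r)%N].
have WS1 : (K * r < #|S|)%N by move: WS; rewrite /W; lia.
have WS2 : (W + K * r < #|S|)%N by move: WS; rewrite /W; lia.
have cp : #|p| = 2.
  rewrite cards2; case: eqP => // /(hinj _ _ WS1 WS2); rewrite /W; lia.
have pos_lt (rho : {set 'I_r}) c : #|rho| = 2 -> (crossing_position rho c < #|S|)%N.
  by move=> c2; apply: leq_trans (crossing_position_lt c c2) WS.
have phimono (rho : {set 'I_r}) (c d : 'I_r) : #|rho| = 2 -> (c < d)%N -> (phi rho c < phi rho d)%N.
  move=> c2 cd; rewrite ltnNge /phi -(hlt _ _ (pos_lt _ d c2) (pos_lt _ c c2)) -ltnNge.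
  exact: crossing_position_mono.
have phiinj (rho : {set 'I_r})  : #|rho| = 2 -> injective (phi rho).
  move=> c2 c d e; apply: val_inj; case: (ltngtP c d) => // lt.
    by have := phimono _ _ _ c2 lt; rewrite e ltnn.
  by have := phimono _ _ _ c2 lt; rewrite e ltnn.
have phip (rho : {set 'I_r})  : #|rho| = 2 -> phi rho @: rho = p.
  move=> c2; apply/eqP; rewrite eqEcard cp card_imset ?c2 ?leqnn ?andbT; last exact: phiinj.
  apply/subsetP => x /imsetP[c cr ->]; rewrite !inE /phi.
  by case: (crossing_position_pair c2 cr) => ->; rewrite eqxx ?orbT.
exists p, (fun rho => phi rho @: setT); split => // rho c2; split.
- by apply/subsetP => x /imsetP[c _ ->]; exact: hS.
- by rewrite card_imset ?cardsT ?card_ord //; exact: phiinj.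
- by rewrite -(phip _ c2) imsetS // subsetT.
- rewrite -(phip _ c2) (role_imset r (@ordle_linear r) (@ordle_linear m)) ?role_ord ?subsetT //.
  + by move=> c d _ _ /(phiinj _ c2).
  + move=> c d _ _; rewrite /ordle leq_eqVlt => /orP[/eqP/val_inj -> //|lt].
    exact/ltnW/phimono.
move=> rho' c2' ne; apply/setP => x; apply/idP/idP.
  rewrite inE => /andP[/imsetP[c _ ->] /imsetP[d _ e]].
  have /(crossing_position_inj)/(_ ne)[cr dr] := hinj _ _ (pos_lt _ _ c2) (pos_lt _ _ c2') e.
  by rewrite -(phip _ c2) imset_f.
move=> xp; rewrite inE; apply/andP; split.
  by move: xp; rewrite -(phip _ c2) => /(subsetP (imsetS _ (subsetT _))).
by move: xp; rewrite -(phip _ c2') => /(subsetP (imsetS _ (subsetT _))).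
Qed.
End CrossingFamily.

(** * Numerical estimates and equal parts *)

Section Numeric.
Variable R : archiRealFieldType.

(** A convex function lies below its chord over the unit interval. *)
Lemma expr_1D_le (x : R) n : 0 <= x <= 1 -> (1 + x) ^+ n <= 1 + (2 ^+ n - 1) * x.
Proof.
move=> /andP[x0 x1]; elim: n => [|n IH]; first by rewrite !expr0 subrr mul0r addr0.
rewrite exprSr; have h := ler_wpM2r (addr_ge0 ler01 x0) IH; apply: le_trans h _.
have : 1 <= 2 ^+ n :> R by rewrite exprn_ege1 // ler1n.
rewrite exprSr; set p := 2 ^+ n => p1.
have : 0 <= (p - 1) * x * (1 - x) by rewrite !mulr_ge0 ?subr_ge0.
by lra.
Qed.

Lemma nat_above (x : R) : exists n : nat, x <= n%:R.
Proof.
exists (Num.bound x); have [x0|x0] := leP 0 x; first exact/ltW/archi_boundP.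
by apply: le_trans (ltW x0) (ler0n _ _).
Qed.

Lemma ffact_le_exp n k : (n ^_ k <= n ^ k)%N.
Proof.
by rewrite ffact_prod -[k in (_ ^ k)%N]card_ord -prod_nat_const; apply: leq_prod => i _; exact: leq_subr.
Qed.

Lemma exp_le_ffact n k : ((n - k) ^ k <= n ^_ k)%N.
Proof.
rewrite ffact_prod -[k in (_ ^ k)%N]card_ord -prod_nat_const; apply: leq_prod => i _.
by apply: leq_sub2l; apply: ltnW.
Qed.

(** Among [n] blocks of size [s], the r-sets that meet a block twice are negligible for large [n],
    uniformly in [s]. *)
Lemma binomial_ratio r (theta : R) : 0 < theta -> exists n0, forall n s, (n0 <= n)%N ->
  'C(n * s, r)%:R <= (1 + theta) * ('C(n, r)%:R * (s ^ r)%:R).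
Proof.
move=> t0; have [N hN] := nat_above (r%:R * 2 ^+ r / theta).
(* This makes r / (n - r) at most theta / 2^r, which absorbs the factor 2^r from [expr_1D_le]. *)
exists (r + r + N.+1)%N => n s hn.
have f0 : 0 < (r`!)%:R :> R by rewrite ltr0n fact_gt0.
have eC k : 'C(k, r)%:R * (r`!)%:R = (k ^_ r)%:R :> R by rewrite -natrM bin_ffact.
rewrite -(ler_pM2r f0) eC.
have -> : (1 + theta) * ('C(n, r)%:R * (s ^ r)%:R) * (r`!)%:R =
   (1 + theta) * (n ^_ r)%:R * (s ^ r)%:R :> R.
  by rewrite -eC; ring.
apply: (@le_trans _ _ ((n ^ r)%:R * (s ^ r)%:R)).
  by rewrite -natrM ler_nat -expnMn ffact_le_exp.
apply: ler_wpM2r => //; apply: (@le_trans _ _ ((1 + theta) * ((n - r) ^ r)%:R)); last first.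
  by rewrite ler_wpM2l ?ler_nat ?exp_le_ffact // addr_ge0 // ltW.
pose m := (n - r)%N; have m0 : 0 < m%:R :> R by rewrite ltr0n /m; lia.
have -> : n = (m + r)%N by rewrite /m; lia.
rewrite addnK.
pose x : R := r%:R / m%:R.
have xle : x <= theta / 2 ^+ r.
  have p2 : 0 < 2 ^+ r :> R by rewrite exprn_gt0.
  rewrite ler_pdivrMr // mulrAC ler_pdivlMr //.
  have hN' : r%:R * 2 ^+ r <= N%:R * theta by rewrite -ler_pdivrMr.
  apply: le_trans hN' _; rewrite [N%:R * _]mulrC ler_wpM2l ?(ltW t0) //.
  by rewrite ler_nat /m; lia.
have x0 : 0 <= x by rewrite divr_ge0.
have x1 : x <= 1 by rewrite ler_pdivrMr // mul1r ler_nat /m; lia.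
have e : (m + r)%:R = m%:R * (1 + x) :> R.
  by rewrite mulrDr mulr1 /x mulrCA divff ?gt_eqF // mulr1 natrD.
rewrite !natrX e exprMn mulrC; apply: ler_wpM2r; first by rewrite exprn_ge0 // ltW.
have x01 : 0 <= x <= 1 by rewrite x0.
apply: le_trans (expr_1D_le r x01) _; rewrite lerD2l.
apply: (@le_trans _ _ (2 ^+ r * x)).
  by rewrite ler_wpM2r // lerBlDr lerDl.
rewrite -ler_pdivlMl ?exprn_gt0 // mulrC //.
Qed.

Lemma agm_power (I : finType) (P : pred I) (a : I -> R) (x : R) :
  (forall i, 0 <= a i) -> (0 < #|P|)%N -> 0 <= x <= 1 -> \sum_(i in P) a i <= 1 + x ->
  \prod_(i in P) a i <= #|P|%:R ^- #|P| * (1 + 2 ^+ #|P| * x).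
Proof.
move=> a0 P0 x01 hs; have /andP[x0 x1] := x01.
have Pr : 0 < #|P|%:R :> R by rewrite ltr0n.
have agm := leif_AGM (A := P) (fun i (_ : i \in P) => a0 i).
apply: le_trans (leif_le agm) _; rewrite expr_div_n mulrC.
rewrite ler_wpM2l ?invr_ge0 ?exprn_ge0 //.
apply: (@le_trans _ _ ((1 + x) ^+ #|P|)).
  by rewrite lerXn2r // nnegrE ?addr_ge0 // sumr_ge0.
apply: le_trans (expr_1D_le _ x01) _.
by rewrite lerD2l ler_wpM2r // lerBlDr lerDl.
Qed.

Lemma equal_parts (T : finType) m : (0 < m)%N -> exists V : 'I_m -> {set T},
  (forall i j, i != j -> [disjoint V i & V j]) /\ (forall i, #|V i| = (#|T| %/ m)%N).
Proof.
move=> m0; set s := (#|T| %/ m)%N.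
have lt (i : 'I_m) (j : 'I_s) : (i * s + j < #|T|)%N.
  apply: (@leq_trans (i.+1 * s)); first by rewrite mulSn addnC ltn_add2r.
  by apply: (@leq_trans (m * s)); rewrite ?leq_mul2r ?ltn_ord ?orbT // mulnC leq_divM.
pose g i j : T := enum_val (Ordinal (lt i j)).
have ginj i j i' j' : g i j = g i' j' -> i = i' /\ j = j'.
  move=> /enum_val_inj/(congr1 val) /= e; have s0 : (0 < s)%N by apply: leq_ltn_trans (ltn_ord j).
  have e1 : i = i'.
    by apply: val_inj; have := congr1 (divn^~ s) e; rewrite /= !divnMDl // !divn_small ?addn0.
  by split => //; apply: val_inj; move: e; rewrite e1 /= => /addnI.
exists (fun i => [set g i j | j : 'I_s]); split => [i i' ne|i].
  rewrite -setI_eq0; apply/set0Pn => -[t]; rewrite inE => /andP[/imsetP[j _ ->] /imsetP[j' _ e]].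
  by have [e1 _] := ginj _ _ _ _ e; rewrite e1 eqxx in ne.
by rewrite card_imset ?card_ord // => j j' /ginj[].
Qed.
End Numeric.

(** * Twin pairs and their images among the indices *)

Section Twins.
Variables (r : nat) (F : hypergraph r).
Hypothesis F_ql : quasi_linear F.

Lemma twins_sym (e f : {set F}) : twins e f -> twins f e.
Proof. by case=> eE fE ne c; split; rewrite // 1?eq_sym // setIC. Qed.

Lemma twins_uniq (e f f' : {set F}) : twins e f -> twins e f' -> f = f'.
Proof.
move=> ef ef'; have [eE _ _ _] := ef; have [f0 [[_ u] _]] := F_ql eE.
by rewrite -(u f ef) -(u f' ef').
Qed.

Lemma twins_meet (e f g : {set F}) : twins e f -> g \in edges F -> g != e -> g != f ->
  (#|e :&: g| <= 1)%N.
Proof.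
move=> ef gE ge gf; have [eE _ _ _] := ef; have [f0 [[t0 u] h]] := F_ql eE.
by apply: h; rewrite // !inE negb_or ge (u f ef).
Qed.

(** Comparing ranks selects one orientation, so that each unordered twin pair is listed once. *)
Definition twin_pair (j : {set F} * {set F}) :=
  [&& j.1 \in edges F, j.2 \in edges F, j.1 != j.2, #|j.1 :&: j.2| == 2 &
    (enum_rank j.1 < enum_rank j.2)%N].

Lemma twin_pairP j : reflect (twins j.1 j.2 /\ (enum_rank j.1 < enum_rank j.2)%N) (twin_pair j).
Proof.
apply: (iffP and5P) => [[a b c /eqP d e]|[[a b c d] e]]; split => //.
by apply/eqP.
Qed.

Lemma twin_pair_meet j k (C D : {set F}) : twin_pair j -> twin_pair k -> j != k ->
  C \in [:: j.1; j.2] -> D \in [:: k.1; k.2] -> (#|C :&: D| <= 1)%N.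
Proof.
case: j k => [e f] [e' f'] /twin_pairP[/= ef lt] /twin_pairP[/= ef' lt'] ne.
have fe := twins_sym ef; have fe' := twins_sym ef'.
have [eE fE _ _] := ef; have [eE' fE' _ _] := ef'.
have n1 : e' != e.
  by apply: contraNneq ne => h; rewrite h in ef' *; rewrite (twins_uniq ef ef').
have n2 : e' != f.
  apply: contraTneq lt => h; rewrite h in ef' lt'.
  by rewrite (twins_uniq fe ef') -leqNgt ltnW.
have n3 : f' != e.
  apply: contraTneq lt => h; rewrite h in fe' lt'.
  by rewrite -leqNgt (twins_uniq ef fe') ltnW.
have n4 : f' != f.
  by apply: contraNneq ne => h; rewrite h in fe' *; rewrite (twins_uniq fe fe').
rewrite !inE => /orP[]/eqP-> /orP[]/eqP->.
- exact: (twins_meet ef).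
- exact: (twins_meet ef).
- exact: (twins_meet fe).
- exact: (twins_meet fe).
Qed.

Lemma twin_list (m : nat) (psi : F -> 'I_m) : injective psi ->
  exists L : seq ({set 'I_m} * {set 'I_m}),
  [/\ uniq L, (size L <= #|{: {set F} * {set F}}|)%N,
    forall j, j \in L -> exists e f, twins e f /\ j = (psi @: e, psi @: f),
    forall j k (C D : {set 'I_m}), j \in L -> k \in L -> j != k ->
      C \in [:: j.1; j.2] -> D \in [:: k.1; k.2] -> (#|D :&: C| <= 1)%N &
    forall e : {set F}, e \in edges F -> exists2 j, j \in L & psi @: e \in [:: j.1; j.2]].
Proof.
move=> inj; pose im (j : {set F} * {set F}) := (psi @: j.1, psi @: j.2).
have iminj : injective im by case=> a b [c d] [/(imset_inj inj) -> /(imset_inj inj) ->].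
exists [seq im j | j <- enum twin_pair]; split.
- by rewrite map_inj_uniq // enum_uniq.
- by rewrite size_map -cardE max_card.
- move=> j /mapP[[e f]]; rewrite mem_enum => /twin_pairP[ef _] ->.
  by exists e, f.
- move=> j k C D /mapP[j0 + ->] /mapP[k0 + ->]; rewrite !mem_enum => j0P k0P ne.
  rewrite (inj_eq iminj) in ne.
  have memim (l : {set F} * {set F}) B : B \in [:: (im l).1; (im l).2] ->
      exists2 B0, B0 \in [:: l.1; l.2] & B = psi @: B0.
    by rewrite !inE => /orP[]/eqP->; [exists l.1 | exists l.2]; rewrite // !inE eqxx ?orbT.
  move=> /memim[C0 C0j ->] /memim[D0 D0k ->].
  rewrite setIC -imsetI; last by move=> x y _ _; exact: inj.
  by rewrite card_imset //; apply: twin_pair_meet C0j D0k.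
move=> e eE; have [f [[ef _] _]] := F_ql eE; have [_ _ nef _] := ef.
have [lt|lt|eq] := ltngtP (enum_rank e) (enum_rank f).
- exists (im (e, f)); last by rewrite !inE eqxx.
  by apply: map_f; rewrite mem_enum; apply/twin_pairP.
- exists (im (f, e)); last by rewrite !inE eqxx orbT.
  by apply: map_f; rewrite mem_enum; apply/twin_pairP; split => //; exact: twins_sym.
by move/val_inj/enum_rank_inj: eq => eq; rewrite eq eqxx in nef.
Qed.
End Twins.

Lemma order_embedding (T : finType) (le : rel T) m (S : {set 'I_m}) :
  linear_order le -> (0 < #|S|)%N -> (#|T| <= #|S|)%N ->
  exists psi : T -> 'I_m, [/\ injective psi, forall x, psi x \in S &
    forall x y, le x y -> ordle (psi x) (psi y)].
Proof.
move=> lin S0 TS; have [g [ginj gmono gS _]] := role_enum (@ordle_linear m) S0 (erefl #|S|).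
have lt x : (index x (listing le setT) < #|S|)%N.
  by apply: leq_trans TS; rewrite -cardsT -(size_listing le) index_mem mem_listing inE.
exists (fun x => g (Ordinal (lt x))); split => [x y /ginj [e]|x|x y xy].
- have xT : x \in listing le setT by rewrite mem_listing inE.
  by rewrite -(nth_index x xT) e nth_index // mem_listing inE.
- by have := imset_f g (in_setT (Ordinal (lt x))); rewrite gS.
by rewrite -gmono /= index_listing_lt ?inE.
Qed.

Lemma described_level (T : finType) (le : rel T) m k (s : k.-tuple letter) (psi : T -> 'I_m)
    (A B : {set T}) :
  linear_order le -> injective psi -> (forall x y, le x y -> ordle (psi x) (psi y)) ->
  #|A :|: B| = k -> tval s = map (vertex_letter A B) (listing le (A :|: B)) ->
  [/\ role (@ordle m) k (psi @: A :|: psi @: B) (psi @: A) = letter_set s LX,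
      role (@ordle m) k (psi @: A :|: psi @: B) (psi @: B) = letter_set s LY &
      role (@ordle m) k (psi @: A :|: psi @: B) (psi @: A :&: psi @: B) = letter_set s LZ].
Proof.
move=> lin inj mono cQ /(described_roles lin cQ)[eX eY eZ].
rewrite -imsetU -imsetI; last by move=> x y _ _; exact: inj.
have tr (C : {set T}) : C \subset A :|: B ->
    role (@ordle m) k (psi @: (A :|: B)) (psi @: C) = role le k (A :|: B) C.
  move=> CQ; apply: role_imset => //; first exact: ordle_linear.
    by move=> x y _ _; exact: inj.
  by move=> x y _ _; exact: mono.
by split; rewrite tr // ?subsetUl ?subsetUr // subIset // subsetUl.
Qed.

(** * The upper bound *)

Section UpperBound.
Variable R : archiRealFieldType.

(** There are [L.+1] levels because [x = 1] has level [L]. On the unit interval, level 0 means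
    density below 1/L. *)
Definition level (L : nat) (x : R) : 'I_L.+1 := inord (Num.trunc (x * L%:R)).

Lemma levelP (L : nat) (x : R) : (0 < L)%N -> 0 <= x <= 1 ->
  (level L x)%:R / L%:R <= x < (level L x).+1%:R / L%:R.
Proof.
move=> L0 /andP[x0 x1]; have Lr : 0 < L%:R :> R by rewrite ltr0n.
have xL : 0 <= x * L%:R by rewrite mulr_ge0 // ltW.
have /andP[lo hi] := truncn_itv xL.
have le : (Num.trunc (x * L%:R) < L.+1)%N.
  by rewrite ltnS -(ler_nat R); apply: le_trans lo _; rewrite ler_piMl // ltW.
by rewrite /level inordK // ler_pdivrMr // lo ltr_pdivlMr.
Qed.

(** If k of the conditions hold at a point, then k <= 1 + k(k - 1), and k(k - 1) counts the ordered
    pairs of distinct conditions that hold there. *)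
Lemma almost_disjoint (I T J : finType) (P : pred J) (W : I -> {set T})
    (u : J -> {ffun I -> T} -> bool) (delta : R) : 0 <= delta -> (0 < vol W)%N ->
  (forall i j, P i -> P j -> i != j -> density R W (fun x => u i x && u j x) <= delta) ->
  \sum_(i | P i) density R W (u i) <= 1 + #|P|%:R ^+ 2 * delta.
Proof.
move=> d0 W0 hd; have N0 : 0 < (vol W)%:R :> R by rewrite ltr0n.
have point x : \sum_(i | P i) (u i x)%:R <=
    1 + \sum_(i | P i) \sum_(j | P j && (j != i)) (u i x && u j x)%:R :> R.
  have ge0 (Q : pred J) (v : J -> bool) : 0 <= \sum_(j | Q j) (v j)%:R :> R by exact: sumr_ge0.
  have [/existsP[i /andP[Pi ui]]|/existsPn none] := boolP [exists i, P i && u i x]; last first.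
    rewrite big1 => [|i Pi]; first by rewrite addr_ge0 ?ler01 // sumr_ge0.
    by have := none i; rewrite Pi /= => /negbTE ->.
  rewrite (bigD1 i Pi) /= ui lerD2l [leRHS](bigD1 i Pi) /= ui /=.
  by rewrite -[leLHS]addr0; apply: lerD => //; apply: sumr_ge0.
rewrite -mulr_suml ler_pdivrMr // /bsum exchange_big /=.
apply: (@le_trans _ _ (\sum_(x in family W) (1 + \sum_(i | P i)
    \sum_(j | P j && (j != i)) (u i x && u j x)%:R))).
  by apply: ler_sum => x _; exact: point.
rewrite big_split /= sum_const_box mulr1 mulrDl mul1r lerD2l exchange_big /=.
have -> : #|P|%:R ^+ 2 * delta * (vol W)%:R = \sum_(i | P i) (#|P|%:R * (delta * (vol W)%:R)).
  by rewrite sumr_const -mulr_natl expr2; ring.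
apply: ler_sum => i Pi; rewrite exchange_big /=.
apply: (@le_trans _ _ (\sum_(j | P j && (j != i)) delta * (vol W)%:R)).
  by apply: ler_sum => j /andP[Pj ji]; rewrite -ler_pdivrMr //; apply: hd; rewrite // eq_sym.
have c0 : 0 <= delta * (vol W)%:R by rewrite mulr_ge0.
rewrite mulr_natl sumr_const; apply: ler_wpMn2l => //.
by apply: subset_leq_card; apply/subsetP => j /andP[].
Qed.

Lemma prod_roles m r (A : {set 'I_m}) (f : {set 'I_r} -> R) : (0 < r)%N -> #|A| = r ->
  \prod_(p <- pairs_in A) f (role (@ordle m) r A p) = \prod_(rho : {set 'I_r} | #|rho| == 2) f rho.
Proof.
move=> r0 cA; have [g [ginj _ gA gsub]] := role_enum (@ordle_linear m) r0 cA.
rewrite /pairs_in big_filter big_enum_cond /=.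
rewrite (reindex_onto (fun rho : {set 'I_r} => g @: rho) (role (@ordle m) r A)) /=; last first.
  by move=> p /andP[pA _]; exact: gsub.
have back (rho : {set 'I_r}) : role (@ordle m) r A (g @: rho) = rho.
  apply: (imset_inj ginj); apply: gsub; rewrite -gA; exact: imsetS (subsetT _).
apply: eq_big => [rho|rho _]; last by rewrite back.
by rewrite back eqxx andbT card_imset // -{1}gA imsetS ?subsetT.
Qed.

Lemma clusters_contain r (F H : hypergraph r) m (W : 'I_m -> {set H})
    (G : {set 'I_m} -> {set 'I_m} -> {ffun 'I_m -> H} -> bool) (eta eps delta : R)
    (S : {set 'I_m}) (s : (2 * r - 2).-tuple letter) :
  quasi_linear F -> admits F s -> clusters (edges H) W G eta eps ->
  (forall i j, i != j -> [disjoint W i & W j]) -> (0 < vol W)%N ->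
  (0 < #|S|)%N -> (#|F| <= #|S|)%N ->
  0 <= eta <= 1 -> 0 <= delta <= 1 -> 0 <= eps ->
  3 * #|{: {set F} * {set F}}|%:R * eps < (eta ^+ 2 * delta) ^+ #|{: {set F} * {set F}}| ->
  (forall A B : {set 'I_m}, A :|: B \subset S -> #|A| = r -> #|B| = r -> #|A :&: B| = 2 ->
     role (@ordle m) (2 * r - 2) (A :|: B) A = letter_set s LX ->
     role (@ordle m) (2 * r - 2) (A :|: B) B = letter_set s LY ->
     role (@ordle m) (2 * r - 2) (A :|: B) (A :&: B) = letter_set s LZ ->
     delta <= density R W (fun x => G A (A :&: B) x && G B (A :&: B) x)) ->
  contains H F.
Proof.
move=> ql [le lin desc] cl dW W0 S0 FS eta01 delta01 eps0 small hdense.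
have [psi [inj psiS mono]] := order_embedding lin S0 FS.
have [L [uL sL Ltw cross Lall]] := twin_list ql inj.
have c0 : 0 <= eta ^+ 2 * delta <= 1.
  case/andP: eta01 => ? ?; case/andP: delta01 => ? ?.
  by rewrite mulr_ge0 ?sqr_ge0 // mulr_ile1 ?sqr_ge0 // exprn_ile1.
have [||x xW hx] := crossing_pairs_exist cl eps0 W0 eta01 delta01 uL _ cross.
- move=> j /Ltw[e [f [ef ->]]] /=; have [eE fE _ cI] := ef.
  have cardp (e' : {set F}) : e' \in edges F -> #|psi @: e'| = r.
    by move=> e'E; rewrite card_imset // (card_edge e'E).
  have cI' : #|psi @: e :&: psi @: f| = 2.
    by rewrite -imsetI ?card_imset // => y z _ _; exact: inj.
  have cQ : #|e :|: f| = (2 * r - 2)%N.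
    by apply: card_twin_union cI; exact: card_edge.
  have sub (e1 f1 : {set F}) : psi @: e1 :|: psi @: f1 \subset S.
    by rewrite -imsetU; apply/subsetP => y /imsetP[z _ ->].
  have [d|d] := desc e f ef.
    have [eX eY eZ] := described_level lin inj mono cQ d.
    by apply: hdense; rewrite ?cardp.
  (* [describes] allows the twins to trade the letters X and Y; the common part of their two graphs
     is symmetric in them. *)
  have d' : tval s = map (vertex_letter f e) (listing le (f :|: e)) by rewrite setUC.
  have cQ' : #|f :|: e| = (2 * r - 2)%N by rewrite setUC.
  have [eX eY eZ] := described_level lin inj mono cQ' d'.
  have := hdense (psi @: f) (psi @: e) (sub _ _) (cardp _ fE) (cardp _ eE).
  rewrite setIC => /(_ cI'); rewrite -setIC => /(_ eX eY); rewrite setIC in eZ.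
  rewrite setIC in eZ; rewrite [_ :&: psi @: e]setIC in eZ *.
  move=> /(_ eZ) h; apply: le_trans h _; rewrite le_eqVlt; apply/orP; left; apply/eqP.
  by congr (_ / _); apply: bsum_eq => y; rewrite andbC.
- apply: (@le_lt_trans _ _ (3 * #|{: {set F} * {set F}}|%:R * eps)).
    by rewrite ler_wpM2r // ler_wpM2l // ler_nat.
  by case/andP: c0 => a b; apply: lt_le_trans small _; apply: ler_wiXn2l.
move/familyP: xW => xW.
exists (fun v => x (psi v)) => [v w e|e eE].
  by apply: inj; apply: (disjoint_box_inj dW (xW _) (xW _) e).
have [j jL ej] := Lall e eE.
have /andP[h1 h2] := hx j jL.
rewrite (_ : [set x (psi v) | v in e] = x @: (psi @: e)); last by rewrite -imset_comp.
by move: ej; rewrite !inE => /orP[]/eqP->.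
Qed.
End UpperBound.

Section Sparse.
Variable R : archiRealFieldType.

Lemma card_roles r : #|[pred rho : {set 'I_r} | #|rho| == 2]| = 'C(r, 2).
Proof.
by rewrite -[r in RHS]card_ord -card_draws; apply: eq_card => rho; rewrite !inE.
Qed.

Lemma size_pairs_in (I : finType) (A : {set I}) : size (pairs_in A) = 'C(#|A|, 2).
Proof.
rewrite -cards_draws cardE; apply/perm_size/uniq_perm; rewrite ?enum_uniq //.
  by rewrite filter_uniq ?enum_uniq.
by move=> p; rewrite mem_pairs_in mem_enum inE.
Qed.

(** Levels depend on roles only, so the same numbers [f rho] bound the densities over the K pairs of
    one r-set and those of the K graphs on one pair. The latter bounds their sum, the former needs
    their product. In [x], the part K^2/L comes from overlaps and K/L from rounding up. *)
Lemma sparse_density (T : finType) (E : {set {set T}}) m r L (W : 'I_m -> {set T})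
    (G : {set 'I_m} -> {set 'I_m} -> {ffun 'I_m -> T} -> bool) (eta eps : R)
    (S : {set 'I_m}) (c : {set 'I_r} -> 'I_L.+1) :
  let K := 'C(r, 2) in let x : R := (K%:R ^+ 2 + K%:R) / L%:R in
  clusters E W G eta eps -> 0 <= eps -> (0 < vol W)%N -> (0 < L)%N -> (1 < r)%N ->
  (3 * (#|{: {set 'I_r}}| * r).+1 <= #|S|)%N -> x <= 1 ->
  (forall A p : {set 'I_m}, A \subset S -> #|A| = r -> p \subset A -> #|p| = 2 ->
     level L (density R W (G A p)) = c (role (@ordle m) r A p)) ->
  (forall A B : {set 'I_m}, A :|: B \subset S -> #|A| = r -> #|B| = r -> #|A :&: B| = 2 ->
     role (@ordle m) r A (A :&: B) <> role (@ordle m) r B (A :&: B) ->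
     density R W (fun x => G A (A :&: B) x && G B (A :&: B) x) <= L%:R^-1) ->
  forall A : {set 'I_m}, A \subset S -> #|A| = r ->
    density R W (crossing_edge E A) <= K%:R ^- K * (1 + 2 ^+ K * x) + K%:R * (eta + 2 * eps).
Proof.
move=> K x cl eps0 W0 L0 r1 bigS x1 hlev hdis A AS cA.
have Lr : 0 < L%:R :> R by rewrite ltr0n.
have [p [B [cp hB]]] := crossing_family r1 bigS.
pose f (rho : {set 'I_r}) : R := (c rho).+1%:R / L%:R.
have levb (A' p' : {set 'I_m}) : A' \subset S -> #|A'| = r -> p' \subset A' -> #|p'| = 2 ->
    f (role (@ordle m) r A' p') - L%:R^-1 <= density R W (G A' p') <= f (role (@ordle m) r A' p').
  move=> A'S cA' pA' cp'; have := levelP L0 (density_bounds R W (G A' p')).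
  rewrite hlev // => /andP[lo /ltW ->]; rewrite andbT /f -natr1 mulrDl mul1r.
  by rewrite addrK.
have K0 : (0 < K)%N by rewrite bin_gt0.
have sumd : \sum_(rho : {set 'I_r} | #|rho| == 2) density R W (G (B rho) p) <= 1 + K%:R ^+ 2 * L%:R^-1.
  have := almost_disjoint (P := [pred rho : {set 'I_r} | #|rho| == 2])
     (u := fun rho => G (B rho) p) (delta := L%:R^-1) _ W0.
  rewrite card_roles; apply; first by rewrite invr_ge0.
  move=> i j /eqP ci /eqP cj ij; have [iS ic _ ir idis] := hB i ci; have [jS jc _ jr _] := hB j cj.
  have eI := idis j cj ij.
  have := hdis (B i) (B j); rewrite eI; apply => //; first by rewrite subUset iS.
  by rewrite ir jr => e; rewrite e eqxx in ij.
have sumf : \sum_(rho in [pred rho : {set 'I_r} | #|rho| == 2]) f rho <= 1 + x.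
  have h : \sum_(rho : {set 'I_r} | #|rho| == 2) (f rho - L%:R^-1) <= 1 + K%:R ^+ 2 * L%:R^-1.
    apply: le_trans sumd; apply: ler_sum => rho /eqP crho.
    have [rS rc pr er _] := hB rho crho.
    by have := levb _ _ rS rc pr cp; rewrite er => /andP[].
  have eK : L%:R^-1 *+ K = K%:R * L%:R^-1 :> R by rewrite mulr_natl.
  move: h; rewrite sumrB sumr_const card_roles -/K eK lerBlDr => h.
  by apply: le_trans h _; rewrite /x (mulrDl (K%:R ^+ 2)) addrA.
have f0 rho : 0 <= f rho by rewrite divr_ge0.
have x0 : 0 <= x by rewrite divr_ge0 ?addr_ge0 ?exprn_ge0.
have agm := agm_power (P := [pred rho : {set 'I_r} | #|rho| == 2]) f0.
rewrite card_roles -/K in agm; have {}agm := agm x K0 _ sumf.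
apply: le_trans (edge_upper cl eps0 A W0) _; rewrite size_pairs_in cA.
apply: lerD => //; apply: le_trans (agm _); last by rewrite x0.
rewrite [leRHS](eq_bigl (fun rho : {set 'I_r} => #|rho| == 2)) //.
rewrite -(prod_roles f (ltnW r1) cA) big_seq [leRHS]big_seq.
apply: ler_prod => q; rewrite mem_pairs_in => /andP[qA /eqP cq].
by have /andP[-> _] := density_bounds R W (G A q); case/andP: (levb _ _ AS cA qA cq).
Qed.
End Sparse.

(* Inverse of [role]; the value is junk when J is not the role of a subset of Q. *)
Definition role_pick m k (Q : {set 'I_m}) (J : {set 'I_k}) : {set 'I_m} :=
  odflt set0 [pick p : {set 'I_m} | (p \subset Q) && (role (@ordle m) k Q p == J)].

Lemma role_pickK m k (Q p : {set 'I_m}) : (0 < k)%N -> #|Q| = k -> p \subset Q ->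
  role_pick Q (role (@ordle m) k Q p) = p.
Proof.
move=> k0 cQ pQ; have [g [_ _ _ gsub]] := role_enum (@ordle_linear m) k0 cQ.
rewrite /role_pick; case: pickP => [p' /andP[p'Q /eqP e]|/(_ p)]; last by rewrite pQ eqxx.
by rewrite /= -(gsub p' p'Q) e gsub.
Qed.

Lemma le_twice_divn m n : (0 < n %/ m)%N -> (n <= 2 * m * (n %/ m))%N.
Proof.
move=> d0; have [m0|m0] := posnP m; first by rewrite m0 divn0 in d0.
have := divn_eq n m; have := ltn_pmod n m0; have : (m <= n %/ m * m)%N by rewrite leq_pmull.
by rewrite -mulnA [(m * _)%N]mulnC; move: (_ * m)%N (n %% m)%N => a b; lia.
Qed.

Section DenseContains.
Variable R : archiRealFieldType.

Lemma nonedges_le r (H : hypergraph r) (U : {set H}) (d : R) :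
  d * 'C(#|U|, r)%:R <= #|edges_inside U|%:R ->
  #|[set e : {set H} | [&& #|e| == r, e \subset U & e \notin edges H]]|%:R <=
    (1 - d) * 'C(#|U|, r)%:R.
Proof.
move=> h; rewrite mulrBl mul1r lerBrDr; apply: (@le_trans _ _
  (#|[set e : {set H} | [&& #|e| == r, e \subset U & e \notin edges H]]|%:R + #|edges_inside U|%:R)).
  by rewrite lerD2l.
rewrite -natrD ler_nat -cards_draws.
set N := [set e | _]; set M := edges_inside U; set D := [set _ | _].
have dis : [disjoint N & M].
  rewrite -setI_eq0; apply/set0Pn => -[e]; rewrite !inE => /andP[/and3P[_ _ /negbTE h1]].
  by rewrite h1.
have -> : (#|N| + #|M|)%N = #|N :|: M|.
  by move: dis; rewrite -setI_eq0 => /eqP dis; rewrite cardsU dis cards0 subn0.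
apply: subset_leq_card; rewrite subUset; apply/andP; split; apply/subsetP => e; rewrite !inE.
  by move=> /and3P[-> -> _].
by move=> /andP[eE ->]; rewrite (card_edge eE) eqxx.
Qed.

(** The other sides of [W] are no larger than those of [V], so the loss on one side is at most the
    loss in volume. *)
Lemma box_side_lower (T : finType) m (V W : 'I_m -> {set T}) s (c : R) i : 0 < c ->
  (forall j, W j \subset V j) -> (forall j, #|V j| = s) -> (0 < s)%N ->
  c * (vol V)%:R <= (vol W)%:R -> c * s%:R <= #|W i|%:R.
Proof.
move=> c0 WV Vs s0; rewrite /vol (bigD1 i) //= [in leRHS](bigD1 i) //= Vs.
set P := (\prod_(j | j != i) #|V j|)%N; set Q := (\prod_(j | j != i) #|W j|)%N => h.
have QP : (Q <= P)%N by apply: leq_prod => j _; apply: subset_leq_card.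
have P0 : 0 < P%:R :> R.
  by rewrite ltr0n; apply: prodn_gt0 => j; rewrite Vs.
rewrite -(ler_pM2r P0); apply: (@le_trans _ _ (#|W i|%:R * Q%:R)).
  by move: h; rewrite !natrM mulrA.
by rewrite ler_wpM2l // ler_nat.
Qed.

Theorem dense_contains r (F : hypergraph r) (d' : R) : (3 <= r)%N -> quasi_linear F ->
  (forall s : (2 * r - 2).-tuple letter, descriptive s -> ~~ consistent_seq s -> admits F s) ->
  'C(r, 2)%:R ^- 'C(r, 2) < d' -> d' <= 1 ->
  exists2 e0 : R, 0 < e0 & exists N0, forall H : hypergraph r, (N0 <= #|H|)%N ->
    (forall U : {set H}, e0 * #|H|%:R <= #|U|%:R ->
       (d' - e0) * 'C(#|U|, r)%:R <= #|edges_inside U|%:R) ->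
    contains H F.
Proof.
move=> r3 ql adm; set K := 'C(r, 2); set d : R := K%:R ^- K => dd' d'1.
have r1 : (1 < r)%N by exact: ltnW.
have K0 : (0 < K)%N by rewrite bin_gt0.
have Kr : 0 < K%:R :> R by rewrite ltr0n.
have d0 : 0 <= d by rewrite invr_ge0 exprn_ge0 // ltW.
have d1 : d <= 1 by rewrite invf_le1 ?exprn_gt0 // exprn_ege1 // ler1n.
pose gam := d' - d; have g0 : 0 < gam by rewrite subr_gt0.
have g1 : gam <= 1 by rewrite lerBlDr (le_trans d'1) // lerDl.
have p2 : 1 <= 2 ^+ K :> R by rewrite exprn_ege1 // ler1n.
have [L' hL'] := nat_above (4 * 2 ^+ K * (K%:R ^+ 2 + K%:R) / gam).
pose L := L'.+1; have Lr : 0 < L%:R :> R by rewrite ltr0n.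
pose x : R := (K%:R ^+ 2 + K%:R) / L%:R.
have x0 : 0 <= x by rewrite divr_ge0 ?addr_ge0 ?exprn_ge0.
have hx : 2 ^+ K * x <= gam / 4.
  rewrite /x mulrA ler_pdivrMr //.
  have : 4 * 2 ^+ K * (K%:R ^+ 2 + K%:R) <= L%:R * gam.
    rewrite -ler_pdivrMr //; apply: le_trans hL' _; by rewrite ler_nat.
  by set a := 2 ^+ K; set b := _ + _; lra.
have x1 : x <= 1.
  have := ler_wpM2r x0 p2; move: hx; set a := 2 ^+ K; lra.
(* Half of the surplus [gam] goes to the upper bound on crossing density: a quarter to rounding,
   through the choice of [L], and a quarter to [K * (eta + 2 * eps)]. *)
pose eta : R := gam / (8 * K%:R).
have K1 : 1 <= K%:R :> R by rewrite ler1n.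
have eta0 : 0 < eta by rewrite divr_gt0 // mulr_gt0.
have eta1 : eta <= 1 by rewrite ler_pdivrMr ?mulr_gt0 //; lra.
pose t := #|{: {set F} * {set F}}|.
pose X := (eta ^+ 2 * L%:R^-1) ^+ t.
have X0 : 0 < X by rewrite exprn_gt0 // mulr_gt0 ?exprn_gt0 ?invr_gt0.
(* The first bound serves the crossing density, the second the existence of a copy of F; the [+ 1]
   keeps the denominator positive. *)
pose eps := Num.min (gam / (16 * K%:R)) (X / (3 * t%:R + 1)).
have t0 : 0 < 3 * t%:R + 1 :> R by rewrite ltr_wpDl ?mulr_ge0.
have eps0 : 0 < eps by rewrite lt_min !divr_gt0 ?mulr_gt0.
have eps_g : eps <= gam / (16 * K%:R) by rewrite ge_min lexx.
have eps_X : eps <= X / (3 * t%:R + 1) by rewrite ge_min lexx orbT.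
have eps1 : eps <= 1.
  by apply: le_trans eps_g _; rewrite ler_pdivrMr ?mulr_gt0 //; lra.
have smallX : 3 * t%:R * eps < X.
  move: eps_X; rewrite ler_pdivlMr // => h; lra.
have Keta : K%:R * (eta + 2 * eps) <= gam / 4.
  have h1 : K%:R * eta = gam / 8 by rewrite /eta; field; rewrite gt_eqF.
  have h2 : K%:R * eps <= gam / 16.
    have := ler_wpM2l (ltW Kr) eps_g.
    by rewrite (_ : K%:R * (gam / (16 * K%:R)) = gam / 16) //; field; rewrite gt_eqF.
  by lra.
have th0 : 0 < gam / 4 by rewrite divr_gt0.
have [n0 hn0] := binomial_ratio r th0.
pose n := (n0 + 3 * (#|{: {set 'I_r}}| * r).+1 + #|F| + r)%N.
have [n_n0 n_W n_F n_r n_gt0] : [/\ n0 <= n, 3 * (#|{: {set 'I_r}}| * r).+1 <= n, #|F| <= n,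
    r <= n & 0 < n]%N.
  rewrite /n; move: (3 * _)%N (leq0n (#|{: {set 'I_r}}| * r)) #|F| r3 => a _ b; clear => r3.
  by split; lia.
pose q := (2 * r - 2)%N.
have q0 : (0 < q)%N by rewrite /q; clear -r3; lia.
have r0 : (0 < r)%N by exact: ltnW.
(* Nested use: first the unions of two r-sets, of size q, are made homogeneous on at least [M1]
   indices, then the r-sets inside. One colour records the levels for all choices of roles at
   once. *)
have [M1 hM1] := ramsey {ffun {set 'I_r} -> 'I_L.+1} r n.
have [M2 hM2] := ramsey {ffun {set 'I_q} * {set 'I_q} * {set 'I_q} -> 'I_L.+1} q M1.
pose m := M2.+1; have m0 : 0 < m%:R :> R by rewrite ltr0n.
have [c c0 hreg] := regular_clusters 'I_m (ltW eta0) eps0 eps1.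
have [N1 hN1] := nat_above c^-1.
(* The 4 allows for a factor 2 lost in dividing [#|H|] by [m] and another in truncating
   [c * s0%:R]. *)
pose e0 := Num.min (gam / 4) (c / (4 * m%:R)).
have e00 : 0 < e0 by rewrite lt_min th0 divr_gt0 // mulr_gt0.
exists e0 => //; exists (m * N1.+1)%N => H HN dense.
have [V [dV Vs]] := equal_parts H (ltn0Sn M2).
set s0 := (#|H| %/ m)%N in Vs.
have s0N : (N1 < s0)%N by rewrite /s0 leq_divRL // mulnC.
have s0_0 : (0 < s0)%N by exact: leq_ltn_trans s0N.
have V0 : (0 < vol V)%N by rewrite vol_gt0; apply/forallP => i; rewrite Vs.
have [W [G [WV Wbig W0 cl]]] := hreg H (edges H) V V0.
have dW i j : i != j -> [disjoint W i & W j].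
  by move=> /dV dij; apply: disjointWl (WV i) (disjointWr (WV j) dij).
pose alpha (A B p : {set 'I_m}) := density R W (fun x => G A p x && G B p x).
have al01 A B p : 0 <= alpha A B p <= 1 by exact: density_bounds.
pose col1 (Q : {set 'I_m}) := [ffun J : {set 'I_q} * {set 'I_q} * {set 'I_q} =>
  level L (alpha (role_pick Q J.1.1) (role_pick Q J.1.2) (role_pick Q J.2))].
pose col2 (Q : {set 'I_m}) := [ffun J : {set 'I_r} => level L (density R W (G Q (role_pick Q J)))].
have [|S1 [c1 [_ cS1 hom1]]] := hM2 _ col1 setT.
  by rewrite cardsT card_ord; exact: leqnSn.
have [|S [c2 [SS1 cS hom2]]] := hM1 _ col2 S1; first exact: eq_leq (esym cS1).
have level1 (A B : {set 'I_m}) : A :|: B \subset S -> #|A| = r -> #|B| = r -> #|A :&: B| = 2 ->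
    level L (alpha A B (A :&: B)) = c1 (role (@ordle m) q (A :|: B) A,
      role (@ordle m) q (A :|: B) B, role (@ordle m) q (A :|: B) (A :&: B)).
  move=> QS cA cB cI; have cQ := card_twin_union cA cB cI.
  rewrite -(hom1 (A :|: B)) ?(subset_trans QS) // ffunE /=.
  by rewrite !role_pickK ?subsetUl ?subsetUr // subIset // subsetUl.
have nS : n = #|S| by rewrite cS.
have S0 : (0 < #|S|)%N by rewrite -nS.
(* A positive level is a density of at least 1/L along the whole pattern and yields a copy of F;
   otherwise all inconsistent patterns have density below 1/L. *)
have [[s [ds ncs hs]]|none] := boolp.EM (exists s : q.-tuple letter, [/\ descriptive s,
    ~~ consistent_seq s & (0 < c1 (letter_set s LX, letter_set s LY, letter_set s LZ))%N]).
  have L1 : L%:R^-1 <= 1 :> R by rewrite invf_le1 // ler1n.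
  apply: (clusters_contain (S := S) (s := s) (delta := L%:R^-1) ql (adm s ds ncs) cl dW W0) => //.
  - by rewrite -nS.
  - by rewrite (ltW eta0).
  - by rewrite invr_ge0 ltW.
  - exact: ltW.
  move=> A B QS cA cB cI eX eY eZ; have := level1 A B QS cA cB cI.
  rewrite eX eY eZ => lev; have /andP[lo _] := levelP (ltn0Sn L') (al01 A B (A :&: B)).
  by apply: le_trans lo; rewrite -/L lev ler_pdivlMr // mulVf ?gt_eqF // ler1n.
have hD := sparse_density (S := S) (c := c2) cl (ltW eps0) W0 (ltn0Sn L') r1.
pose D := d + gam / 2.
have {}hD (A : {set 'I_m}) : A \subset S -> #|A| = r ->
    (\sum_(y in family W) (y @: A \in edges H)%:R) / (vol W)%:R <= D.
  move=> AS cA; apply: le_trans (hD _ x1 _ _ A AS cA) _.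
  - by rewrite -nS.
  - move=> B p BS cB pB cp; by rewrite -(hom2 B BS cB) ffunE (role_pickK r0 cB pB).
  - move=> B C QS cB cC cI ne; have lev := level1 B C QS cB cC cI.
    have [s [ds ncs eX eY eZ]] := crossing_pattern (@ordle_linear m) r1 cB cC cI ne.
    have z : c1 (letter_set s LX, letter_set s LY, letter_set s LZ) = 0%N :> nat.
      apply/eqP; rewrite -leqn0 leqNgt; apply/negP => pos; apply: none.
      by exists s.
    rewrite eX eY eZ in lev.
    have /andP[_ /ltW hi] := levelP (ltn0Sn L') (al01 B C (B :&: C)).
    by move: hi; rewrite -/L lev z mul1r.
  rewrite -/K -/x -/d /D mulrDr mulr1 -addrA lerD2l.
  have h : d * (2 ^+ K * x) <= gam / 4.
    by apply: le_trans hx; rewrite ler_piMl // mulr_ge0 // exprn_ge0.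
  by move: h Keta; set a := d * _; set b := K%:R * _; lra.
have cs0 : 1 <= c * s0%:R.
  rewrite mulrC -ler_pdivrMr // mul1r; apply: le_trans hN1 _.
  by rewrite ler_nat ltnW.
pose s := Num.trunc (c * s0%:R).
have cs00 : 0 <= c * s0%:R by apply: le_trans cs0.
have /andP[slo shi] := truncn_itv cs00.
have s_gt0 : (0 < s)%N by rewrite truncn_gt0.
have sW i : (s <= #|W i|)%N.
  by rewrite -(ler_nat R); apply: le_trans slo _; apply: box_side_lower c0 WV Vs s0_0 Wbig.
have Sn0 : S != set0 by rewrite -card_gt0.
have [U [sU Us hU]] := local_density s_gt0 dW sW Sn0 hD.
have Ubig : e0 * #|H|%:R <= #|U|%:R.
  apply: (@le_trans _ _ s%:R); last by rewrite ler_nat.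
  have N_le : #|H|%:R <= 2 * m%:R * s0%:R :> R.
    by rewrite -!natrM ler_nat; exact: le_twice_divn s0_0.
  have c_le : c * s0%:R <= 2 * s%:R.
    apply: ltW; apply: lt_le_trans shi _; rewrite -/s -natr1.
    have : 1 <= s%:R :> R by rewrite ler1n.
    by lra.
  apply: (@le_trans _ _ (c / (4 * m%:R) * (2 * m%:R * s0%:R))).
    by apply: ler_pM => //; [exact: ltW | rewrite ge_min lexx orbT].
  rewrite (_ : c / (4 * m%:R) * (2 * m%:R * s0%:R) = c * s0%:R / 2); last by field; rewrite gt_eqF.
  by lra.
have hN := nonedges_le (dense U Ubig).
have Cmono : 'C(#|U|, r)%:R <= 'C(#|S| * s, r)%:R :> R by rewrite ler_nat leq_bin2l.
have ratio := hn0 #|S| s.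
have {}ratio : 'C(#|S| * s, r)%:R <= (1 + gam / 4) * ('C(#|S|, r)%:R * (s ^ r)%:R).
  by apply: ratio; rewrite -nS.
set Z := 'C(#|S|, r)%:R * (s ^ r)%:R in ratio.
have Z0 : 0 < Z.
  by rewrite mulr_gt0 // ltr0n ?expn_gt0 ?s_gt0 // bin_gt0 -nS.
have e0g : e0 <= gam / 4 by rewrite ge_min lexx.
have y0 : 0 <= 1 - (d' - e0) by lra.
have chain : (1 - D) * Z <= (1 - (d' - e0)) * ((1 + gam / 4) * Z).
  have eZ : (1 - D) * Z = (1 - D) * 'C(#|S|, r)%:R * (s ^ r)%:R by rewrite /Z mulrA.
  rewrite eZ; apply: (le_trans hU); apply: (le_trans hN).
  by apply: (ler_wpM2l y0); exact: le_trans Cmono ratio.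
have chain2 : (1 - (d' - e0)) * ((1 + gam / 4) * Z) <= (1 - D - gam / 4) * ((1 + gam / 4) * Z).
  by rewrite ler_wpM2r ?mulr_ge0 ?addr_ge0 ?(ltW Z0) ?(ltW th0) // /D /gam; move: e0g; rewrite /gam; lra.
(* Cancelling [Z] leaves 1 - D <= (1 - D - gam/4)(1 + gam/4), whose right side equals 1 - D - gam
   D/4 - gam^2/16. *)
have := le_trans chain chain2; clearbody Z; rewrite mulrA ler_pM2r // => bad.
have D0 : 0 <= D by rewrite addr_ge0 // divr_ge0 // ltW.
have gg : 0 < gam * gam by rewrite mulr_gt0.
have gD : 0 <= gam * D by rewrite mulr_ge0 ?(ltW g0).
by clearbody D gam; clear -bad g0 D0 gg gD; lra.
Qed.
End DenseContains.

(** * The lower bound *)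

Section Update.
Variables (R : realFieldType) (I T : finType).
Implicit Types (y : {ffun I -> T}) (F : {ffun I -> T} -> R).

Definition upd i t y : {ffun I -> T} := [ffun k => if k == i then t else y k].

Lemma sum_upd i F : #|T|%:R * (\sum_y F y) = \sum_y \sum_t F (upd i t y).
Proof.
have -> : #|T|%:R * (\sum_y F y) = \sum_y \sum_(t : T) F y.
  by rewrite mulr_sumr; apply: eq_bigr => y _; rewrite sumr_const mulr_natl.
rewrite !pair_big /=.
pose sw (p : {ffun I -> T} * T) := (upd i p.2 p.1, p.1 i).
have swK : involutive sw.
  case=> y t; rewrite /sw /= ffunE eqxx; congr pair.
  by apply/ffunP => k; rewrite !ffunE; case: eqP => [->|].
by rewrite (reindex_inj (can_inj swK)).
Qed.
End Update.

Section Discrepancy.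
Variables (R : realFieldType) (m : nat) (C : finType).
Hypothesis C_gt0 : (0 < #|C|)%N.

(* The pair s, t with s.1 < t.1 gets the colour t.2 s.1. Since the second
   components run over all functions, distinct first components see exactly
   orthogonal colourings, so no randomness is needed. *)
Definition rado_vertex : finType := ('I_m * {ffun 'I_m -> C})%type.
Implicit Types s t : rado_vertex.

Let M := #|{: {ffun 'I_m -> C}}|.

Lemma card_rado_vertex : #|{: rado_vertex}| = (m * M)%N.
Proof. by rewrite card_prod card_ord. Qed.

Definition bias (c k : C) : R := (k == c)%:R - #|C|%:R^-1.

Lemma sum_bias c : \sum_k bias c k = 0.
Proof.
rewrite /bias sumrB sumr_const (bigD1 c) //= eqxx big1 => [|k /negbTE -> //].
by rewrite addr0 -(mulr_natr #|C|%:R^-1) mulVf ?subrr // pnatr_eq0 -lt0n.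
Qed.

Lemma bias_sqr_le1 c k : bias c k ^+ 2 <= 1.
Proof.
have h1 : 0 <= #|C|%:R^-1 :> R by rewrite invr_ge0.
have h2 : #|C|%:R^-1 <= 1 :> R by rewrite invf_le1 ?ltr0n // ler1n.
by rewrite /bias; case: (k == c); rewrite /=; nra.
Qed.

Lemma bias_orthogonal c (x1 x2 : 'I_m) : x1 != x2 ->
  \sum_(y : {ffun 'I_m -> C}) bias c (y x1) * bias c (y x2) = 0.
Proof.
move=> ne; have Cn : #|C|%:R != 0 :> R by rewrite pnatr_eq0 -lt0n.
apply: (mulfI Cn); rewrite mulr0 (sum_upd x1) big1 // => y _.
under eq_bigr do rewrite !ffunE eqxx eq_sym (negbTE ne).
by rewrite -mulr_suml sum_bias mul0r.
Qed.

Lemma sum_sqr_orthogonal c (A : 'I_m -> R) : (forall x, 0 <= A x <= M%:R) ->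
  \sum_(y : {ffun 'I_m -> C}) (\sum_x A x * bias c (y x)) ^+ 2 <= m%:R * M%:R ^+ 3.
Proof.
move=> A01.
have -> : \sum_(y : {ffun 'I_m -> C}) (\sum_x A x * bias c (y x)) ^+ 2 =
   \sum_x A x ^+ 2 * \sum_(y : {ffun 'I_m -> C}) bias c (y x) ^+ 2.
  transitivity (\sum_x \sum_x' A x * A x' *
      \sum_(y : {ffun 'I_m -> C}) bias c (y x) * bias c (y x')).
    under eq_bigr do rewrite expr2 mulr_suml.
    rewrite exchange_big /=; apply: eq_bigr => x _.
    under eq_bigr do rewrite mulr_sumr.
    rewrite exchange_big /=; apply: eq_bigr => x' _.
    by rewrite mulr_sumr; apply: eq_bigr => y _; ring.
  apply: eq_bigr => x _; rewrite (bigD1 x) //= [X in _ + X]big1 => [|x' ne].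
    by rewrite addr0 expr2; congr (_ * _); apply: eq_bigr => y _; rewrite expr2.
  by rewrite bias_orthogonal ?mulr0 // eq_sym.
rewrite [leRHS]mulr_natl -[X in _ *+ X]card_ord -sumr_const; apply: ler_sum => x _.
rewrite [leRHS]exprSr; have /andP[a0 a1] := A01 x; apply: ler_pM; rewrite ?sqr_ge0 ?sumr_ge0 //.
- by move=> y _; rewrite sqr_ge0.
- by rewrite lerXn2r // nnegrE.
rewrite /M -sum1_card natr_sum; apply: ler_sum => y _; exact: bias_sqr_le1.
Qed.

Lemma sum_rado (f : rado_vertex -> R) : \sum_s f s = \sum_x \sum_y f (x, y).
Proof. by rewrite pair_bigA; apply: eq_bigr => -[x y]. Qed.

(** For fixed [t.1], the coefficients [A t.1 x] do not depend on [t.2], so orthogonality bounds the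
    second moment of [phi] over [t.2]. An arbitrary [b] is then handled pointwise. *)
Lemma discrepancy c (a b : rado_vertex -> bool) (delta : R) : 0 < delta -> 1 <= delta ^+ 2 * m%:R ->
  - (delta * #|{: rado_vertex}|%:R ^+ 2) <=
  \sum_s \sum_t (a s && b t && (s.1 < t.1)%N)%:R * bias c (t.2 s.1).
Proof.
move=> d0 dm; have m0 : (0 < m)%N.
  by rewrite lt0n; apply: contraTneq dm => ->; rewrite mulr0 -ltNge ltr01.
have M0 : (0 < M)%N.
  by have /card_gt0P[k _] := C_gt0; apply/card_gt0P; exists [ffun=> k].
have mr : 0 < m%:R :> R by rewrite ltr0n.
have Mr : 0 < M%:R :> R by rewrite ltr0n.
pose A (x' x : 'I_m) : R := \sum_(y : {ffun 'I_m -> C}) (a (x, y) && (x < x')%N)%:R.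
have A01 x' x : 0 <= A x' x <= M%:R.
  rewrite /A sumr_ge0 //=; first by rewrite /M -sum1_card natr_sum; apply: ler_sum => y _; case: (_ && _).
pose phi t : R := \sum_x A t.1 x * bias c (t.2 x).
have -> : \sum_s \sum_t (a s && b t && (s.1 < t.1)%N)%:R * bias c (t.2 s.1) =
   \sum_t (b t)%:R * phi t.
  rewrite exchange_big /=; apply: eq_bigr => t _; rewrite /phi mulr_sumr.
  rewrite sum_rado /=.
  apply: eq_bigr => x _; rewrite /A mulr_suml mulr_sumr; apply: eq_bigr => y _.
  by case: (a _); case: (b t); case: (_ < _)%N; rewrite /= ?mul0r ?mul1r ?mulr0.
(* The pointwise bound by phi^2/(2 mu) + mu/2 stands in for Cauchy-Schwarz. With this [mu], each of
   the two terms sums to at most half of the allowed error. *)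
pose mu := delta * m%:R * M%:R; have mu0 : 0 < mu by rewrite !mulr_gt0.
have phi2 : \sum_t phi t ^+ 2 <= m%:R ^+ 2 * M%:R ^+ 3.
  rewrite sum_rado [m%:R ^+ 2]expr2 -mulrA [leRHS]mulr_natl -[X in _ *+ X]card_ord -sumr_const.
  by apply: ler_sum => x _; exact: (sum_sqr_orthogonal c (A01 x)).
have pt t : - (phi t ^+ 2 / (2 * mu) + mu / 2) <= (b t)%:R * phi t.
  have h : 0 <= (phi t + mu) ^+ 2 / (2 * mu) by rewrite divr_ge0 ?sqr_ge0 // mulr_ge0 // ltW.
  have h2 : 0 <= phi t ^+ 2 / (2 * mu) by rewrite divr_ge0 ?sqr_ge0 // mulr_ge0 // ltW.
  have e : (phi t + mu) ^+ 2 / (2 * mu) = phi t ^+ 2 / (2 * mu) + mu / 2 + phi t.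
    by field; rewrite gt_eqF.
  by case: (b t); rewrite ?mul1r ?mul0r; lra.
apply: (@le_trans _ _ (\sum_t - (phi t ^+ 2 / (2 * mu) + mu / 2))); last first.
  by apply: ler_sum => t _.
rewrite sumrN big_split /= -mulr_suml sumr_const lerN2 card_rado_vertex.
rewrite -(mulr_natr (mu / 2)) natrM.
have h : (\sum_t phi t ^+ 2) / (2 * mu) <= m%:R ^+ 2 * M%:R ^+ 3 / (2 * mu).
  by rewrite ler_wpM2r // invr_ge0 mulr_ge0 // ltW.
have e1 : m%:R ^+ 2 * M%:R ^+ 3 / (2 * mu) = m%:R * M%:R ^+ 2 / (2 * delta).
  by rewrite /mu; field; rewrite !gt_eqF.
have h2 : m%:R * M%:R ^+ 2 / (2 * delta) <= delta * (m%:R * M%:R) ^+ 2 / 2.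
  rewrite ler_pdivrMr ?mulr_gt0 //.
  have p : 0 <= m%:R * M%:R ^+ 2 :> R by rewrite mulr_ge0 ?exprn_ge0.
  have := ler_wpM2l p dm; rewrite mulr1 => /le_trans; apply.
  by rewrite le_eqVlt; apply/orP; left; apply/eqP; field.
have e3 : mu / 2 * (m%:R * M%:R) = delta * (m%:R * M%:R) ^+ 2 / 2 by rewrite /mu; field.
by rewrite e3; move: h h2; rewrite e1; lra.
Qed.
End Discrepancy.

Definition role_colour r : finType := {rho : {set 'I_r} | #|rho| == 2}.

Lemma card_role_colour r : #|{: role_colour r}| = 'C(r, 2).
Proof. by rewrite card_sig card_roles. Qed.

(** * The hypergraph of role-coloured sets *)

Section RadoHypergraph.
Variables (m r : nat).
Notation vertices := (rado_vertex m (role_colour r)).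
Implicit Types (y : {ffun 'I_r -> vertices}) (S : {set vertices}).

Definition rising y := [forall i : 'I_r, forall j : 'I_r, (i < j)%N ==> ((y i).1 < (y j).1)%N].

Definition coloured y := [forall i : 'I_r, forall j : 'I_r,
  (i < j)%N ==> ((y i).1 < (y j).1)%N && (val ((y j).2 (y i).1) == [set i; j])].

Lemma risingP y (i j : 'I_r) : rising y -> (i < j)%N -> ((y i).1 < (y j).1)%N.
Proof. by move=> /forallP/(_ i)/forallP/(_ j)/implyP. Qed.

Lemma coloured_rising y : coloured y -> rising y.
Proof.
move=> /forallP h; apply/forallP => i; apply/forallP => j; apply/implyP => ij.
by have /forallP/(_ j)/implyP/(_ ij)/andP[] := h i.
Qed.

Lemma rising_lt y (i j : 'I_r) : rising y -> ((y i).1 < (y j).1)%N = (i < j)%N.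
Proof.
move=> ry; case: (ltngtP i j) => [/(risingP ry) //|/(risingP ry) h|/val_inj ->]; last by rewrite ltnn.
by apply/negbTE; rewrite -leqNgt ltnW.
Qed.

Lemma rising_inj y : rising y -> injective y.
Proof.
move=> ry i j e; apply: val_inj; case: (ltngtP i j) => // /(risingP ry).
  by rewrite e ltnn.
by rewrite e ltnn.
Qed.

Lemma rising_imset_inj y y' : rising y -> rising y' -> y @: setT = y' @: setT -> y = y'.
Proof.
move=> ry ry' e.
have rank (z : {ffun 'I_r -> vertices}) (i : 'I_r) : rising z -> #|[set v in z @: setT | (v.1 < (z i).1)%N]| = i.
  move=> rz; have -> : [set v in z @: setT | (v.1 < (z i).1)%N] = z @: [set k : 'I_r | (k < i)%N].
    apply/setP => v; rewrite inE; apply/andP/imsetP => [[/imsetP[k _ ->]]|[k + ->]].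
      by rewrite rising_lt // => ki; exists k; rewrite ?inE.
    by rewrite inE => ki; rewrite imset_f ?inE ?rising_lt.
  rewrite card_imset; last exact: rising_inj.
  rewrite -sum1_card; under eq_bigl do rewrite inE.
  by rewrite (big_ord_narrow (ltnW (ltn_ord i))) /= sum1_card card_ord.
apply/ffunP => i; have : y i \in y' @: setT by rewrite -e imset_f.
case/imsetP => j _ ij; rewrite ij; congr (y' _); apply: val_inj.
by rewrite /= -(rank y' j ry') -(rank y i ry) e ij.
Qed.

Definition rado_edges : {set {set vertices}} :=
  [set y @: setT | y : {ffun 'I_r -> vertices} in coloured].

Lemma card_rado_edge e : e \in rado_edges -> #|e| = r.
Proof.
case/imsetP => y /coloured_rising ry ->.
by rewrite card_imset ?cardsT ?card_ord //; exact: rising_inj.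
Qed.

Definition rado : hypergraph r := Hypergraph card_rado_edge.

(** A linear extension of the order of first components. The rank only breaks ties, and no edge
    contains two vertices with the same first component. *)
Definition lexi (s t : vertices) : bool :=
  (s.1 < t.1)%N || ((s.1 == t.1) && (enum_rank s <= enum_rank t)%N).

Lemma lexi_linear : linear_order lexi.
Proof.
split=> [s|s t|s t u|s t]; rewrite /lexi.
- by rewrite eqxx leqnn orbT.
- move=> /andP[/orP[h|/andP[/eqP h1 h2]] /orP[h'|/andP[/eqP h1' h2']]].
  + by have := ltn_trans h h'; rewrite ltnn.
  + by rewrite h1' ltnn in h.
  + by rewrite h1 ltnn in h'.
  by apply: enum_rank_inj; apply: val_inj; apply/eqP; rewrite eqn_leq h2.
- move=> /orP[h|/andP[/eqP h1 h2]] /orP[h'|/andP[/eqP h1' h2']].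
  + by rewrite (ltn_trans h h').
  + by rewrite -h1' h.
  + by rewrite h1 h'.
  by rewrite h1 h1' eqxx (leq_trans h2 h2') orbT.
by rewrite -(val_eqE s.1) -(val_eqE t.1) /=; case: (ltngtP s.1 t.1) => //= _; apply: leq_total.
Qed.

Definition tuple_support y : {set vertices} := y @: setT.

(** Sort an r-subset by [lexi]: either its first components rise strictly, or two of them
    coincide. *)
Lemma draws_le_rising S : (1 < r)%N ->
  ('C(#|S|, r) <= #|[set y | rising y && [forall i, y i \in S]]| +
    \sum_(p : 'I_r * 'I_r | p.1 != p.2) #|[set y : {ffun 'I_r -> vertices} | (y p.1).1 == (y p.2).1]|)%N.
Proof.
move=> r1; rewrite -cards_draws.
set D := [set e : {set vertices} | _]; set A := [set y | rising y && _].
pose B (p : 'I_r * 'I_r) := [set y : {ffun 'I_r -> vertices} | (y p.1).1 == (y p.2).1].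
have sub : D \subset tuple_support @: A :|: \bigcup_(p | p.1 != p.2) (tuple_support @: B p).
  apply/subsetP => e; rewrite inE => /andP[eS /eqP ce].
  have [psi [inj mono im _]] := role_enum lexi_linear (ltnW r1) ce.
  pose y : {ffun 'I_r -> vertices} := [ffun i => psi i].
  have ey : e = y @: setT.
    by rewrite -im; apply: eq_imset => i; rewrite ffunE.
  have yS : [forall i, y i \in S].
    by apply/forallP => i; apply: (subsetP eS); rewrite ey imset_f.
  rewrite inE; have [ry|/forallPn[i /forallPn[j]]] := boolP (rising y).
    by apply/orP; left; rewrite ey -/(tuple_support y) imset_f // inE ry.
  rewrite negb_imply -leqNgt => /andP[ij hij]; apply/orP; right.
  apply/bigcupP; exists (i, j) => /=; first by rewrite neq_ltn ij.
  rewrite ey -/(tuple_support y) imset_f // inE /=; have := mono i j; rewrite (ltnW ij) /lexi => /esym.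
  by move: hij; rewrite !ffunE leqNgt => /negbTE -> /= /andP[].
apply: leq_trans (subset_leq_card sub) _; rewrite cardsU; apply: leq_trans (leq_subr _ _) _.
apply: leq_add; first exact: leq_imset_card.
elim/big_ind2: _ => [|X a Y b hX hY|p _]; first by rewrite cards0.
  by rewrite cardsU; apply: leq_trans (leq_subr _ _) (leq_add hX hY).
exact: leq_imset_card.
Qed.

Lemma coloured_le_edges S :
  (#|[set y | coloured y && [forall i, y i \in S]]| <= #|@edges_inside r rado S|)%N.
Proof.
rewrite -(card_in_imset (f := fun y : {ffun 'I_r -> vertices} => y @: setT)).
  apply: subset_leq_card; apply/subsetP => e /imsetP[y]; rewrite !inE => /andP[cy /forallP yS] ->.
  apply/andP; split; first exact: imset_f.
  by apply/subsetP => v /imsetP[i _ ->].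
move=> y y'; rewrite !inE => /andP[/coloured_rising ry _] /andP[/coloured_rising ry' _].
exact: rising_imset_inj.
Qed.

Lemma rado_avoids (F : hypergraph r) : (1 < r)%N -> ~ consistent F -> ~ contains rado F.
Proof.
move=> r1 incons [f finj fE]; apply: incons.
pose le : rel F := fun u v => lexi (f u) (f v).
have lelin : linear_order le.
  have [a b c d] := lexi_linear; split => [u|u v h|u v w|u v]; rewrite /le //.
  - by apply: finj; exact: b.
  - exact: c.
exists le => // e g eg.
have colour (e' : {set F}) (p : {set F}) : e' \in edges F -> p \subset e' -> #|p| = 2 ->
    exists u v, [/\ p = [set u; v], ((f u).1 < (f v).1)%N &
      role le r e' p = val ((f v).2 (f u).1)].
  move=> e'E pe cp; have /imsetP[y cy ey] := fE _ e'E; have ry := coloured_rising cy.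
  have pre i : exists u, f u = y i.
    have : y i \in f @: e' by rewrite ey imset_f.
    by case/imsetP => u _ ->; exists u.
  have [phi hphi] := fin_all_exists pre.
  have phiinj : injective phi.
    by move=> i j h; apply: (rising_inj ry); rewrite -!hphi h.
  have im : phi @: setT = e'.
    apply: (imset_inj finj); rewrite -imset_comp ey; apply: eq_imset => i; exact: hphi.
  pose J := phi @^-1: p.
  have eJ : phi @: J = p.
    apply/setP => u; apply/imsetP/idP => [[i]|up]; first by rewrite inE => ip ->.
    have : u \in phi @: setT by rewrite im (subsetP pe).
    by case/imsetP => i _ ui; exists i; rewrite // inE -ui.
  have rJ : role le r e' p = J.
    rewrite -im -eJ (role_imset r (@ordle_linear r) lelin) ?role_ord ?subsetT //.
    - by move=> i j _ _; exact: phiinj.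
    move=> i j _ _; rewrite /ordle /le !hphi leq_eqVlt => /orP[/eqP/val_inj ->|ij].
      by have [refl _ _ _] := lexi_linear.
    by rewrite /lexi (risingP ry ij).
  have cJ : #|J| == 2 by rewrite -cp -eJ card_imset.
  have [i [j [ij eij]]] : exists i j : 'I_r, (i < j)%N /\ J = [set i; j].
    have /cards2P[i [j [ne eij]]] := cJ.
    have [lt|lt|/val_inj eq] := ltngtP i j; last by rewrite eq eqxx in ne.
      by exists i, j.
    by exists j, i; rewrite setUC.
  exists (phi i), (phi j); rewrite !hphi; split.
  - by rewrite -eJ eij imsetU1 imset_set1.
  - exact: risingP.
  rewrite rJ eij; have /forallP/(_ i)/forallP/(_ j)/implyP/(_ ij)/andP[_ /eqP ->] := cy.
  by [].
have [eE gE _ cI] := eg.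
have [u [v [puv lt ->]]] := colour e _ eE (subsetIl e g) cI.
have [u' [v' [puv' lt' ->]]] := colour g _ gE (subsetIr e g) cI.
(* The strict order of first components decides which vertex of the pair comes first, so both edges
   read the same colour off it. *)
have eq2 : [set u; v] = [set u'; v'] by rewrite -puv -puv'.
have : u \in [set u'; v'] by rewrite -eq2 !inE eqxx.
have : v \in [set u'; v'] by rewrite -eq2 !inE eqxx orbT.
have nuv : u != v by apply: contraTneq lt => ->; rewrite ltnn.
rewrite !inE => /orP[]/eqP ev /orP[]/eqP eu; rewrite eu ev // in lt nuv *.
- by rewrite eqxx in nuv.
- by have := ltn_trans lt lt'; rewrite ltnn.
by rewrite eqxx in nuv.
Qed.
End RadoHypergraph.

(** * Edge density of large sets in the coloured hypergraph *)

Section RadoDensity.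
Variables (R : realFieldType) (m r : nat).
Hypothesis r1 : (1 < r)%N.
Hypothesis m_gt0 : (0 < m)%N.
Notation vertices := (rado_vertex m (role_colour r)).
Notation colour := (role_colour r).
Implicit Types (y : {ffun 'I_r -> vertices}) (S : {set vertices}).

Let N : R := #|{: vertices}|%:R.

Lemma role_colour_gt0 : (0 < #|colour|)%N.
Proof. by rewrite card_role_colour bin_gt0. Qed.

Lemma rado_vertex_gt0 : (0 < #|{: vertices}|)%N.
Proof.
rewrite card_rado_vertex muln_gt0 m_gt0 /=; have /card_gt0P[k _] := role_colour_gt0.
by apply/card_gt0P; exists [ffun=> k].
Qed.

Let N0 : 0 < N. Proof. by rewrite ltr0n rado_vertex_gt0. Qed.

Lemma vol_setT : (vol (fun _ : 'I_r => [set: vertices]))%:R = N ^+ r.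
Proof. by rewrite /vol prod_nat_const card_ord cardsT natrX. Qed.

Lemma sum_setT (f : {ffun 'I_r -> vertices} -> R) :
  \sum_(y in family (fun _ : 'I_r => [set: vertices])) f y = \sum_y f y.
Proof. by apply: eq_bigl => y; apply/familyP => i; rewrite inE. Qed.

(* With the other coordinates frozen, v is a product of a condition on the
   first and one on the second coordinate of p. *)
Definition separable (p : 'I_r * 'I_r) (v : {ffun 'I_r -> vertices} -> bool) :=
  forall y, exists a b : vertices -> bool, forall s t,
    v (upd p.1 s (upd p.2 t y)) = a s && b t.

Lemma separable_and p u v : separable p u -> separable p v -> separable p (fun x => u x && v x).
Proof.
move=> hu hv y; have [a [b h]] := hu y; have [a' [b' h']] := hv y.
by exists (fun s => a s && a' s), (fun t => b t && b' t) => s t; rewrite h h' andbACA.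
Qed.

(** Distinct ordered pairs share at most one index, so [v] sees at most one of the two coordinates
    being varied. *)
Lemma separable_dep (p k : 'I_r * 'I_r) (v : {ffun 'I_r -> vertices} -> bool) : dep [set k.1; k.2] v -> (p.1 < p.2)%N -> (k.1 < k.2)%N ->
  p != k -> separable p v.
Proof.
move=> dv pp kk ne y; have p12 : p.1 != p.2 by rewrite neq_ltn pp.
have [h|h] := boolP (p.1 \in [set k.1; k.2]); last first.
  exists xpredT, (fun t => v (upd p.2 t y)) => s t; apply: dv => i ik; rewrite ffunE.
  by case: eqP => // e; rewrite -e ik in h.
have h2 : p.2 \notin [set k.1; k.2].
  move: h; rewrite !inE => /orP[]/eqP h; apply/norP; split; apply/eqP => h'.
  - by rewrite h h' eqxx in p12.
  - by case/eqP: ne; rewrite [p]surjective_pairing h h' -surjective_pairing.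
  - by move: pp kk; rewrite h h' => /ltn_trans h3 /h3; rewrite ltnn.
  by rewrite h h' eqxx in p12.
exists (fun s => v (upd p.1 s y)), xpredT => s t; rewrite andbT; apply: dv => i ik.
rewrite !ffunE; case: eqP => // _; case: eqP => // e; by rewrite -e ik in h2.
Qed.

Lemma separable_all (p : 'I_r * 'I_r) S : p.1 != p.2 -> separable p (fun y => [forall i, y i \in S]).
Proof.
move=> ne y; exists (fun s => (s \in S) && [forall i, (i != p.1) && (i != p.2) ==> (y i \in S)]).
exists (fun t => t \in S) => s t; apply/forallP/andP => [h|[/andP[sS /forallP h] tS] i].
  split; last by have := h p.2; rewrite !ffunE eqxx eq_sym (negbTE ne).
  apply/andP; split; first by have := h p.1; rewrite ffunE eqxx.
  apply/forallP => i; apply/implyP => /andP[/negbTE i1 /negbTE i2].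
  by have := h i; rewrite !ffunE i1 i2.
rewrite !ffunE; case: eqP => // /eqP i1; case: eqP => // /eqP i2.
by have := h i; rewrite i1 i2.
Qed.

Definition rises (p : 'I_r * 'I_r) y := ((y p.1).1 < (y p.2).1)%N.
Definition rises_coloured (p : 'I_r * 'I_r) y :=
  rises p y && (val ((y p.2).2 (y p.1).1) == [set p.1; p.2]).
Definition ordered_pairs := [seq p : 'I_r * 'I_r <- enum {: 'I_r * 'I_r} | (p.1 < p.2)%N].

Lemma mem_ordered_pairs (p : 'I_r * 'I_r) : (p \in ordered_pairs) = (p.1 < p.2)%N.
Proof. by rewrite mem_filter mem_enum andbT. Qed.

Lemma size_ordered_pairs : (size ordered_pairs <= 'C(r, 2))%N.
Proof.
pose f (p : 'I_r * 'I_r) := [set p.1; p.2].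
have inj : {in ordered_pairs &, injective f}.
  move=> [a b] [c d]; rewrite !mem_ordered_pairs /f /= => ab cd e.
  have : a \in [set c; d] by rewrite -e !inE eqxx.
  have : b \in [set c; d] by rewrite -e !inE eqxx orbT.
  rewrite !inE => /orP[]/eqP eb /orP[]/eqP ea; rewrite ea eb ?ltnn // in ab *.
  by have := ltn_trans ab cd; rewrite ltnn.
rewrite -[r in 'C(r, _)]card_ord -card_draws -(size_map f) cardE; apply: uniq_leq_size.
  by rewrite map_inj_in_uniq // filter_uniq // enum_uniq.
move=> e /mapP[p]; rewrite mem_ordered_pairs mem_enum inE => pp ->.
by rewrite cards2 neq_ltn pp.
Qed.

Lemma all_rises y : all (rises^~ y) ordered_pairs = rising y.
Proof.
apply/allP/idP => [h|h p]; last by rewrite mem_ordered_pairs => /(risingP h).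
apply/forallP => i; apply/forallP => j; apply/implyP => ij.
by apply: (h (i, j)); rewrite mem_ordered_pairs.
Qed.

Lemma all_rises_coloured y : all (rises_coloured^~ y) ordered_pairs = coloured y.
Proof.
apply/allP/idP => [h|h p]; last first.
  by rewrite mem_ordered_pairs => pp; have /forallP/(_ p.1)/forallP/(_ p.2)/implyP/(_ pp) := h.
apply/forallP => i; apply/forallP => j; apply/implyP => ij.
by apply: (h (i, j)); rewrite mem_ordered_pairs.
Qed.

(** Resample the two vertices at [p] with all others frozen: [v] splits into one condition on each,
    and [discrepancy] applies to every frozen choice. *)
Lemma colour_step (delta : R) (p : 'I_r * 'I_r) v : 0 < delta -> 1 <= delta ^+ 2 * m%:R -> (p.1 < p.2)%N ->
  separable p v ->
  #|colour|%:R^-1 * (\sum_y (rises p y && v y)%:R) - delta * N ^+ r <=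
  \sum_y (rises_coloured p y && v y)%:R.
Proof.
move=> d0 dm pp sv; have p12 : p.1 != p.2 by rewrite neq_ltn pp.
have c2 : #|[set p.1; p.2]| == 2 by rewrite cards2 p12.
pose c : colour := exist (fun rho : {set 'I_r} => is_true (#|rho| == 2)) [set p.1; p.2] c2.
pose F y : R := (rises p y && v y)%:R * bias R c ((y p.2).2 (y p.1).1).
suff : - (delta * N ^+ r) <= \sum_y F y.
  have -> : \sum_y F y = \sum_y (rises_coloured p y && v y)%:R -
      #|colour|%:R^-1 * (\sum_y (rises p y && v y)%:R).
    rewrite mulr_sumr -sumrB; apply: eq_bigr => y _; rewrite /F /bias /rises_coloured.
    rewrite -(val_eqE _ c) /=; case: (rises p y); case: (v y); case: (_ == _) => /=;
      by rewrite ?mul1r ?mul0r ?mulr1 ?mulr0 ?subrr ?subr0.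
  by lra.
rewrite -(ler_pM2l N0) -(ler_pM2l N0) [X in _ <= _ * X](sum_upd p.1 F) (sum_upd p.2).
have -> : N * (N * - (delta * N ^+ r)) = \sum_(y : {ffun 'I_r -> vertices}) - (delta * N ^+ 2).
  rewrite sumr_const card_ffun card_ord -mulr_natr natrX -/N; ring.
apply: ler_sum => y _; have [a [b hab]] := sv y.
apply: le_trans (discrepancy role_colour_gt0 c a b d0 dm) _.
have eF s t : F (upd p.1 s (upd p.2 t y)) = (a s && b t && (s.1 < t.1)%N)%:R * bias R c (t.2 s.1).
  have u1 : upd p.1 s (upd p.2 t y) p.1 = s by rewrite ffunE eqxx.
  have u2 : upd p.1 s (upd p.2 t y) p.2 = t.
    by rewrite ffunE eq_sym (negbTE p12) ffunE eqxx.
  by rewrite /F hab /rises u1 u2 [X in (nat_of_bool X)%:R]andbC.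
rewrite [leLHS]exchange_big.
apply: ler_sum => t _.
apply: ler_sum => s _.
by rewrite eF.
Qed.

Lemma coloured_ge (delta : R) S : 0 < delta -> 1 <= delta ^+ 2 * m%:R ->
  'C(r, 2)%:R ^- 'C(r, 2) * #|[set y | rising y && [forall i, y i \in S]]|%:R
    - 'C(r, 2)%:R * (delta * N ^+ r) <=
  #|[set y | coloured y && [forall i, y i \in S]]|%:R.
Proof.
move=> d0 dm; set K := 'C(r, 2); have Kc : #|colour| = K by exact: card_role_colour.
have Kr : 0 < K%:R :> R by rewrite ltr0n bin_gt0.
have eta01 : 0 <= (K%:R^-1 : R) <= 1.
  by rewrite invr_ge0 ler0n invf_le1 // ler1n bin_gt0.
have card_sum (u : {ffun 'I_r -> vertices} -> bool) : #|[set y | u y]|%:R =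
    bsum R (fun _ : 'I_r => [set: vertices]) u.
  rewrite /bsum sum_setT -sum1_card natr_sum big_mkcond /=.
  by apply: eq_bigr => y _; rewrite inE; case: (u y).
have dep1 (k : 'I_r * 'I_r) : dep [set k.1; k.2] (rises k).
  by move=> x y e; rewrite /rises !e // !inE eqxx ?orbT.
have dep2 (k : 'I_r * 'I_r) : dep [set k.1; k.2] (rises_coloured k).
  by move=> x y e; rewrite /rises_coloured /rises !e // !inE eqxx ?orbT.
have tel := telescope_lower (V := fun _ : 'I_r => [set: vertices]) separable_and
  (b := rises_coloured) (g := rises) eta01 (ltW d0) (s := ordered_pairs)
  (u := fun y => [forall i, y i \in S]).
rewrite !card_sum; set A := bsum _ _ _; set B := bsum _ _ _.
have {}tel : K%:R^-1 ^+ size ordered_pairs * A - (size ordered_pairs)%:R * (delta * N ^+ r) <= B.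
  have eA : A = bsum R (fun _ : 'I_r => [set: vertices])
     (fun y => all (rises^~ y) ordered_pairs && [forall i, y i \in S]).
    by apply: bsum_eq => y; rewrite all_rises.
  have eB : B = bsum R (fun _ : 'I_r => [set: vertices])
     (fun y => all (rises_coloured^~ y) ordered_pairs && [forall i, y i \in S]).
    by apply: bsum_eq => y; rewrite all_rises_coloured.
  rewrite eA eB -vol_setT; apply: tel.
  - by rewrite filter_uniq // enum_uniq.
  - move=> p v; rewrite mem_ordered_pairs => pp sv.
    by rewrite vol_setT /bsum !sum_setT -Kc; exact: colour_step.
  - move=> p k; rewrite !mem_ordered_pairs => pp kk ne.
    by split; apply: (separable_dep _ pp kk ne); [exact: dep2 | exact: dep1].
  by move=> p; rewrite mem_ordered_pairs => pp; apply: separable_all; rewrite neq_ltn pp.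
apply: le_trans tel; apply: lerB.
  rewrite -exprVn; apply: ler_wpM2r; first exact: sumr_ge0.
  by case/andP: eta01 => e0 e1; apply: ler_wiXn2l => //; exact: size_ordered_pairs.
apply: ler_wpM2r; first by rewrite mulr_ge0 ?exprn_ge0 // ltW.
by rewrite ler_nat size_ordered_pairs.
Qed.

Lemma card_same_first (p : 'I_r * 'I_r) : p.1 != p.2 ->
  m%:R * #|[set y : {ffun 'I_r -> vertices} | (y p.1).1 == (y p.2).1]|%:R = N ^+ r.
Proof.
move=> ne; have eN : N = m%:R * #|{: {ffun 'I_m -> colour}}|%:R.
  by rewrite /N card_rado_vertex natrM.
set M := #|_|%:R in eN; have M0 : M != 0.
  by apply: contraTneq N0 => h; rewrite eN h mulr0 ltxx.
have e1 : #|[set y : {ffun 'I_r -> vertices} | (y p.1).1 == (y p.2).1]|%:R =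
    \sum_(y : {ffun 'I_r -> vertices}) ((y p.1).1 == (y p.2).1)%:R :> R.
  rewrite -sum1_card natr_sum big_mkcond /=.
  by apply: eq_bigr => y _; rewrite inE; case: (_ == _).
apply: (mulIf M0); rewrite mulrAC -eN e1 (sum_upd p.2).
have -> : N ^+ r * M = \sum_(y : {ffun 'I_r -> vertices}) M.
  by rewrite sumr_const card_ffun card_ord -mulr_natl natrX.
apply: eq_bigr => y _.
have e (t : vertices) : ((upd p.2 t y p.1).1 == (upd p.2 t y p.2).1) = ((y p.1).1 == t.1).
  by rewrite !ffunE (negbTE ne) eqxx.
transitivity (\sum_(t : vertices) ((y p.1).1 == t.1)%:R : R).
  by apply: eq_bigr => t _; rewrite e.
rewrite sum_rado (bigD1 (y p.1).1) //= [X in _ + X]big1 => [|x nx].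
  by rewrite addr0 eqxx sumr_const.
by apply: big1 => z _; rewrite eq_sym (negbTE nx).
Qed.

(** The error has one part from replacing the colour conditions and one from tuples with a repeated
    first component. *)
Theorem rado_density (delta : R) S : 0 < delta -> 1 <= delta ^+ 2 * m%:R ->
  'C(r, 2)%:R ^- 'C(r, 2) * 'C(#|S|, r)%:R - ('C(r, 2)%:R * delta + r%:R ^+ 2 / m%:R) * N ^+ r <=
  #|@edges_inside r (rado m r) S|%:R.
Proof.
move=> d0 dm; set K := 'C(r, 2); have mr : 0 < m%:R :> R by rewrite ltr0n.
apply: le_trans (_ : _ <= #|[set y | coloured y && [forall i, y i \in S]]|%:R) _; last first.
  by rewrite ler_nat; exact: coloured_le_edges.
apply: le_trans (coloured_ge S d0 dm); rewrite -/K.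
set A := #|_|%:R.
have hC : 'C(#|S|, r)%:R <= A + r%:R ^+ 2 / m%:R * N ^+ r.
  have := draws_le_rising S r1; rewrite -(ler_nat R) natrD => /le_trans; apply.
  rewrite lerD2l natr_sum.
  apply: (@le_trans _ _ (\sum_(p : 'I_r * 'I_r | p.1 != p.2) N ^+ r / m%:R)).
    apply: ler_sum => p ne; rewrite ler_pdivlMr // mulrC card_same_first //.
  have c0 : 0 <= N ^+ r / m%:R by rewrite divr_ge0 ?exprn_ge0 // ltW.
  have -> : r%:R ^+ 2 / m%:R * N ^+ r = (N ^+ r / m%:R) *+ (r * r).
    by rewrite -[RHS]mulr_natl natrM; ring.
  rewrite sumr_const; apply: ler_wpMn2l => //.
  by apply: leq_trans (max_card _) _; rewrite card_prod card_ord.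
have p0 : 0 <= K%:R ^- K :> R by rewrite invr_ge0 exprn_ge0.
have p1 : K%:R ^- K <= 1 :> R.
  by rewrite invf_le1 ?exprn_gt0 ?ltr0n ?bin_gt0 // exprn_ege1 // ler1n bin_gt0.
have q0 : 0 <= r%:R ^+ 2 / m%:R * N ^+ r by rewrite mulr_ge0 ?divr_ge0 ?exprn_ge0 // ltW.
have h1 := ler_wpM2l p0 hC.
have h2 : K%:R ^- K * (r%:R ^+ 2 / m%:R * N ^+ r) <= r%:R ^+ 2 / m%:R * N ^+ r.
  by rewrite ler_piMl.
move: h1 h2; set B := r%:R ^+ 2 / m%:R; set a := K%:R ^- K; set n := N ^+ r.
by move: B a n => B a n; lra.
Qed.
End RadoDensity.

Theorem rado_locally_dense (R : archiRealFieldType) r (eps : R) : (1 < r)%N -> 0 < eps ->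
  exists m0, forall m, (m0 <= m)%N -> forall S : {set rado m r},
    eps * #|rado m r|%:R <= #|S|%:R ->
    ('C(r, 2)%:R ^- 'C(r, 2) - eps) * 'C(#|S|, r)%:R <= #|edges_inside S|%:R.
Proof.
move=> r1 e0; set K := 'C(r, 2).
have Kr : 0 < K%:R :> R by rewrite ltr0n bin_gt0.
(* [B] bounds the ratio of N^r to the binomial of [#|S|], so that errors in N^r become relative
   ones; the factor 2^r comes from #|S| - r >= #|S|/2. Then [delta] makes the colouring error eps/2,
   and [m2] does the same for repeated first components. *)
pose B : R := (r`!)%:R * 2 ^+ r / eps ^+ r.
have B0 : 0 < B by rewrite divr_gt0 ?mulr_gt0 ?exprn_gt0 // ltr0n fact_gt0.
pose delta := eps / (2 * K%:R * B); have d0 : 0 < delta.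
  exact: divr_gt0 e0 (mulr_gt0 (mulr_gt0 (ltr0Sn _ 1) Kr) B0).
have [m1 h1] := nat_above (delta ^- 2).
have [m2 h2] := nat_above (2 * r%:R ^+ 2 * B / eps).
have [m3 h3] := nat_above (2 * r%:R / eps).
exists (m1 + m2 + m3).+1 => m hm S Sbig.
have m_gt0 : (0 < m)%N by apply: leq_trans hm.
have mr : 0 < m%:R :> R by rewrite ltr0n.
have le_m n : (n <= m1 + m2 + m3)%N -> n%:R <= m%:R :> R.
  by move=> hn; rewrite ler_nat; apply: leq_trans hn (ltnW hm).
have {}h1 : 1 <= delta ^+ 2 * m%:R.
  rewrite mulrC -ler_pdivrMr ?exprn_gt0 // mul1r; apply: le_trans h1 _.
  by apply: le_m; lia.
have {}h2 : r%:R ^+ 2 / m%:R * B <= eps / 2.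
  have : 2 * r%:R ^+ 2 * B / eps <= m%:R by apply: le_trans h2 _; apply: le_m; lia.
  rewrite ler_pdivrMr // => h; rewrite mulrAC ler_pdivrMr //; lra.
have {}h3 : 2 * r%:R <= eps * m%:R.
  have : 2 * r%:R / eps <= m%:R by apply: le_trans h3 _; apply: le_m; lia.
  by rewrite ler_pdivrMr // [m%:R * _]mulrC.
have N_ge : m%:R <= #|rado m r|%:R :> R.
  rewrite ler_nat /= card_rado_vertex leq_pmulr //.
  by have := rado_vertex_gt0 r1 m_gt0; rewrite card_rado_vertex muln_gt0 => /andP[].
have S2r : (2 * r <= #|S|)%N.
  rewrite -(ler_nat R) natrM; apply: le_trans h3 _; apply: le_trans Sbig.
  by rewrite ler_wpM2l // ltW.
have NC : #|rado m r|%:R ^+ r <= 'C(#|S|, r)%:R * B.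
  have a1 : #|rado m r|%:R <= #|S|%:R / eps by rewrite ler_pdivlMr // mulrC.
  have a2 : #|rado m r|%:R ^+ r <= (#|S|%:R / eps) ^+ r.
    by apply: lerXn2r => //; rewrite nnegrE ?ler0n //; exact: divr_ge0 (ler0n _ _) (ltW e0).
  apply: le_trans a2 _; rewrite expr_div_n /B mulrA ler_wpM2r ?invr_ge0 ?exprn_ge0 ?(ltW e0) //.
  rewrite mulrA -natrM bin_ffact -!natrX -natrM ler_nat.
  apply: (@leq_trans ((2 * (#|S| - r)) ^ r)); first by rewrite leq_exp2r //; lia.
  by rewrite expnMn mulnC leq_mul2r exp_le_ffact orbT.
have := rado_density r1 m_gt0 S d0 h1; rewrite -/K => /(le_trans _); apply.
rewrite mulrBl lerD2l lerN2.
have c0 : 0 <= K%:R * delta + r%:R ^+ 2 / m%:R.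
  exact: addr_ge0 (mulr_ge0 (ltW Kr) (ltW d0)) (divr_ge0 (exprn_ge0 _ (ler0n _ _)) (ltW mr)).
apply: le_trans (ler_wpM2l c0 NC) _; rewrite mulrCA mulrC ler_wpM2r // mulrDl.
have -> : K%:R * delta * B = eps / 2 by rewrite /delta; field; rewrite !gt_eqF.
by move: h2; set z := _ / m%:R * B; lra.
Qed.

(* Passage to sequences and the extremal value *)
From mathcomp Require Import all_classical all_reals all_analysis.

Local Open Scope ring_scope.

Lemma avoidable_lower (R : realType) (r : nat) (F : hypergraph r) :
  (1 < r)%N -> ~ consistent F -> avoidable_density F ('C(r, 2)%:R ^- 'C(r, 2) : R).
Proof.
move=> r1 incons.
have seq (k : nat) : exists m, (k <= m)%N /\
    eps_dense ('C(r, 2)%:R ^- 'C(r, 2) : R) (harmonic k) (rado m r).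
  have [m0 hm0] := rado_locally_dense r1 (@harmonic_gt0 R k).
  (* Taking at least [k] first components makes the number of vertices tend to infinity. *)
  by exists (maxn k m0); split; [exact: leq_maxl | exact: hm0 (leq_maxr _ _)].
have [mm hmm] := boolp.choice seq.
exists (fun k => rado (mm k) r); last by move=> k; exact: rado_avoids.
split; first by exists harmonic; [exact: cvg_harmonic | move=> k; case: (hmm k)].
apply/cvgnyPge => A; near=> k.
apply: (@leq_trans k); first by near: k; exact: nbhs_infty_ge.
have [km _] := hmm k; have [k0|k0] := posnP k; first by rewrite k0.
have m_gt0 : (0 < mm k)%N by exact: leq_trans k0 km.
apply: leq_trans km _; rewrite /= card_rado_vertex leq_pmulr //.
by have := rado_vertex_gt0 r1 m_gt0; rewrite card_rado_vertex muln_gt0 => /andP[].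
Unshelve. all: by end_near. Qed.

Theorem theorem3p2 (R : realType) (r : nat) (F : hypergraph r) (hr : (3 <= r)%N)
    (F_quasi_linear : quasi_linear F) (F_inconsistent : ~ consistent F)
    (F_admits : forall s : (2 * r - 2).-tuple letter,
       descriptive s -> ~~ consistent_seq s -> admits F s) :
  pi_u_eq F ('C(r, 2)%:R ^- 'C(r, 2) : R).
Proof.
split; first by apply: avoidable_lower => //; exact: ltnW.
move=> d' [H [[eps eps0 dense] Hinfty] avoid]; rewrite leNgt; apply/negP => dd'.
have K1 : (1 < 'C(r, 2))%N.
  by apply: (@leq_trans 'C(3, 2)) => //; exact: leq_bin2l.
have d1 : 'C(r, 2)%:R ^- 'C(r, 2) < 1 :> R.
  by rewrite invf_lt1 ?exprn_gt0 ?ltr0n ?(ltnW K1) // exprn_egt1 ?ltr1n // -lt0n ltnW.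
(* [dense_contains] asks for a density of at most 1. Capping [d'] there keeps it above the claimed
   value, which is below 1 because ['C(r, 2)] exceeds 1. *)
have dmin : 'C(r, 2)%:R ^- 'C(r, 2) < Num.min d' 1 by rewrite lt_min dd'.
have min1 : Num.min d' 1 <= 1 by rewrite ge_min lexx orbT.
have [e0 e00 [N0 hN0]] := dense_contains hr F_quasi_linear F_admits dmin min1.
have ev : \forall n \near \oo%classic, eps n <= e0 /\ (N0 <= #|vertex (H n)|)%N.
  near=> n; split; last by near: n; move/cvgnyPge: Hinfty; exact.
  by apply: ltW; near: n; exact: (cvgr_lt 0 eps0).
have [n _ /(_ n (leqnn n)) /= [en Nn]] := ev.
apply: (avoid n); apply: (hN0 _ Nn) => U hU.
have := dense n U; have Nge0 : 0 <= #|vertex (H n)|%:R :> R by [].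
move=> h; apply: le_trans (h _); last by apply: le_trans hU; exact: ler_wpM2r.
rewrite ler_wpM2r // lerB // ge_min lexx //.
Unshelve. all: by end_near. Qed.
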